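(* Let $n\in\mathbb{N}$ and $s\in[n]$. Let $v_1,\ldots,v_n$ be vectors in $\{-M,\ldots,M\}^\alpha$, where $M=n^{O(1)}$ and $\alpha\le n$. Define the sets $A_i=\{v_i,v_{i+1},\ldots,v_{i+s-1}\}$ for $i\in[n-s+1]$. Let $t=O(\log^2 n)$. One can compute (randomized) vectors $q_i\in\ell_1^t$ for $i\in[n-s+1]$ such that for any $i,j\in[n-s+1]$, with high probability, $$\mathrm{TEMD}(A_i,A_j)\le \|q_i-q_j\|_1\le \mathrm{TEMD}(A_i,A_j)\cdot \log^{O(1)} n.$$ Furthermore, computing all vectors $q_i$ takes $\tilde O(n\alpha)$ time.
   Context: $[n]=\{1,\ldots,n\}$. $\ell_1^t$ denotes $\mathbb{R}^t$ with the norm $\|x\|_1=\sum_i|x_i|$. For sets (collections) $A,B$ of the same size $s$ of points in a metric space $(M,d_M)$ (here $\mathbb{R}^\alpha$ with the $\ell_1$ distance), the thresholded Earth-Mover Distance is $\mathrm{TEMD}(A,B)=\frac1s\min_{\tau:A\to B}\sum_{a\in A}\min\{d_M(a,\tau(a)),s\}$, where $\tau$ ranges over all bijections from $A$ to $B$. ''With high probability'' means with probability $1-1/p(n)$ for a sufficiently large polynomial $p$. $\tilde O(f)$ denotes $f\cdot\log^{O(1)} f$. *)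

(* Defs.v *)
From mathcomp Require Import all_boot all_order all_algebra all_fingroup.
From mathcomp Require Export reals exp.

Set Implicit Arguments.
Unset Strict Implicit.
Unset Printing Implicit Defensive.

Import Order.TTheory GRing.Theory Num.Theory.
Local Open Scope ring_scope.

Definition l1norm (R : numDomainType) (d : nat) (x : 'rV[R]_d) : R :=
  \sum_(k < d) `|x 0 k|.

Definition l1dist (R : numDomainType) (d : nat) (x y : 'rV[R]_d) : R :=
  l1norm (x - y).

(* A collection of s points is a family indexed by 'I_s (repeated points are
   allowed), so that bijections between two collections are permutations of
   'I_s.  The default value of the minimum is the cost of the identity, itself
   one of the values being minimized. *)
Section TEMD.
Variables (R : realFieldType) (T : Type) (dist : T -> T -> R) (s : nat).

Definition temd_cost (A B : 'I_s -> T) (tau : 'S_s) : R :=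
  \sum_(k < s) Num.min (dist (A k) (B (tau k))) s%:R.

Definition TEMD (A B : 'I_s -> T) : R :=
  s%:R^-1 *
  \big[Num.min/temd_cost A B 1%g]_(tau : 'S_s) temd_cost A B tau.

End TEMD.

Lemma window_subproof (n s : nat) (le_sn : (s <= n)%N)
  (i : 'I_(n - s + 1)) (k : 'I_s) : (i + k < n)%N.
Proof.
have le_i : (i <= n - s)%N
  by move: (ltn_ord i); rewrite [X in (_ < X)%N]addn1.
rewrite -[X in (_ < X)%N](subnK le_sn) -addnS.
exact: leq_add le_i (ltn_ord k).
Qed.

(* The collection {v_i, ..., v_(i+s-1)}, with indices starting at 0. *)
Definition window (T : Type) (n s : nat) (le_sn : (s <= n)%N) (v : 'I_n -> T)
    (i : 'I_(n - s + 1)) (k : 'I_s) : T :=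
  v (Ordinal (window_subproof le_sn i k)).

(* Randomized random-access machine with structured control flow, under the
   logarithmic cost criterion: every operation is charged the bit length of
   the integers (including memory addresses) it manipulates, hence at least 1.
   Compared with a RAM with words of O(log n) bits and unit cost, running
   times agree up to polylogarithmic factors.  Memory cells are indexed by all
   of int, so negative addresses can serve as registers. *)

Inductive binop := OpAdd | OpSub | OpMul | OpDiv | OpLeq.

Inductive expr :=
  | Const of int
  | Fetch of expr
  | Op of binop & expr & expr.

Inductive cmd :=
  | Skip
  | Store of expr & expr          (* address, value *)
  | Toss of expr                  (* stores a fair random bit at an address *)
  | Seq of cmd & cmd
  | If of expr & cmd & cmd
  | While of expr & cmd.

Definition memory := int -> int.

Definition bitlen (z : int) : nat := (trunc_log 2 `|z|%N).+1.

Definition eval_op (o : binop) (x y : int) : int :=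
  match o with
  | OpAdd => x + y
  | OpSub => x - y
  | OpMul => x * y
  | OpDiv => (x %/ y)%Z
  | OpLeq => (x <= y)%R%:Z
  end.

Fixpoint eval (m : memory) (e : expr) : int :=
  match e with
  | Const z => z
  | Fetch a => m (eval m a)
  | Op o e1 e2 => eval_op o (eval m e1) (eval m e2)
  end.

Fixpoint eval_time (m : memory) (e : expr) : nat :=
  match e with
  | Const z => bitlen z
  | Fetch a => eval_time m a + bitlen (eval m a) + bitlen (m (eval m a))
  | Op _ e1 e2 => eval_time m e1 + eval_time m e2
                  + bitlen (eval m e1) + bitlen (eval m e2)
  end%N.

Definition update (m : memory) (a z : int) : memory :=
  fun a' => if a' == a then z else m a'.

Record config := Config {
  cf_todo : seq cmd;              (* commands still to be executed, in order *)
  cf_mem : memory;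
  cf_coins : seq bool;            (* random bits not yet consumed *)
  cf_time : nat }.                (* total cost so far *)

(* Exhausted coins read as false; this never happens in a run of total cost at
   most the number of coins supplied, since each toss costs at least 1. *)
Definition step (cf : config) : config :=
  let: Config k m r w := cf in
  match k with
  | [::] => cf
  | Skip :: k' => Config k' m r (w + 1)
  | Store a e :: k' =>
      Config k' (update m (eval m a) (eval m e)) r
        (w + (eval_time m a + eval_time m e
              + bitlen (eval m a) + bitlen (eval m e)))
  | Toss a :: k' =>
      Config k' (update m (eval m a) (head false r)%:Z) (behead r)
        (w + (eval_time m a + bitlen (eval m a) + 1))
  | Seq c1 c2 :: k' => Config [:: c1, c2 & k'] m r (w + 1)
  | If e c1 c2 :: k' =>
      Config ((if eval m e != 0 then c1 else c2) :: k') m r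
        (w + (eval_time m e + bitlen (eval m e)))
  | While e c :: k' =>
      Config (if eval m e != 0 then [:: c, While e c & k'] else k') m r
        (w + (eval_time m e + bitlen (eval m e)))
  end%N.

(* As each step costs at least 1, a run of total cost at most T has halted
   after T steps. *)
Definition run (P : cmd) (m : memory) (T : nat) (r : seq bool) : config :=
  iter T step (Config [:: P] m r 0).

Definition halts_within (P : cmd) (m : memory) (T : nat) (r : seq bool) :
    Prop :=
  cf_todo (run P m T r) = [::] /\ (cf_time (run P m T r) <= T)%N.

(* The input n, s, alpha, M, v_1, ..., v_n occupies consecutive cells from
   address 0 on, each vector being listed coordinate by coordinate; all other
   cells hold 0. *)
Definition input_memory (n s alpha M : nat) (v : 'I_n -> 'rV[int]_alpha) :
    memory :=
  let inp := [:: n%:Z; s%:Z; alpha%:Z; M%:Z]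
             ++ [seq v i 0 k | i <- enum 'I_n, k <- enum 'I_alpha] in
  fun a => if a is Posz p then nth 0 inp p else 0.

(* Output vectors are rational: cell 0 holds a common denominator, and the
   numerators follow, vector by vector. *)
Definition output_vector (R : fieldType) (t : nat) (m : memory) (i : nat) :
    'rV[R]_t :=
  \row_(k < t) ((m (1 + i * t + k)%N%:Z)%:~R / (m 0)%:~R).

(* Probability of an event over T independent fair coin tosses. *)
Definition prob (R : fieldType) (T : nat) (E : pred (T.-tuple bool)) : R :=
  #|E|%:R / 2 ^+ T.

(* Main.v *)
(* Every window gets a label for each of polylogarithmically many classes.  A
   class shifts a hierarchy of grids of side 2^l at random, counts the points of
   the window in each cell, rounds these counts at scale 2^rho with a second
   random grid, and hashes the result.  With high probability windows sharing a
   label of scale rho are at transportation distance at most 2^rho up to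
   polylogarithmic factors, since the counts control a greedy matching along the
   nested cells; conversely windows at distance about 2^rho share a label of that
   scale with probability at least 1/2, hence in one of the repetitions.  Joining
   windows with a common label by edges of length 2^rho thus gives a graph metric
   approximating TEMD, and distances to random sets of windows, computed by
   Dijkstra's algorithm through the classes, embed it into l1 as in Bourgain's
   theorem. *)

Require Import Defs.
From mathcomp Require boolp.
From mathcomp Require Import sequences.
From mathcomp Require Import all_boot all_order all_algebra all_fingroup zify ring lra.

Set Implicit Arguments.
Unset Strict Implicit.
Unset Printing Implicit Defensive.

Import Order.TTheory GRing.Theory Num.Theory.

(** * Finite product probability spaces *)

Local Open Scope ring_scope.

(** The time bound leaves no room for [s] operations per window. Consecutive windows differ by one
    point leaving and one entering, and the hash is linear in the rounded counts, so one insertion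
    and one deletion update it. Nor is the graph ever listed edge by edge: each bucket of equal
    labels is a clique with one edge length, and Dijkstra opens it once. Shortest-path distances are
    treated as greatest Lipschitz functions vanishing on the sources, so no path is written down.
    The classes of the top scale give all windows one label, with an edge at least as long as any
    distance, which keeps the graph connected. Bourgain's average over coordinates is replaced by
    repetition: with high probability some coordinate separates a given pair, the others being
    merely nonnegative, and the factor [vF] repays all losses. Distances are kept as integers, [s]
    times [TEMD], until the output is divided by [s]. Cost and correctness are separated: every
    stored value is reduced modulo a polynomial [cap], which bounds the cost of any program, and
    correctness shows that the reduction never acts. *)

Section ProductSpace.
Variables (R : realType) (I V : finType).
Hypothesis V_gt0 : (0 < #|V|)%N.
Local Notation Om := {ffun I -> V}.
Implicit Types (X Y : Om -> R) (Q : pred Om).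

Definition Ex X : R := (\sum_w X w) / #|Om|%:R.
Definition Pr Q : R := Ex (fun w => (Q w)%:R).

Lemma card_Om_gt0 : 0 < #|Om|%:R :> R.
Proof. by rewrite ltr0n card_ffun expn_gt0 V_gt0. Qed.

Lemma Ex_le X Y : (forall w, X w <= Y w) -> Ex X <= Ex Y.
Proof.
by move=> H; rewrite /Ex ler_wpM2r ?invr_ge0 ?ler0n //; apply: ler_sum.
Qed.

Lemma eq_Ex X Y : X =1 Y -> Ex X = Ex Y.
Proof. by move=> H; congr (_ / _); apply: eq_bigr. Qed.

Lemma Ex_cst (a : R) : Ex (fun=> a) = a.
Proof.
by rewrite /Ex sumr_const -[a *+ _]mulr_natr mulfK // gt_eqF // card_Om_gt0.
Qed.

Lemma Ex_scale (a : R) X : Ex (fun w => a * X w) = a * Ex X.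
Proof. by rewrite /Ex -mulr_sumr mulrA. Qed.

Lemma Ex_sum (J : Type) (r : seq J) (F : J -> Om -> R) :
  Ex (fun w => \sum_(j <- r) F j w) = \sum_(j <- r) Ex (F j).
Proof. by rewrite /Ex exchange_big /= mulr_suml. Qed.

Lemma Pr_sub Q Q' : (forall w, Q w -> Q' w) -> Pr Q <= Pr Q'.
Proof.
by move=> H; apply: Ex_le => w; rewrite ler_nat; case: (Q w) (H w) => // /(_ isT)->.
Qed.

Lemma Pr_ge0 Q : 0 <= Pr Q.
Proof. by rewrite -(Ex_cst 0); apply: Ex_le => w. Qed.

Lemma Pr_le1 Q : Pr Q <= 1.
Proof. by rewrite -(Ex_cst 1); apply: Ex_le => w; rewrite lern1; case: (Q w). Qed.

Lemma PrC Q : Pr Q = 1 - Pr (fun w => ~~ Q w).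
Proof.
apply/eqP; rewrite eq_sym subr_eq -{1}(Ex_cst 1) /Pr /Ex -mulrDl -big_split /=.
by apply/eqP; congr (_ / _); apply: eq_bigr => w _; case: (Q w); rewrite ?addr0 ?add0r.
Qed.

Lemma PrU Q Q' : Pr (fun w => Q w || Q' w) <= Pr Q + Pr Q'.
Proof.
rewrite /Pr /Ex -mulrDl -big_split /=; apply: Ex_le => w.
by case: (Q w) (Q' w) => [] []; rewrite ?addr0 ?add0r // lerDl ler01.
Qed.

Lemma Pr_has (J : eqType) (r : seq J) (F : J -> pred Om) :
  Pr (fun w => has (fun j => F j w) r) <= \sum_(j <- r) Pr (F j).
Proof.
elim: r => [|j r IH] /=; first by rewrite big_nil /Pr Ex_cst.
by rewrite big_cons; apply: le_trans (PrU _ _) _; rewrite lerD2l.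
Qed.

Lemma Pr_exists_le (J : finType) (F : J -> pred Om) (p : R) :
  (forall j, Pr (F j) <= p) -> Pr (fun w => [exists j, F j w]) <= #|J|%:R * p.
Proof.
move=> H; apply: le_trans (_ : \sum_j Pr (F j) <= _); last first.
  by rewrite mulr_natl -sumr_const; apply: ler_sum.
rewrite /index_enum; apply: le_trans (Pr_has _ _); apply: Pr_sub => w /existsP[j jw].
by apply/hasP; exists j => //; rewrite mem_index_enum.
Qed.

(** Conditioning by resampling: [w] stays frozen outside [J] and [w'] supplies fresh values
    inside. *)
Definition merge (J : pred I) (w w' : Om) : Om := [ffun i => if J i then w' i else w i].

(** Exchanging the [J] coordinates of [w] and [w'] is an involution of the set of pairs, so a
    half-resampled point is again uniform. *)
Lemma Ex_merge J X : Ex X = Ex (fun w => Ex (fun w' => X (merge J w w'))).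
Proof.
rewrite /Ex; set c := #|_|%:R; under [in RHS]eq_bigr do rewrite mulr_suml.
rewrite pair_big /= (reindex (fun p : Om * Om => (merge J p.1 p.2, merge J p.2 p.1))) /=.
  rewrite (eq_bigr (fun p : Om * Om => X p.1 / c)); last first.
    move=> p _; congr (X _ / _); apply/ffunP => i; rewrite !ffunE.
    by case: (J i).
  rewrite -(pair_big xpredT xpredT (fun w _ => X w / c)) /=.
  congr (_ / _); apply: eq_bigr => w _.
  by rewrite sumr_const -[_ *+ _]mulr_natr -/c mulfVK // gt_eqF // card_Om_gt0.
exists (fun p : Om * Om => (merge J p.1 p.2, merge J p.2 p.1)) => -[w w'] _ /=;
  congr (_, _); apply/ffunP => i; rewrite !ffunE; by case: (J i).
Qed.

Lemma Pr_merge_le J Q (p : R) :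
  (forall w, Pr (fun w' => Q (merge J w w')) <= p) -> Pr Q <= p.
Proof.
by move=> H; rewrite /Pr (Ex_merge J) -(Ex_cst p); apply: Ex_le => w; apply: H.
Qed.

Lemma Pr_merge_Ex J Q X :
  (forall w, Pr (fun w' => Q (merge J w w')) <= X w) -> Pr Q <= Ex X.
Proof. by move=> H; rewrite /Pr (Ex_merge J); apply: Ex_le => w; apply: H. Qed.

Lemma Pr_indep J Q Q' :
  (forall w w', Q (merge J w w') = Q w) ->
  (forall w w', Q' (merge J w w') = Q' w') ->
  Pr (fun w => Q w && Q' w) = Pr Q * Pr Q'.
Proof.
move=> HQ HQ'; rewrite {1}/Pr (Ex_merge J) mulrC /Pr -Ex_scale; apply: eq_Ex => w.
rewrite mulrC -Ex_scale; apply: eq_Ex => w'.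
by rewrite HQ HQ' -mulnb natrM.
Qed.

(** Amplification: repetitions that read disjoint blocks of coordinates fail together with at most
    the product probability. The head block is resampled against the others, whose events do not see
    it. *)
Lemma Pr_blocks (K : eqType) (r : seq K) (B : K -> pred I) (F : K -> pred Om) (p : R) :
  uniq r -> 0 <= p ->
  (forall z z' i, z != z' -> B z i -> ~~ B z' i) ->
  (forall z (w w' : Om), (forall i, B z i -> w i = w' i) -> F z w = F z w') ->
  (forall z, z \in r -> Pr (F z) <= p) ->
  Pr (fun w => all (fun z => F z w) r) <= p ^+ size r.
Proof.
move=> + p0 disj dep; elim: r => [|z r IH] /=; first by rewrite Pr_le1.
case/andP=> zr ur Hp; rewrite exprS.
have IHr : Pr (fun w => all (fun z => F z w) r) <= p ^+ size r.
  by apply: IH => // z' z'r; apply: Hp; rewrite inE z'r orbT.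
rewrite (_ : Pr _ = Pr (fun w => all (fun z => F z w) r && F z w)); last first.
  by apply: eq_Ex => w; rewrite andbC.
rewrite (@Pr_indep (B z)).
- rewrite mulrC; apply: ler_pM => //; rewrite ?Pr_ge0 //.
  by apply: Hp; rewrite mem_head.
- move=> w w'; apply: eq_in_all => z' z'r; apply: dep => i Bi; rewrite ffunE.
  case: ifP => // Bzi; have zz' : z != z' by apply: contraNneq zr => ->.
  by move: (disj z z' i zz' Bzi); rewrite Bi.
- by move=> w w'; apply: dep => i Bi; rewrite ffunE Bi.
Qed.

Lemma Ex_prod (G : I -> V -> R) :
  Ex (fun w => \prod_i G i (w i)) = \prod_i ((\sum_v G i v) / #|V|%:R).
Proof.
rewrite /Ex -(bigA_distr_bigA G) big_split /=; congr (_ * _).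
by rewrite prodr_const card_ffun natrX exprVn.
Qed.

(** Independence of distinct coordinates. By injectivity the fibre of [f] over each [i] has at most
    one element, and a coordinate outside the image contributes the factor 1. *)
Lemma Pr_all (J : finType) (f : J -> I) (F : J -> pred V) : injective f ->
  Pr (fun w => [forall j, F j (w (f j))]) = \prod_j (#|F j|%:R / #|V|%:R).
Proof.
move=> f_inj.
transitivity (Ex (fun w => \prod_i \prod_(j | f j == i) (F j (w i))%:R)).
  apply: eq_Ex => w; rewrite [RHS](_ : _ = \prod_j (F j (w (f j)))%:R); last first.
    rewrite [RHS](partition_big f xpredT) //=; apply: eq_bigr => i _.
    by apply: eq_bigr => j /eqP->.
  case: forallP => [H|/forallP].
    by rewrite big1 // => j _; rewrite H.
  rewrite negb_forall => /existsP[j /negbTE Hj].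
  by rewrite (bigD1 j) //= Hj mul0r.
rewrite (Ex_prod (fun i v => \prod_(j | f j == i) (F j v)%:R)).
rewrite [RHS](partition_big f xpredT) //=; apply: eq_bigr => i _.
case: (pickP (fun j => f j == i)) => [j /eqP fj|no].
  have E : (fun j' => f j' == i) =1 pred1 j.
    by move=> j' /=; rewrite -fj (inj_eq f_inj).
  rewrite (big_pred1 j) //; congr (_ / _).
  rewrite (eq_bigr (fun v => (F j v)%:R)); last by move=> v _; rewrite (big_pred1 j).
  rewrite -natr_sum; congr _%:R; rewrite -sum1_card [RHS]big_mkcond /=.
  by apply: eq_bigr => v _; rewrite unfold_in; case: (F j v).
rewrite [RHS]big_pred0 //.
rewrite (eq_bigr (fun=> 1)); last by move=> v _; rewrite big_pred0.
by rewrite sumr_const divff // pnatr_eq0 -lt0n.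
Qed.

Lemma Pr_coord i (F : pred V) : Pr (fun w => F (w i)) = #|F|%:R / #|V|%:R.
Proof.
have := @Pr_all unit (fun=> i) (fun=> F); rewrite (big_pred1 tt) => [<-|[]//].
  by apply: eq_Ex => w; case: forallP => [/(_ tt)->//|H]; case E: (F _) => //; case: H.
by move=> [] [].
Qed.

End ProductSpace.

(** * Random grids and linear hashing *)

Local Open Scope ring_scope.

(** One of the two truncated differences is 0, so the sum is the absolute difference. *)
Definition ndist (x y : nat) : nat := (x - y + (y - x))%N.

Lemma ndistC x y : ndist x y = ndist y x.
Proof. by rewrite /ndist addnC. Qed.

(** Every residue occurs [q] times in [q] full periods. Moving [x] by one exchanges a term for
    another congruent to it modulo [w], which reduces the count to [x = 0]. *)
Lemma sum_modn_lt (w q t x : nat) : (t <= w)%N ->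
  (\sum_(0 <= u < w * q) ((x + u) %% w < t) = t * q)%N.
Proof.
move=> tw; elim: x => [|x IH]; last first.
  rewrite -IH; set N := (w * q)%N.
  have : (\sum_(0 <= u < N.+1) ((x + u) %% w < t) =
     (x %% w < t) + \sum_(0 <= u < N) ((x.+1 + u) %% w < t))%N.
    rewrite big_nat_recl // addn0; congr (_ + _)%N; apply: eq_bigr => i _.
    by rewrite addnS.
  rewrite big_nat_recr //= addnC => /eqP.
  have -> : ((x + N) %% w = x %% w)%N by rewrite /N mulnC addnC modnMDl.
  by rewrite eqn_add2l => /eqP.
elim: q => [|q IH]; first by rewrite !muln0 big_geq.
rewrite mulnS addnC (big_cat_nat (n := (w * q)%N)) ?leq_addr //= IH mulnS addnC.
congr (_ + _)%N; rewrite -{1}[(w * q)%N]add0n big_addn addKn.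
rewrite (eq_big_nat _ _ (F2 := fun u => ((u < t)%N : nat))); last first.
  by move=> u /andP[_ uw]; rewrite add0n addnC mulnC modnMDl modn_small.
rewrite (big_cat_nat (n := t)) //= [X in (_ + X)%N]big1_seq ?addn0; last first.
  by move=> u /andP[_]; rewrite mem_index_iota => /andP[tu _]; rewrite ltnNge tu.
rewrite (eq_big_nat _ _ (F2 := fun u => 1%N)) ?sum_nat_const_nat ?subn0 ?muln1 //.
by move=> u /andP[_ ->].
Qed.

Lemma divn_shift_eq (w d z : nat) : (0 < w)%N ->
  ((z %/ w == (z + d) %/ w) = (z %% w < w - d))%N.
Proof.
move=> w0; rewrite {2}(divn_eq z w) -addnA divnMDl // -{1}[(z %/ w)%N]addn0 eqn_add2l.
rewrite eq_sym; have [H|H] := ltnP (z %% w + d) w.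
  by rewrite divn_small //; apply/esym; lia.
have := divn_gt0 (z %% w + d) w0; rewrite H => H1; rewrite gtn_eqF //.
by apply/esym/negbTE; rewrite -leqNgt; lia.
Qed.

(** A shift uniform below [2 ^ m] is uniform modulo [2 ^ e], and two points stay together exactly
    when the residue of the smaller one leaves room for the gap. Truncated subtraction gives 0 once
    the gap exceeds a cell. *)
Lemma same_cell_card (m e x y : nat) : (e <= m)%N ->
  #|[pred u : 'I_(2 ^ m) | (x + u) %/ 2 ^ e == (y + u) %/ 2 ^ e]%N| =
  ((2 ^ e - ndist x y) * 2 ^ (m - e))%N.
Proof.
move=> em; wlog xy : x y / (x <= y)%N.
  move=> H; case: (leqP x y) => [/H//|/ltnW /H]; rewrite ndistC => <-.
  by apply: eq_card => u; rewrite !inE eq_sym.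
have -> : ndist x y = (y - x)%N by rewrite /ndist; lia.
rewrite -(@sum_modn_lt (2 ^ e) (2 ^ (m - e)) _ x) ?leq_subr //.
rewrite -expnD subnKC // big_mkord -sum1_card big_mkcond /=.
apply: eq_bigr => u _; rewrite inE.
have -> : (y + u = x + u + (y - x))%N by lia.
by rewrite divn_shift_eq ?expn_gt0 //; case: (_ < _)%N.
Qed.

Lemma affine_eq_uniq (a b p q k l : nat) : a != b ->
  (k * a + p = k * b + q)%N -> (l * a + p = l * b + q)%N -> k = l.
Proof. move/eqP; nia. Qed.

Section Grid.
Variables (R : realType) (I : finType) (m : nat).
Local Notation V := 'I_(2 ^ m).
Local Notation Om := {ffun I -> V}.

Lemma cardV_gt0 : (0 < #|V|)%N.
Proof. by rewrite card_ord expn_gt0. Qed.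

Section Cells.
Variables (J : finType) (f : J -> I) (x y e : J -> nat).
Hypothesis em : forall j, (e j <= m)%N.

Definition same_cell (j : J) : pred V :=
  fun u => ((x j + u) %/ 2 ^ e j == (y j + u) %/ 2 ^ e j)%N.

Lemma same_cell_ratio j : #|same_cell j|%:R / #|V|%:R =
  (2 ^ e j - ndist (x j) (y j))%N%:R / 2 ^+ e j :> R.
Proof.
rewrite (@same_cell_card m (e j) (x j) (y j)) // card_ord natrM.
have -> : (2 ^ m = 2 ^ (m - e j) * 2 ^ e j)%N by rewrite -expnD subnK.
rewrite natrM -mulrA invfM [_ ^-1 * _]mulrC -?natrX; congr (_ * _).
by rewrite mulrCA divff ?mulr1 // pnatr_eq0 -lt0n expn_gt0.
Qed.

Lemma same_cell_exp j : #|same_cell j|%:R / #|V|%:R <=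
  expR (- ((ndist (x j) (y j))%:R / 2 ^+ e j)) :> R.
Proof.
rewrite same_cell_ratio; have e0 : 0 < 2 ^+ e j :> R by rewrite exprn_gt0.
have [H|H] := leqP (ndist (x j) (y j)) (2 ^ e j); last first.
  by rewrite (eqP (ltnW H : _ - _ == 0)%N) mul0r expR_ge0.
apply: le_trans (expR_ge1Dx _); rewrite natrB // natrX mulrBl divff ?gt_eqF //.
Qed.

Lemma diff_cell_le j : #|[pred u | ~~ same_cell j u]|%:R / #|V|%:R <=
  (ndist (x j) (y j))%:R / 2 ^+ e j :> R.
Proof.
have -> : #|[pred u | ~~ same_cell j u]|%:R = #|V|%:R - #|same_cell j|%:R :> R.
  by apply/eqP; rewrite eq_sym subr_eq addrC -natrD -(cardC (same_cell j)).
rewrite mulrBl same_cell_ratio divff ?pnatr_eq0 -?lt0n ?cardV_gt0 //.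
have e0 : 0 < 2 ^+ e j :> R by rewrite exprn_gt0.
rewrite lerBlDr -mulrDl ler_pdivlMr // mul1r -natrX -natrD ler_nat; lia.
Qed.

(** Union bound: each coordinate is cut with probability at most its distance over the cell
    width. *)
Lemma grid_separate :
  Pr R (fun w : Om => ~~ [forall j, same_cell j (w (f j))]) <=
  \sum_j (ndist (x j) (y j))%:R / 2 ^+ e j.
Proof.
apply: le_trans (_ : \sum_(j <- index_enum J) Pr R
   (fun w : Om => ~~ same_cell j (w (f j))) <= _).
  apply: le_trans (Pr_has _ cardV_gt0 _ _); apply: Pr_sub => w.
  rewrite negb_forall => /existsP[j Hj]; apply/hasP; exists j; last exact: Hj.
  exact: mem_index_enum.
apply: ler_sum => j _.
have := Pr_coord R cardV_gt0 (f j) [pred u | ~~ same_cell j u] => /= ->.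
exact: diff_cell_le.
Qed.

(** The shifts are independent and each survival factor is at most an exponential, so the exponents
    add up to the scaled l1 distance. This decay is what later makes a union bound over all pairs
    possible. *)
Lemma grid_same : injective f ->
  Pr R (fun w : Om => [forall j, same_cell j (w (f j))]) <=
  expR (- \sum_j (ndist (x j) (y j))%:R / 2 ^+ e j).
Proof.
move=> f_inj; rewrite Pr_all ?cardV_gt0 // -sumrN expR_sum.
by apply: ler_prod => j _; rewrite same_cell_exp divr_ge0.
Qed.

End Cells.

(** With all coefficients frozen but that of a differing coordinate [j0], both sums are affine in
    the remaining one with different slopes, and agree for at most one of its [2 ^ m] values. No
    modulus is involved, so the bound is independent of the size of the entries. *)
Lemma linear_hash_collision (J : finType) (f : J -> I) (X Y : J -> nat) :
  injective f -> (exists j, X j != Y j) ->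
  Pr R (fun w : Om => \sum_j (w (f j) * X j) == \sum_j (w (f j) * Y j))%N
    <= 2 ^- m.
Proof.
move=> f_inj [j0 XY]; apply: (Pr_merge_le cardV_gt0 (J := pred1 (f j0))) => w.
pose cX := (\sum_(j | j != j0) (w (f j) * X j))%N.
pose cY := (\sum_(j | j != j0) (w (f j) * Y j))%N.
pose F : pred V := fun v => (v * X j0 + cX == v * Y j0 + cY)%N.
have E w' Z : (\sum_j ((merge (pred1 (f j0)) w w') (f j) * Z j) =
    w' (f j0) * Z j0 + \sum_(j | j != j0) (w (f j) * Z j))%N.
  rewrite (bigD1 j0) //= ffunE /= eqxx; congr (_ + _)%N.
  by apply: eq_bigr => j jj; rewrite ffunE /= (inj_eq f_inj) (negbTE jj).
apply: le_trans (_ : Pr R (fun w' : Om => F (w' (f j0))) <= _).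
  by apply: Pr_sub => w'; rewrite !E.
rewrite Pr_coord ?cardV_gt0 // card_ord natrX ler_pdivrMr ?exprn_gt0 //.
rewrite mulVf ?expf_neq0 ?pnatr_eq0 // lern1.
apply/card_le1_eqP => u v; rewrite !unfold_in => /eqP Hu /eqP Hv; apply/val_inj => /=.
exact: affine_eq_uniq XY Hv Hu.
Qed.

End Grid.

(** * Matchings of windows *)

Local Open Scope nat_scope.

Section Greedy.
Variables (T : eqType) (lab : nat -> T -> nat) (Lv G : nat).
Hypothesis lab_lt : forall l x, lab l x < G.

(** Level 0 is the finest: on [A] the partitions by [lab l] coarsen as [l] grows, like the cells of
    a hierarchy of grids. *)
Definition nested (A : seq T) := forall l x y, l.+1 < Lv -> x \in A -> y \in A ->
  lab l x = lab l y -> lab l.+1 x = lab l.+1 y.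

(** The number of points of [A] that no matching with [B] can keep inside their cell of level [l].
    With equal sizes the opposite excess is the same number. *)
Definition excess (l : nat) (A B : seq T) : nat :=
  \sum_(g < G) (count (fun x => lab l x == g) A - count (fun x => lab l x == g) B).

Lemma count_lab_sum l (A : seq T) :
  \sum_(g < G) count (fun x => lab l x == g) A = size A.
Proof.
elim: A => [|a A IH] /=; first by rewrite big1.
rewrite big_split /= IH (bigD1 (Ordinal (lab_lt l a))) //= eqxx big1 ?addn0 //.
by move=> g; rewrite -val_eqE /= eq_sym => /negbTE->.
Qed.

Lemma excess_perm l A A' B B' : perm_eq A A' -> perm_eq B B' ->
  excess l A B = excess l A' B'.
Proof.
by move=> /seq.permP pA /seq.permP pB; apply: eq_bigr => g _; rewrite pA pB.
Qed.

Lemma excess_cons_eq l a b A B : lab l a = lab l b ->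
  excess l (a :: A) (b :: B) = excess l A B.
Proof. by move=> E; apply: eq_bigr => g _ /=; rewrite E subnDl. Qed.

Lemma excess_disjoint l A B :
  (forall a b, a \in A -> b \in B -> lab l a != lab l b) ->
  excess l A B = size A.
Proof.
move=> H; rewrite -(count_lab_sum l); apply: eq_bigr => g _.
have [/hasP[a aA /eqP ag]|] := boolP (has (fun x => lab l x == g) A).
  rewrite [X in _ - X](_ : _ = 0) ?subn0 //; apply/eqP; rewrite -leqn0 leqNgt -has_count.
  by apply/hasP => -[b bB /eqP bg]; move: (H _ _ aA bB); rewrite ag bg eqxx.
by rewrite has_count -leqNgt leqn0 => /eqP->; rewrite sub0n.
Qed.

(** The value is [Lv] when the two points share no cell at all. *)
Definition sep_level (x y : T) := find (fun l => lab l x == lab l y) (iota 0 Lv).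

Lemma sep_levelP (A : seq T) x y l : nested A -> x \in A -> y \in A -> l < Lv ->
  (lab l x == lab l y) = (sep_level x y <= l).
Proof.
move=> nA xA yA lL; apply/eqP/idP => [H|].
  rewrite leqNgt; apply/negP => /(before_find 0); rewrite nth_iota // add0n.
  by rewrite H eqxx.
rewrite /sep_level => H.
have lt : find (fun l => lab l x == lab l y) (iota 0 Lv) < Lv by apply: leq_ltn_trans lL.
elim: l H lL => [|l IH] H lL.
  have := nth_find 0 (_ : has (fun l => lab l x == lab l y) (iota 0 Lv)).
  rewrite has_find size_iota lt => /(_ isT); rewrite nth_iota //.
  by move: H; rewrite leqn0 => /eqP-> /eqP.
move: H; rewrite leq_eqVlt => /orP[/eqP E|H]; last first.
  by apply: nA => //; apply: IH => //; apply: ltnW.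
have := nth_find 0 (_ : has (fun l => lab l x == lab l y) (iota 0 Lv)).
by rewrite has_find size_iota lt => /(_ isT); rewrite nth_iota // E => /eqP.
Qed.

(** Matching first a pair of smallest [sep_level] [k] is optimal on all levels at once. From level
    [k] on the pair shares a cell and its removal changes no excess; below [k] no point of [A]
    shares a cell with a point of [B], so every matching separates everything there. *)
Lemma greedy_matching (A B : seq T) : size A = size B -> nested (A ++ B) ->
  exists P : seq (T * T), [/\ perm_eq (unzip1 P) A, perm_eq (unzip2 P) B &
    forall l, l < Lv ->
      \sum_(p <- P) (lab l p.1 != lab l p.2) = excess l A B].
Proof.
move: {2}(size A) (erefl (size A)) => s; elim: s A B => [|s IH] A B sA sB nAB.
  exists [::]; rewrite (size0nil sA) (size0nil (esym (etrans (esym sA) sB))) /=.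
  by split=> // l _; rewrite big_nil /excess big1.
have [a0 aA] : exists a, a \in A by case: A sA {sB nAB} => // a A _; exists a; rewrite mem_head.
have [b0 bB] : exists b, b \in B.
  by case: B sB {nAB} => [|b B _]; [rewrite sA|exists b; rewrite mem_head].
have exk : exists k, has (fun a => has (fun b => sep_level a b == k) B) A.
  exists (sep_level a0 b0); apply/hasP; exists a0 => //; apply/hasP; exists b0 => //.
case: (ex_minnP exk) => k /hasP[a aA' /hasP[b bB' /eqP kE]] kmin {exk a0 aA b0 bB}.
have min_ab x y : x \in A -> y \in B -> k <= sep_level x y.
  by move=> xA yB; apply: kmin; apply/hasP; exists x => //; apply/hasP; exists y.
have pA := perm_to_rem aA'; have pB := perm_to_rem bB'.
have [|||P [P1 P2 PS]] := IH (rem a A) (rem b B).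
- by rewrite size_rem // sA.
- by rewrite !size_rem // -sB.
- move=> l x y lL xAB yAB; apply: nAB => //.
    by move: xAB; rewrite !mem_cat => /orP[/mem_rem->|/mem_rem->]; rewrite ?orbT.
  by move: yAB; rewrite !mem_cat => /orP[/mem_rem->|/mem_rem->]; rewrite ?orbT.
exists ((a, b) :: P); split => /=.
- by rewrite perm_sym (perm_trans pA) // perm_cons perm_sym.
- by rewrite perm_sym (perm_trans pB) // perm_cons perm_sym.
move=> l lL; rewrite big_cons PS //= (excess_perm l pA pB).
have inA x : x \in A -> x \in A ++ B by rewrite mem_cat => ->.
have inB x : x \in B -> x \in A ++ B by rewrite mem_cat orbC => ->.
rewrite (sep_levelP nAB (inA _ aA') (inB _ bB') lL) kE.
case: leqP => kl /=.
  rewrite add0n excess_cons_eq //; apply/eqP.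
  by rewrite (sep_levelP nAB (inA _ aA') (inB _ bB') lL) kE.
have D x y : x \in A -> y \in B -> lab l x != lab l y.
  move=> xA yB; rewrite (sep_levelP nAB (inA _ xA) (inB _ yB) lL) -ltnNge.
  exact: leq_trans kl (min_ab _ _ xA yB).
rewrite -(excess_perm l pA pB) !excess_disjoint //.
- by rewrite (perm_size pA).
- by move=> x y /mem_rem xA /mem_rem yB; apply: D.
Qed.

End Greedy.

(** Points are identified with their positions in the input, so a window is the repetition-free list
    [iota i s] even when vectors coincide; the permutation looks up the partner of position
    [i + k]. *)
Lemma matching_perm (s i j : nat) (P : seq (nat * nat)) :
  perm_eq (unzip1 P) (iota i s) -> perm_eq (unzip2 P) (iota j s) ->
  exists tau : 'S_s, forall F : nat -> nat -> nat,
    \sum_(k < s) F (i + k) (j + tau k) = \sum_(p <- P) F p.1 p.2.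
Proof.
move=> P1 P2.
have u1 : uniq (unzip1 P) by rewrite (perm_uniq P1) iota_uniq.
have u2 : uniq (unzip2 P) by rewrite (perm_uniq P2) iota_uniq.
have szP : size P = s by rewrite -(size_map fst) (perm_size P1) size_iota.
pose partner x := nth 0 (unzip2 P) (index x (unzip1 P)).
have pos (k : 'I_s) : index (i + k) (unzip1 P) < s.
  have sz1 : size (unzip1 P) = s by rewrite size_map szP.
  apply: leq_trans (_ : size (unzip1 P) <= s); last by rewrite sz1.
  by rewrite index_mem (perm_mem P1) mem_iota leq_addr ltn_add2l /=.
have par_in (k : 'I_s) : j <= partner (i + k) < j + s.
  have : partner (i + k) \in unzip2 P by apply: mem_nth; rewrite size_map szP.
  by rewrite (perm_mem P2) mem_iota.
have tP (k : 'I_s) : partner (i + k) - j < s by have := par_in k; lia.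
pose t k := Ordinal (tP k).
have t_inj : injective t.
  move=> k k' /(congr1 val) /= H.
  have {}H : partner (i + k) = partner (i + k').
    by have := par_in k; have := par_in k'; lia.
  have /eqP : index (i + k) (unzip1 P) == index (i + k') (unzip1 P).
    by rewrite -(nth_uniq 0 _ _ u2) ?size_map ?szP ?pos //; apply/eqP.
  have in1 (q : 'I_s) : i + q \in unzip1 P.
    by rewrite (perm_mem P1) mem_iota leq_addr ltn_add2l /=.
  move=> E; apply/val_inj; apply/eqP.
  by rewrite -(eqn_add2l i) -(nth_index 0 (in1 k)) -(nth_index 0 (in1 k')) E.
exists (perm t_inj) => F.
rewrite (eq_bigr (fun k : 'I_s => F (i + k) (partner (i + k)))); last first.
  by move=> k _; rewrite permE /= subnKC //; case/andP: (par_in k).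
transitivity (\sum_(x <- iota i s) F x (partner x)).
  rewrite -[i in iota i s]addn0 iotaDl big_map.
  by rewrite -(big_mkord xpredT (fun k => F (i + k) (partner (i + k)))) /index_iota subn0.
rewrite -(perm_big _ P1) big_map; apply: eq_big_seq => p pP /=; congr F.
rewrite /partner; have pi : index p P < size P by rewrite index_mem.
rewrite -[p in index p.1](nth_index (0, 0) pP) -(nth_map _ 0) // index_uniq ?size_map //.
by rewrite (nth_map (0, 0)) // nth_index.
Qed.

Section WindowDistance.
Variables (s : nat) (dn : nat -> nat -> nat).

Definition match_cost (i j : nat) (tau : 'S_s) : nat :=
  \sum_(k < s) minn (dn (i + k) (j + tau k)) s.

(** The integer form of [TEMD], without the factor [1 / s], which returns only in the output. *)
Definition wdist (i j : nat) : nat :=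
  match_cost i j [arg min_(tau < 1%g) match_cost i j tau].

Lemma wdist_le i j tau : wdist i j <= match_cost i j tau.
Proof. by rewrite /wdist; case: arg_minnP => // t _ /(_ tau); apply. Qed.

Lemma wdist_ex i j : exists tau, wdist i j = match_cost i j tau.
Proof. by rewrite /wdist; eexists. Qed.

Lemma wdist_max i j : wdist i j <= s * s.
Proof.
apply: leq_trans (wdist_le i j 1%g) _.
have -> : s * s = \sum_(k < s) s by rewrite sum_nat_const card_ord.
by apply: leq_sum => k _; apply: geq_minr.
Qed.

Definition wcount (lab : nat -> nat) (g i : nat) : nat :=
  \sum_(k < s) (lab (i + k) == g).

Lemma wcountE lab g i : wcount lab g i = count (fun x => lab x == g) (iota i s).
Proof.
rewrite -sum1_count /wcount [RHS]big_mkcond /= -[i in iota i s]addn0 iotaDl big_map.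
rewrite -(big_mkord xpredT (fun k => (lab (i + k) == g) : nat)) /index_iota subn0.
by apply: eq_bigr => k _; case: eqP.
Qed.

(** The greedy matching pays [W l] for each pair separated at level [l], and these pairs are counted
    by the excess, which is at most the l1 distance of the cell counts. The name refers to that
    multiscale count distance, which is bounded below. *)
Lemma wdist_lower (lab : nat -> nat -> nat) (Lv n : nat) (W : nat -> nat) i j :
  (forall l x, lab l x < n) ->
  nested lab Lv (iota i s ++ iota j s) ->
  (forall x y, x \in iota i s -> y \in iota j s ->
     minn (dn x y) s <= \sum_(l < Lv) W l * (lab l x != lab l y)) ->
  wdist i j <=
    \sum_(l < Lv) W l * \sum_(g < n) ndist (wcount (lab l) g i) (wcount (lab l) g j).
Proof.
move=> lab_lt nst Hc.
have [|P [P1 P2 PS]] := greedy_matching lab_lt _ nst; first by rewrite !size_iota.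
have [tau Ht] := matching_perm P1 P2.
apply: leq_trans (wdist_le i j tau) _.
rewrite /match_cost (Ht (fun x y => minn (dn x y) s)).
apply: leq_trans (_ : \sum_(p <- P) \sum_(l < Lv) W l * (lab l p.1 != lab l p.2) <= _).
  rewrite big_seq [X in _ <= X]big_seq; apply: leq_sum => p pP; apply: Hc.
    by rewrite -(perm_mem P1) map_f.
  by rewrite -(perm_mem P2) map_f.
rewrite exchange_big /=; apply: leq_sum => l _.
rewrite -big_distrr /= leq_mul2l PS //; apply/orP; right.
by apply: leq_sum => g _; rewrite !wcountE /ndist leq_addr.
Qed.

(** Pairs that stay in one cell cancel; a separated pair changes two counts by one each. *)
Lemma wcount_upper (lab : nat -> nat) n i j (tau : 'S_s) :
  (forall x, lab x < n) ->
  \sum_(g < n) ndist (wcount lab g i) (wcount lab g j) <=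
    2 * \sum_(k < s) (lab (i + k) != lab (j + tau k)).
Proof.
move=> lab_lt.
pose sp (k : 'I_s) := lab (i + k) != lab (j + tau k).
have cB g : wcount lab g j = \sum_(k < s) (lab (j + tau k) == g).
  by rewrite /wcount (reindex_inj (@perm_inj _ tau)).
have one (h : 'I_s -> nat) : (forall k, h k < n) ->
    \sum_(g < n) \sum_(k < s) (h k == g) && sp k = \sum_(k < s) sp k.
  move=> hn; rewrite exchange_big /=; apply: eq_bigr => k _.
  rewrite (bigD1 (Ordinal (hn k))) //= eqxx big1 ?addn0 // => g.
  by rewrite -val_eqE /= eq_sym => /negbTE->.
rewrite mul2n -addnn -{1}(one (fun k => lab (i + k))) //.
rewrite -(one (fun k => lab (j + tau k))) // -big_split /=; apply: leq_sum => g _.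
rewrite /ndist cB; apply: leq_add; rewrite leq_subLR -big_split /=;
  apply: leq_sum => k _; rewrite /sp.
- by case: (lab (i + k) =P g) => [->|//]; rewrite eq_sym; case: eqP.
- by case: (lab (j + tau k) =P g) => [->|//]; case: eqP.
Qed.

End WindowDistance.

(** * Embedding a graph metric into l1 *)

Local Open Scope ring_scope.

Lemma card_set_ord N (B : {set 'I_N}) : (#|B| <= N)%N.
Proof. by have := max_card (mem B); rewrite card_ord. Qed.

Section GraphMetric.
Variables (N E : nat) (lab : nat -> nat -> nat) (wt : nat -> nat).
Implicit Types (g f : nat -> nat) (S : {set 'I_N}).

(** Potentials of the graph in which two nodes with equal label in class [e] are joined by an edge
    of length [wt e]. *)
Definition lip g := forall e i j, (e < E)%N -> (i < N)%N -> (j < N)%N ->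
  lab e i = lab e j -> (g i <= g j + wt e)%N.

(** The shortest-path distance to [S], described through linear programming duality as the largest
    potential that vanishes on [S]. *)
Definition greatest_lip S f :=
  [/\ lip f, forall i : 'I_N, i \in S -> f i = 0%N &
      forall g, lip g -> (forall i : 'I_N, i \in S -> g i = 0%N) ->
      forall i, (i < N)%N -> (g i <= f i)%N].

Variable d : 'I_N -> nat -> nat.
Hypothesis dP : forall x, greatest_lip [set x] (d x).

Lemma d_refl x : d x x = 0%N.
Proof. by case: (dP x) => _ H _; rewrite H // inE. Qed.

Lemma lip_sub (c : nat) g : lip g -> lip (fun z => (c - g z)%N).
Proof. by move=> Hg e i j eE iN jN lij; have := Hg e j i eE jN iN (esym lij); lia. Qed.

Lemma lip_shift (c : nat) g : lip g -> lip (fun z => (g z - c)%N).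
Proof. by move=> Hg e i j eE iN jN lij; have := Hg e i j eE iN jN lij; lia. Qed.

(** Maximality of [d x], applied to [g - g x] truncated at 0. *)
Lemma lip_d g (x y : 'I_N) : lip g -> (g y <= g x + d x y)%N.
Proof.
move=> Hg; case: (dP x) => _ _ /(_ _ (lip_shift (g x) Hg)) H.
have := H _ y (ltn_ord y); rewrite leq_subLR; apply.
by move=> i; rewrite inE => /eqP->; rewrite subnn.
Qed.

Lemma lip_dx x : lip (d x). Proof. by case: (dP x). Qed.

(** The potential [d x y - d x z] in [z] vanishes at [y]; maximality of [d y] is then evaluated at
    [x]. *)
Lemma d_sym (x y : 'I_N) : d x y = d y x.
Proof.
wlog: x y / (d y x <= d x y)%N => [H|H].
  by case: (leqP (d y x) (d x y)) => [/H//|/ltnW /H].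
apply/eqP; rewrite eqn_leq H andbT.
case: (dP y) => _ _ /(_ _ (lip_sub (d x y) (lip_dx x))) H'.
have := H' _ x (ltn_ord x); rewrite d_refl subn0; apply.
by move=> i; rewrite inE => /eqP->; rewrite subnn.
Qed.

Lemma d_triangle (x y z : 'I_N) : (d x z <= d x y + d y z)%N.
Proof. exact/lip_d/lip_dx. Qed.

Section Pair.
Variables (x y : 'I_N) (Q : nat).
Hypothesis NQ : (N < 2 ^ Q)%N.
Let dl := d x y.

(** Radii are multiples of [dl / (2 * Q)], with the denominator cleared. *)
Definition ball (a : 'I_N) (j : nat) := [set z : 'I_N | (2 * Q * d a z <= j * dl)%N].

Lemma ball_center a j : a \in ball a j.
Proof. by rewrite inE d_refl muln0. Qed.

(** Otherwise the smaller of the two balls would more than double in each of [Q] steps and reach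
    [2 ^ Q] nodes, more than [N]. *)
Lemma ball_slow_growth : exists2 j, (j < Q)%N &
  (minn #|ball x j.+1| #|ball y j.+1| <= 2 * minn #|ball x j| #|ball y j|)%N.
Proof.
pose nn j := minn #|ball x j| #|ball y j|.
have n0 : (0 < nn 0)%N.
  by rewrite leq_min !card_gt0; apply/andP; split; apply/set0Pn;
     [exists x|exists y]; rewrite ball_center.
have [/existsP[j Hj]|/existsPn H] := boolP [exists j : 'I_Q, (nn j.+1 <= 2 * nn j)%N].
  by exists (val j); [exact: ltn_ord|exact: Hj].
have : forall j, (j <= Q)%N -> (2 ^ j <= nn j)%N.
  elim=> [|j IH] jQ; first by rewrite expn0.
  have := H (Ordinal jQ); rewrite -ltnNge /= => H1.
  by rewrite expnS; apply: leq_trans (ltnW H1); rewrite leq_mul2l IH // ltnW.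
move=> /(_ Q (leqnn Q)) HQ.
have : (nn Q <= N)%N by rewrite geq_min card_set_ord.
by move=> /(leq_trans HQ); rewrite leqNgt NQ.
Qed.

(** Bourgain's argument for one pair. [b] is the endpoint whose ball of index [j + 1] is the
    smaller, [a] the other one. Slow growth bounds that ball by a multiple of [2 ^ h] while the ball
    of index [j] at [a] has at least [2 ^ h] nodes, so one sampling rate can hit the latter and miss
    the former. Distances to such a set differ by at least one radius step. *)
Lemma separating_balls : (0 < dl)%N -> exists h (Ba Bb : {set 'I_N}),
  [/\ (2 ^ h <= N)%N, (2 ^ h <= #|Ba|)%N, (#|Bb| <= 2 ^ h.+2)%N, [disjoint Ba & Bb] &
   forall S f, greatest_lip S f -> ~~ [disjoint S & Ba] -> [disjoint S & Bb] ->
     (dl <= 2 * Q * ndist (f x) (f y))%N].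
Proof.
move=> dl0; have [j jQ Hj] := ball_slow_growth.
have Q0 : (0 < Q)%N by apply: leq_ltn_trans jQ.
have [a [b [Hab Ha]]] : exists a b, ((a = x /\ b = y) \/ (a = y /\ b = x)) /\
   (#|ball b j.+1| <= 2 * minn #|ball x j| #|ball y j|)%N.
  move: Hj; rewrite {1}/minn; case: ifP => _ H.
    by exists y, x; split=> //; right.
  by exists x, y; split=> //; left.
set nj := minn #|ball x j| #|ball y j| in Ha.
have nj0 : (0 < nj)%N.
  by rewrite leq_min !card_gt0; apply/andP; split; apply/set0Pn;
     [exists x|exists y]; rewrite ball_center.
have /andP[hl hu] := trunc_log_bounds (leqnn 2) nj0.
have nja : (nj <= #|ball a j|)%N.
  by case: Hab => [[-> _]|[-> _]]; rewrite geq_min leqnn ?orbT.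
have dab : d a b = dl by case: Hab => [[-> ->]|[-> ->]] //; rewrite d_sym.
exists (trunc_log 2 nj), (ball a j), (ball b j.+1); split.
- exact: leq_trans hl (leq_trans nja (card_set_ord _)).
- exact: leq_trans hl nja.
- apply: leq_trans Ha _; rewrite expnS leq_mul2l /=; exact: ltnW.
(* A common node would give [2 * Q * dl <= (2 * j + 1) * dl], against [j < Q] and [0 < dl]. *)
- apply/pred0P => z /=; apply/negbTE/negP => /andP[]; rewrite !inE => Hz1 Hz2.
  have := d_triangle a z b; rewrite dab (d_sym z b) => Ht.
  have : (2 * Q * dl <= 2 * Q * (d a z + d b z))%N by rewrite leq_mul2l Ht orbT.
  by rewrite mulnDr; nia.
move=> S f [fl fS fg] hit mis.
have fa : (2 * Q * f a <= j * dl)%N.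
  move/pred0Pn: hit => [z /andP[/= zS]]; rewrite inE => Hz.
  apply: leq_trans Hz; rewrite leq_mul2l; apply/orP; right.
  by have := lip_d z a fl; rewrite (fS z zS) add0n d_sym.
have fb : (j.+1 * dl < 2 * Q * f b)%N.
  (* The least integer above the outer radius: the potential [r - d b z] vanishes on [S], which
     avoids that ball, and equals [r] at [b]. *)
  pose r := ((j.+1 * dl) %/ (2 * Q)).+1.
  have rP : (j.+1 * dl < 2 * Q * r)%N.
    by rewrite [X in (_ < X)%N]mulnC /r; apply: ltn_ceil; rewrite muln_gt0.
  apply: leq_trans rP _; rewrite leq_mul2l; apply/orP; right.
  have := fg _ (lip_sub r (lip_dx b)) _ b (ltn_ord b); rewrite d_refl subn0; apply.
  move=> z zS; apply/eqP; rewrite subn_eq0 /r ltn_divLR ?muln_gt0 // [X in (_ < X)%N]mulnC ltnNge.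
  by apply/negP => Hz; move/pred0P: mis => /(_ z) /=; rewrite zS inE Hz.
have : (dl <= 2 * Q * ndist (f a) (f b))%N.
  move: fa fb; rewrite mulSn /ndist; move: (f a) (f b) => u v; nia.
by case: Hab => [[-> ->]|[-> ->]] //; rewrite ndistC.
Qed.

End Pair.
End GraphMetric.

(** Equality holds at [e = 1], and the value grows with [e] because [(1 - t) ^ 2 >= 1 - 2 * t]. *)
Lemma one_minus_pow_ge (R : realType) (e : nat) : (0 < e)%N ->
  4^-1 <= (1 - 2 ^- e) ^+ (2 ^ e) :> R.
Proof.
elim: e => // -[_ _|e IH _]; first by rewrite expr1; lra.
apply: le_trans (IH isT) _; rewrite [(2 ^ e.+2)%N]expnS exprM lerXn2r //.
- by rewrite nnegrE subr_ge0 invf_le1 ?exprn_gt0 // exprn_ege1 // ler1n.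
- by rewrite nnegrE sqr_ge0.
have : 2 ^- e.+1 = 2 * 2 ^- e.+2 :> R.
  by rewrite [2 ^+ e.+2]exprS invfM mulrA divff ?mul1r // pnatr_eq0.
move=> ->; move: (2 ^- e.+2) => t; nra.
Qed.

(** [(1 - p) ^ a] is at most the inverse of [(1 + p) ^ a], which Bernoulli's inequality bounds below
    by [1 + a * p >= 3 / 2]. *)
Lemma one_minus_pow_le (R : realType) (e a : nat) : (2 ^ e <= a)%N ->
  (1 - 2 ^- e.+1) ^+ a <= 2 / 3 :> R.
Proof.
move=> ea; set p : R := 2 ^- e.+1.
have p0 : 0 < p by rewrite invr_gt0 exprn_gt0.
have p1 : p < 1 by rewrite invf_lt1 ?exprn_gt0 // exprn_egt1 // ltr1n.
have B : forall k, 1 + k%:R * p <= (1 + p) ^+ k.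
  elim=> [|k IH]; first by rewrite mul0r addr0 expr0.
  rewrite exprSr; apply: le_trans (_ : (1 + k%:R * p) * (1 + p) <= _); last first.
    by rewrite ler_wpM2r //; lra.
  have : 0 <= k%:R * p * p by rewrite !mulr_ge0 // ltW.
  rewrite -natr1 mulrDl mul1r; move: (k%:R * p) => q; nra.
have h : (1 - p) ^+ a * (1 + p) ^+ a <= 1.
  rewrite -exprMn exprn_ile1 //; nra.
have h2 : 3 / 2 <= (1 + p) ^+ a.
  apply: le_trans (B a); have : 2^-1 <= a%:R * p; last lra.
  have -> : 2^-1 = (2 ^ e)%:R * p :> R.
    by rewrite natrX /p exprS invfM mulrCA divff ?mulr1 // expf_neq0 ?pnatr_eq0.
  by rewrite ler_pM2r // ler_nat.
have : 0 <= (1 - p) ^+ a by rewrite exprn_ge0 // subr_ge0 ltW.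
move: ((1 - p) ^+ a) ((1 + p) ^+ a) h h2 => u v; nra.
Qed.

(** * Random sets that hit one ball and miss another *)

Section RandomSets.
Variables (R : realType) (I : finType) (m N : nat) (f : 'I_N -> I).
Hypothesis f_inj : injective f.
Local Notation V := 'I_(2 ^ m).
Local Notation Om := {ffun I -> V}.

(** A uniform word is divisible by [2 ^ h] with probability [2 ^- h] when [h <= m], so sampling at
    any such rate costs one word per node. *)
Definition rset (h : nat) (w : Om) : {set 'I_N} :=
  [set i : 'I_N | (w (f i) %% 2 ^ h == 0)%N].

Lemma Pr_rset_miss h (B : {set 'I_N}) : (h <= m)%N ->
  Pr R (fun w => [disjoint rset h w & B]) = (1 - 2 ^- h) ^+ #|B|.
Proof.
move=> hm.
pose F (i : 'I_N) : pred V := if i \in B then [pred u : V | (u %% 2 ^ h != 0)%N] else predT.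
transitivity (Pr R (fun w : Om => [forall i, F i (w (f i))])).
  apply: eq_Ex => w; congr (nat_of_bool _)%:R; apply/pred0P/forallP => H i.
    by have /= := H i; rewrite inE /F; case: ifP => //= _; rewrite andbT => ->.
  by have := H i; rewrite /= inE /F; case: ifP => //= _; case: eqP.
rewrite Pr_all ?cardV_gt0 // -[RHS]prodr_const [RHS]big_mkcond /=.
apply: eq_bigr => i _; rewrite /F; case: ifP => _; last first.
  by rewrite divff // pnatr_eq0 -lt0n cardV_gt0.
have -> : #|[pred u : V | (u %% 2 ^ h != 0)%N]| = (2 ^ m - 2 ^ (m - h))%N.
  have <- : #|[pred u : V | (u %% 2 ^ h == 0)%N]| = (2 ^ (m - h))%N.
    rewrite -[RHS]mul1n -(@sum_modn_lt (2 ^ h) (2 ^ (m - h)) 1 0) ?expn_gt0 //.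
    rewrite -expnD subnKC // big_mkord -sum1_card [LHS]big_mkcond /=.
    by apply: eq_bigr => u _; rewrite inE ltnS leqn0; case: (_ == 0)%N.
  rewrite -[in X in (X - _)%N](card_ord (2 ^ m)) -(cardC [pred u : V | (u %% 2 ^ h == 0)%N]).
  by rewrite addKn; apply: eq_card => u; rewrite !inE.
rewrite card_ord natrB ?leq_exp2l ?leq_subr // mulrBl divff; last first.
  by rewrite pnatr_eq0 -lt0n expn_gt0.
congr (1 - _); rewrite !natrX -[in 2 ^+ m](subnK hm) exprD invfM mulrA divff ?mul1r //.
by rewrite expf_neq0 // pnatr_eq0.
Qed.

(** [Ba] is missed with probability at most 2/3, and [Bb], of size at most twice [2 ^ h.+1], with
    probability at least the square of 1/4. For disjoint sets the events are independent, and 1/3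
    times 1/16 is 1/48. *)
Lemma Pr_rset_good h (Ba Bb : {set 'I_N}) : (h < m)%N ->
  (2 ^ h <= #|Ba|)%N -> (#|Bb| <= 2 ^ h.+2)%N -> [disjoint Ba & Bb] ->
  48^-1 <= Pr R (fun w => ~~ [disjoint rset h.+1 w & Ba] && [disjoint rset h.+1 w & Bb]).
Proof.
move=> hm ha hb dis.
have E : Pr R (fun w => ~~ [disjoint rset h.+1 w & Ba] && [disjoint rset h.+1 w & Bb]) =
   Pr R (fun w => [disjoint rset h.+1 w & Bb])
   - Pr R (fun w => [disjoint rset h.+1 w & Ba :|: Bb]).
  apply/eqP; rewrite eq_sym subr_eq /Pr /Ex -mulrDl -big_split /=; apply/eqP.
  congr (_ / _); apply: eq_bigr => w _.
  rewrite -(setI_eq0 _ (Ba :|: Bb)) setIUr setU_eq0 !setI_eq0.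
  by case: [disjoint _ & Ba] [disjoint _ & Bb] => [] []; rewrite ?addr0 ?add0r.
rewrite E !Pr_rset_miss // cardsU (disjoint_setI0 dis) cards0 subn0 exprD.
set p : R := 1 - 2 ^- h.+1.
have p0 : 0 <= p by rewrite subr_ge0 invf_le1 ?exprn_gt0 // exprn_ege1 // ler1n.
have p1 : p <= 1 by rewrite gerBl invr_ge0 exprn_ge0.
have A1 : p ^+ #|Ba| <= 2 / 3 by apply: one_minus_pow_le.
have B1 : 16^-1 <= p ^+ #|Bb|.
  apply: le_trans (_ : p ^+ (2 ^ h.+2) <= _); last by rewrite ler_wiXn2l.
  rewrite [(2 ^ h.+2)%N]expnS mulnC exprM.
  have := one_minus_pow_ge R (ltn0Sn h); rewrite -/p; move: (p ^+ _) => u; nra.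
have : 0 <= p ^+ #|Ba| by rewrite exprn_ge0.
move: (p ^+ #|Ba|) (p ^+ #|Bb|) A1 B1 => u v; nra.
Qed.

End RandomSets.

(** * Shortest paths through label classes *)

Local Open Scope nat_scope.

Definition fupd (f : nat -> nat) (a b : nat) : nat -> nat :=
  fun x => if x == a then b else f x.

(* dd is the tentative distance plus one, 0 meaning "not settled"; settled nodes
   are listed in ord, and each class e scans that list with its own pointer pt e.
   cur is one plus the next node of the bucket being relaxed, 0 for none. *)
Record dstate := DState {
  dd : nat -> nat; ord : nat -> nat; cn : nat; pt : nat -> nat;
  vis : nat -> nat -> bool; cur : nat; ce : nat; cd : nat }.

Section Dijkstra.
Variables (N E : nat) (rep prev : nat -> nat -> nat) (wt : nat -> nat).

(** [rep e i] is one plus the largest index in the bucket of [i], leaving 0 for no node. It names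
    the bucket and is the head of its list. *)
Definition bucket_rep := forall e i, e < E -> i < N ->
  [/\ 0 < rep e i <= N, rep e (rep e i).-1 = rep e i & i < rep e i].

(** The link of the list: one plus the next smaller index of the same bucket, 0 at the end. *)
Definition bucket_prev := forall e i, e < E -> i < N ->
  [/\ prev e i <= i, 0 < prev e i -> rep e (prev e i).-1 = rep e i &
      forall j, j < i -> rep e j = rep e i -> j < prev e i].

Hypotheses (repP : bucket_rep) (prevP : bucket_prev).

Definition cand (st : dstate) e := dd st (ord st (pt st e)) + wt e.

(** One iteration of the program: settle or skip the node [cur], open the bucket of the cheapest
    candidate, or idle. [vis] is constrained in range only, since it is stored in one array where
    pairs out of range share cells with others. *)
Variant dstep (st st' : dstate) : Prop :=
  | DSettle i of cur st = i.+1 & dd st i = 0 &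
      dd st' =1 fupd (dd st) i (cd st) & ord st' =1 fupd (ord st) (cn st) i &
      cn st' = (cn st).+1 & pt st' =1 pt st &
      (forall e r, e < E -> 0 < r <= N -> vis st' e r = vis st e r) &
      cur st' = prev (ce st) i & ce st' = ce st & cd st' = cd st
  | DSkip i of cur st = i.+1 & dd st i != 0 &
      dd st' =1 dd st & ord st' =1 ord st &
      cn st' = cn st & pt st' =1 pt st &
      (forall e r, e < E -> 0 < r <= N -> vis st' e r = vis st e r) &
      cur st' = prev (ce st) i & ce st' = ce st & cd st' = cd st
  | DPick e of cur st = 0 & e < E & pt st e < cn st &
      (forall e', e' < E -> pt st e' < cn st -> cand st e <= cand st e') &
      dd st' =1 dd st & ord st' =1 ord st &
      cn st' = cn st & pt st' =1 fupd (pt st) e (pt st e).+1 &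
      (forall e' r, e' < E -> 0 < r <= N ->
        vis st' e' r = vis st e' r ||
                       ((e' == e) && (r == rep e (ord st (pt st e))))) &
      cur st' = (if vis st e (rep e (ord st (pt st e))) then 0
                 else rep e (ord st (pt st e))) &
      ce st' = e & cd st' = cand st e
  | DDone of cur st = 0 & (forall e, e < E -> cn st <= pt st e) &
      dd st' =1 dd st & ord st' =1 ord st &
      cn st' = cn st & pt st' =1 pt st &
      (forall e r, e < E -> 0 < r <= N -> vis st' e r = vis st e r) &
      cur st' = 0 & ce st' = ce st & cd st' = cd st.

Variables (S : {set 'I_N}) (W : nat).
Hypothesis wtW : forall e, e < E -> wt e <= W.

(** In [iv_done], the bucket of a node already passed by the pointer of [e] is settled, except for
    what lies below [cur] in the bucket being walked. [iv_dom] makes settled values, less one, at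
    least every admissible potential. [iv_vis] says that a visited bucket was opened by a node
    scanned earlier, hence no farther. [iv_bd] and [iv_cdb] bound the numbers that the machine has
    to store. *)
Record dinv (st : dstate) : Prop := DInv {
  iv_cn : cn st <= N;
  iv_ord : forall p, p < cn st -> ord st p < N /\ 0 < dd st (ord st p);
  iv_inj : forall p q, p < cn st -> q < cn st -> ord st p = ord st q -> p = q;
  iv_onto : forall i, i < N -> 0 < dd st i -> exists2 p, p < cn st & ord st p = i;
  iv_cd : 0 < cd st;
  iv_le : forall p, p < cn st -> dd st (ord st p) <= cd st;
  iv_sorted : forall p q, p <= q -> q < cn st -> dd st (ord st p) <= dd st (ord st q);
  iv_pt : forall e, e < E -> pt st e <= cn st;
  iv_cand : forall e, e < E -> pt st e < cn st -> cd st <= cand st e;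
  iv_done : forall e p i, e < E -> p < pt st e -> i < N ->
    rep e i = rep e (ord st p) ->
    (0 < dd st i <= dd st (ord st p) + wt e) \/
    [/\ i < cur st, e = ce st, rep e i = rep e (cur st).-1
      & cd st <= dd st (ord st p) + wt e];
  iv_dom : forall g, lip N E rep wt g -> (forall i : 'I_N, i \in S -> g i = 0) ->
    forall i, i < N -> 0 < dd st i -> g i < dd st i;
  iv_cur : 0 < cur st -> [/\ cur st <= N, ce st < E & exists j, [/\ j < N, 0 < dd st j,
     rep (ce st) j = rep (ce st) (cur st).-1 & cd st = dd st j + wt (ce st)]];
  iv_vis : forall e i, e < E -> i < N -> vis st e (rep e i) ->
    exists2 p, p < pt st e & rep e (ord st p) = rep e i;
  iv_S : forall i : 'I_N, i \in S -> dd st i = 1;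
  iv_bd : forall p, p < cn st -> dd st (ord st p) <= 1 + p * W;
  iv_cdb : cd st <= 1 + cn st * W }.

(** Nodes are settled in nondecreasing order because [cd] is the least candidate when it is picked,
    and a node settled at [cd] only creates candidates at least [cd]. *)
Lemma dstep_inv st st' : dinv st -> dstep st st' -> dinv st'.
Proof.
case=> Icn Iord Iinj Ionto Icd Ile Isort Ipt Icand Idone Idom Icur Ivis IS Ibd Icdb.
case.
- move=> i ci di Hdd Hord Hcn Hpt Hvis Hcur Hce Hcd.
  have [cN ceE [j [jN dj rj cdE]]] : [/\ cur st <= N, ce st < E & exists j,
     [/\ j < N, 0 < dd st j, rep (ce st) j = rep (ce st) (cur st).-1
     & cd st = dd st j + wt (ce st)]] by apply: Icur; rewrite ci.
  rewrite ci /= in rj.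
  have iN : i < N by rewrite ci in cN.
  have ordi p : p < cn st -> (ord st p == i) = false.
    by move=> pc; apply/eqP => pi; case: (Iord p pc); rewrite pi di.
  (* With [N] settled nodes the injection [ord] would be onto and reach the unsettled [i]. *)
  have cnN : cn st < N.
    rewrite ltn_neqAle Icn andbT; apply/eqP => cE.
    pose o (p : 'I_N) : 'I_N := insubd p (ord st p).
    have oE p : val (o p) = ord st p.
      by rewrite val_insubd; case: (Iord p _) => [|->]; rewrite ?cE.
    have oinj : injective o.
      move=> p q /(congr1 val); rewrite !oE => H; apply/val_inj.
      by apply: Iinj H; rewrite cE.
    have [p /(congr1 val)] : exists p, o p = Ordinal iN.
      have [o' _ oK] := injF_bij oinj; by exists (o' (Ordinal iN)).
    by rewrite oE /= => pE; have := ordi p; rewrite pE eqxx cE ltn_ord => /(_ isT).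
  have ordE p : p < cn st -> ord st' p = ord st p.
    by move=> pc; rewrite Hord /fupd ltn_eqF.
  have ordL : ord st' (cn st) = i by rewrite Hord /fupd eqxx.
  have ddE k : k != i -> dd st' k = dd st k by rewrite Hdd /fupd => /negbTE->.
  have ddi : dd st' i = cd st by rewrite Hdd /fupd eqxx.
  have ddo p : p < cn st -> dd st' (ord st' p) = dd st (ord st p).
    by move=> pc; rewrite ordE // ddE // ordi.
  have ddpos k : 0 < dd st k -> dd st' k = dd st k.
    by move=> dk; apply: ddE; apply: contraTneq dk => ->; rewrite di.
  split.
  + by rewrite Hcn.
  + move=> p; rewrite Hcn ltnS leq_eqVlt => /orP[/eqP->|pc].
      by rewrite ordL ddi.
    by rewrite ddo // ordE //; apply: Iord.
  + move=> p q; rewrite Hcn !ltnS [p <= _]leq_eqVlt [q <= _]leq_eqVlt.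
    move=> /orP[/eqP->|pc] /orP[/eqP->|qc] //; rewrite ?ordL ?ordE //.
    * by move/esym/eqP; rewrite ordi.
    * by move/eqP; rewrite ordi.
    * exact: Iinj.
  + move=> k kN; have [->|ki] := eqVneq k i.
      by exists (cn st); rewrite ?Hcn ?ordL.
    rewrite ddE // => /(Ionto _ kN)[p pc pk]; exists p; first by rewrite Hcn ltnW.
    by rewrite ordE.
  + by rewrite Hcd.
  + move=> p; rewrite Hcn Hcd ltnS leq_eqVlt => /orP[/eqP->|pc].
      by rewrite ordL ddi.
    by rewrite ddo // Ile.
  + move=> p q pq; rewrite Hcn ltnS leq_eqVlt => /orP[/eqP qE|qc].
      rewrite qE ordL ddi; move: pq; rewrite qE leq_eqVlt => /orP[/eqP->|pc].
        by rewrite ordL ddi.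
      by rewrite ddo // Ile.
    by rewrite !ddo ?(leq_ltn_trans pq) // Isort.
  + by move=> e eE; rewrite Hpt Hcn; apply: leq_trans (Ipt e eE) _.
  + move=> e eE; rewrite Hpt Hcn Hcd /cand Hpt ltnS leq_eqVlt => /orP[/eqP->|pc].
      by rewrite ordL ddi leq_addr.
    by rewrite ddo // Icand.
  + move=> e p k eE; rewrite Hpt => pp kN.
    have pc : p < cn st := leq_trans pp (Ipt _ eE).
    rewrite ddo // ordE // => rk; rewrite Hce Hcd Hcur.
    have [/andP[d1 d2]|[kc ec rc cc]] := Idone e p k eE pp kN rk.
      by left; rewrite ddpos // d1.
    have [->|ki] := eqVneq k i; first by left; rewrite ddi Icd.
    rewrite ci /= in rc; have [pl pr pm] := prevP ceE iN.
    have kp : k < prev (ce st) i.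
      by apply: pm; rewrite -?ec //; move: kc; rewrite ci ltnS leq_eqVlt (negbTE ki).
    right; split=> //; rewrite rc ec pr //; exact: leq_ltn_trans kp.
  + move=> g gl gS k kN; have [->|ki] := eqVneq k i; last by rewrite ddE //; apply: Idom.
    rewrite ddi cdE => _; apply: leq_ltn_trans (gl (ce st) i j ceE iN jN (esym rj)) _.
    by rewrite ltn_add2r; apply: Idom.
  + rewrite Hcur Hce Hcd => p0; have [pl pr _] := prevP ceE iN.
    split=> //; first by apply: leq_trans pl (ltnW iN).
    by exists j; rewrite ddpos // pr.
  + move=> e k eE kN; rewrite Hvis //; last by case: (repP eE kN).
    move=> /(Ivis _ _ eE kN)[p pp pr]; exists p; rewrite ?Hpt //.
    by rewrite ordE //; apply: leq_trans pp (Ipt _ eE).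
  + by move=> k kS; rewrite ddpos ?IS.
  + move=> p; rewrite Hcn ltnS leq_eqVlt => /orP[/eqP->|pc]; first by rewrite ordL ddi.
    by rewrite ddo // Ibd.
  + by rewrite Hcd Hcn mulSn; apply: leq_trans Icdb _; rewrite leq_add2l leq_addl.
- move=> i ci di Hdd Hord Hcn Hpt Hvis Hcur Hce Hcd.
  have [cN ceE [j [jN dj rj cdE]]] : [/\ cur st <= N, ce st < E & exists j,
     [/\ j < N, 0 < dd st j, rep (ce st) j = rep (ce st) (cur st).-1
     & cd st = dd st j + wt (ce st)]] by apply: Icur; rewrite ci.
  rewrite ci /= in rj.
  have iN : i < N by rewrite ci in cN.
  have [pl pr pm] := prevP ceE iN.
  split.
  + by rewrite Hcn.
  + by move=> p; rewrite Hcn Hord Hdd; apply: Iord.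
  + by move=> p q; rewrite Hcn !Hord; apply: Iinj.
  + by move=> k kN; rewrite Hdd => /(Ionto _ kN)[p pc pk]; exists p; rewrite ?Hcn ?Hord.
  + by rewrite Hcd.
  + by move=> p; rewrite Hcn Hord Hdd Hcd; apply: Ile.
  + by move=> p q; rewrite Hcn !Hord !Hdd; apply: Isort.
  + by move=> e; rewrite Hpt Hcn; apply: Ipt.
  + by move=> e eE; rewrite /cand Hpt Hcn Hcd Hdd Hord; apply: Icand.
  + move=> e p k eE; rewrite Hpt => pp kN; rewrite Hord !Hdd Hce Hcd Hcur => rk.
    have [|[kc ec rc cc]] := Idone e p k eE pp kN rk; first by left.
    have [->|ki] := eqVneq k i.
      left; rewrite lt0n di /=; apply: leq_trans cc.
      by have [|q qc <-] := Ionto i iN; [rewrite lt0n|apply: Ile].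
    rewrite ci /= in rc.
    have kp : k < prev (ce st) i.
      by apply: pm; rewrite -?ec //; move: kc; rewrite ci ltnS leq_eqVlt (negbTE ki).
    right; split=> //; rewrite rc ec pr //; exact: leq_ltn_trans kp.
  + by move=> g gl gS k kN; rewrite Hdd; apply: Idom.
  + rewrite Hcur Hce Hcd => p0; split=> //; first by apply: leq_trans pl (ltnW iN).
    by exists j; rewrite Hdd pr.
  + move=> e k eE kN; rewrite Hvis //; last by case: (repP eE kN).
    by move=> /(Ivis _ _ eE kN)[p pp pr']; exists p; rewrite ?Hpt ?Hord.
  + by move=> k kS; rewrite Hdd IS.
  + by move=> p; rewrite Hcn Hord Hdd; apply: Ibd.
  + by rewrite Hcd Hcn.
- move=> e c0 eE pe emin Hdd Hord Hcn Hpt Hvis Hcur Hce Hcd.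
  set j := ord st (pt st e) in Hvis Hcur.
  have [jN dj] := Iord _ pe; rewrite -/j in jN dj.
  have [r0 rr jr] := repP eE jN.
  have ptle e' : e' < E -> pt st' e' <= cn st.
    by move=> e'E; rewrite Hpt /fupd; case: eqP => // _; apply: Ipt.
  split.
  + by rewrite Hcn.
  + by move=> p; rewrite Hcn Hord Hdd; apply: Iord.
  + by move=> p q; rewrite Hcn !Hord; apply: Iinj.
  + by move=> k kN; rewrite Hdd => /(Ionto _ kN)[p pc pk]; exists p; rewrite ?Hcn ?Hord.
  + by rewrite Hcd /cand addn_gt0 dj.
  + move=> p; rewrite Hcn Hord Hdd Hcd => pc.
    by apply: leq_trans (Ile _ pc) _; apply: Icand.
  + by move=> p q; rewrite Hcn !Hord !Hdd; apply: Isort.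
  + by move=> e' e'E; rewrite Hcn ptle.
  + move=> e' e'E; rewrite /cand Hpt Hcn Hcd Hdd Hord /fupd.
    case: eqP => [->|_] pc; last exact: emin.
    by rewrite /cand leq_add2r; apply: Isort.
  + move=> e' p k e'E; rewrite Hpt Hord !Hdd Hce Hcd Hcur => pp kN rk.
    have [pp'|pp'] := ltnP p (pt st e').
      have [|[]] := Idone e' p k e'E pp' kN rk; first by left.
      by rewrite c0.
    move: pp; rewrite /fupd; case: eqP => [e'e|_]; last by rewrite ltnNge pp'.
    rewrite e'e in pp' rk *; rewrite ltnS => pp.
    have pE : p = pt st e by apply/eqP; rewrite eqn_leq pp.
    rewrite pE -/j in rk *.
    (* The bucket was already opened by some [q] settled no later than the current node, so its
       members are already settled within [wt e] of [q]. *)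
    case: ifP => [/(Ivis _ _ eE jN)[q qp qr]|_].
      have [/andP[d1 d2]|[]] := Idone e q k eE qp kN (etrans rk (esym qr)); last by rewrite c0.
      left; rewrite d1 /=; apply: leq_trans d2 _; rewrite leq_add2r.
      by apply: Isort => //; apply: ltnW.
    right; split=> //; last by rewrite rr.
    by have [_ _] := repP eE kN; rewrite rk.
  + by move=> g gl gS k kN; rewrite Hdd; apply: Idom.
  + rewrite Hcur Hce Hcd; case: ifP => // _ _; split=> //; first by case/andP: r0.
    by exists j; rewrite Hdd rr.
  + move=> e' k e'E kN; rewrite Hvis //; last by case: (repP e'E kN).
    case/orP=> [/(Ivis _ _ e'E kN)[p pp pr]|/andP[/eqP-> /eqP kE]].
      exists p; rewrite ?Hord // Hpt /fupd; case: eqP => // <-.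
      by apply: leq_trans pp _.
    by exists (pt st e); rewrite ?Hord // Hpt /fupd eqxx.
  + by move=> k kS; rewrite Hdd IS.
  + by move=> p; rewrite Hcn Hord Hdd; apply: Ibd.
  + rewrite Hcd Hcn /cand; apply: leq_trans (leq_add (Ibd _ pe) (wtW eE)) _.
    by rewrite -addnA leq_add2l -mulSnr leq_mul2r pe orbT.
- move=> c0 Hd Hdd Hord Hcn Hpt Hvis Hcur Hce Hcd.
  split.
  + by rewrite Hcn.
  + by move=> p; rewrite Hcn Hord Hdd; apply: Iord.
  + by move=> p q; rewrite Hcn !Hord; apply: Iinj.
  + by move=> k kN; rewrite Hdd => /(Ionto _ kN)[p pc pk]; exists p; rewrite ?Hcn ?Hord.
  + by rewrite Hcd.
  + by move=> p; rewrite Hcn Hord Hdd Hcd; apply: Ile.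
  + by move=> p q; rewrite Hcn !Hord !Hdd; apply: Isort.
  + by move=> e; rewrite Hpt Hcn; apply: Ipt.
  + by move=> e eE; rewrite /cand Hpt Hcn Hcd Hdd Hord; apply: Icand.
  + move=> e p k eE; rewrite Hpt => pp kN; rewrite Hord !Hdd => rk.
    have [|[]] := Idone e p k eE pp kN rk; first by left.
    by rewrite c0.
  + by move=> g gl gS k kN; rewrite Hdd; apply: Idom.
  + by rewrite Hcur.
  + move=> e k eE kN; rewrite Hvis //; last by case: (repP eE kN).
    by move=> /(Ivis _ _ eE kN)[p pp pr']; exists p; rewrite ?Hpt ?Hord.
  + by move=> k kS; rewrite Hdd IS.
  + by move=> p; rewrite Hcn Hord Hdd; apply: Ibd.
  + by rewrite Hcd Hcn.
Qed.

Definition finished (st : dstate) := cur st = 0 /\ forall e, e < E -> cn st <= pt st e.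

(** The class [e0] joins all nodes, so one settled node forces all others to be settled. Exhausted
    pointers then give the Lipschitz property, and [iv_dom] gives maximality. *)
Lemma finished_greatest st e0 : dinv st -> finished st -> 0 < cn st ->
  e0 < E -> (forall i j, i < N -> j < N -> rep e0 i = rep e0 j) ->
  greatest_lip E rep wt S (fun i => (dd st i).-1) /\ forall i, i < N -> 0 < dd st i.
Proof.
case=> Icn Iord Iinj Ionto Icd Ile Isort Ipt Icand Idone Idom Icur Ivis IS Ibd Icdb.
case=> c0 Hd cn0 e0E one.
have all_pos i : i < N -> 0 < dd st i.
  move=> iN; have [oN _] := Iord 0 cn0.
  have [|/andP[]|[]] := Idone e0 0 i e0E _ iN (one _ _ iN oN) => //.
    exact: leq_trans cn0 (Hd _ e0E).
  by rewrite c0.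
split=> //; split.
- move=> e i j eE iN jN rij.
  have [p pc pj] := Ionto j jN (all_pos j jN).
  have [|/andP[d1 d2]|[]] := Idone e p i eE (leq_trans pc (Hd _ eE)) iN; last by rewrite c0.
    by rewrite pj.
  by move: d2 (all_pos j jN); rewrite pj; lia.
- by move=> i /IS->.
- by move=> g gl gS i iN; have := Idom g gl gS i iN (all_pos i iN); lia.
Qed.

(** Remaining pointer moves, plus pairs of a class and a node in an unopened bucket, plus the rest
    of the bucket being walked. Opening a bucket shifts its nodes from the second sum to the third
    and is paid for by a pointer move. *)
Definition potential (st : dstate) : nat :=
  \sum_(e < E) (N - pt st e) + \sum_(e < E) \sum_(i < N) ~~ vis st e (rep e i)
  + (if cur st is c.+1 then \sum_(i < c.+1) (rep (ce st) i == rep (ce st) c) else 0).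

Lemma dstep_potential st st' : dinv st -> dstep st st' ->
  potential st' < potential st \/ finished st' /\ finished st.
Proof.
move=> I; have I' := I.
case: I' => Icn Iord Iinj Ionto Icd Ile Isort Ipt Icand Idone Idom Icur Ivis IS Ibd Icdb.
(* Following [prev] drops at least the node just treated from the rest of the bucket. *)
have chain i : cur st = i.+1 ->
   (if prev (ce st) i is c.+1 then \sum_(k < c.+1) (rep (ce st) k == rep (ce st) c)
    else 0) < \sum_(k < i.+1) (rep (ce st) k == rep (ce st) i).
  move=> ci; have [|cN ceE _] := Icur; first by rewrite ci.
  have iN : i < N by rewrite ci in cN.
  have [pl pr pm] := prevP ceE iN.
  rewrite big_ord_recr /= eqxx addn1 ltnS.
  case: (prev (ce st) i) pl pr pm => [|c] pl pr pm //.
  have -> : rep (ce st) c = rep (ce st) i by exact: pr.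
  rewrite (big_ord_widen i (fun k => (rep (ce st) k == rep (ce st) i) : nat) pl).
  by rewrite [X in X <= _]big_mkcond; apply: leq_sum => k _; case: ifP.
case.
- move=> i ci di Hdd Hord Hcn Hpt Hvis Hcur Hce Hcd; left.
  rewrite /potential Hcur Hce.
  have -> : \sum_(e < E) (N - pt st' e) = \sum_(e < E) (N - pt st e).
    by apply: eq_bigr => e _; rewrite Hpt.
  have -> : \sum_(e < E) \sum_(k < N) ~~ vis st' e (rep e k)
          = \sum_(e < E) \sum_(k < N) ~~ vis st e (rep e k).
    apply: eq_bigr => e _; apply: eq_bigr => k _; rewrite Hvis //.
    by case: (repP (ltn_ord e) (ltn_ord k)).
  by rewrite ltn_add2l ci chain.
- move=> i ci di Hdd Hord Hcn Hpt Hvis Hcur Hce Hcd; left.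
  rewrite /potential Hcur Hce.
  have -> : \sum_(e < E) (N - pt st' e) = \sum_(e < E) (N - pt st e).
    by apply: eq_bigr => e _; rewrite Hpt.
  have -> : \sum_(e < E) \sum_(k < N) ~~ vis st' e (rep e k)
          = \sum_(e < E) \sum_(k < N) ~~ vis st e (rep e k).
    apply: eq_bigr => e _; apply: eq_bigr => k _; rewrite Hvis //.
    by case: (repP (ltn_ord e) (ltn_ord k)).
  by rewrite ltn_add2l ci chain.
- move=> e c0 eE pe emin Hdd Hord Hcn Hpt Hvis Hcur Hce Hcd; left.
  set j := ord st (pt st e) in Hvis Hcur.
  have [jN dj] := Iord _ pe; rewrite -/j in jN dj.
  have [r0 rr jr] := repP eE jN.
  rewrite /potential c0 addn0 -addnA.
  have P1 : \sum_(e < E) (N - pt st' e) < \sum_(e < E) (N - pt st e).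
    rewrite (bigD1 (Ordinal eE)) //= [X in _ < X](bigD1 (Ordinal eE)) //= -addSn.
    apply: leq_add; first by rewrite Hpt /fupd eqxx; lia.
    apply: leq_sum => e' /eqP ne; rewrite Hpt /fupd; case: eqP => // ee.
    by case: ne; apply/val_inj.
  rewrite -addSn; apply: leq_add => //.
  have mono (e' : 'I_E) (k : 'I_N) : ~~ vis st' e' (rep e' k) <= ~~ vis st e' (rep e' k).
    rewrite Hvis //; last by case: (repP (ltn_ord e') (ltn_ord k)).
    by case: (vis st e' (rep e' k)) => //=; case: (_ && _).
  rewrite Hcur Hce; case: ifP => nv.
    by rewrite addn0; apply: leq_sum => e' _; apply: leq_sum => k _.
  rewrite (bigD1 (Ordinal eE)) //= [X in _ <= X](bigD1 (Ordinal eE)) //= addnAC.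
  apply: leq_add; last by apply: leq_sum => e' _; apply: leq_sum => k _.
  case: (rep e j) r0 rr nv Hvis => [|c] //= r0 rr nv Hvis; rewrite rr.
  rewrite (big_ord_widen N (fun k => (rep e k == c.+1) : nat) r0).
  rewrite [X in _ + X]big_mkcond -big_split /=; apply: leq_sum => k _.
  rewrite Hvis //; last by case: (repP eE (ltn_ord k)).
  rewrite eqxx /=.
  by case: eqP => [->|_]; rewrite ?nv ?orbT ?orbF; case: ifP; rewrite ?addn0.
- by move=> c0 Hd Hdd Hord Hcn Hpt Hvis Hcur _ _; right; split; split=> // e eE; rewrite Hcn Hpt Hd.
Qed.

Lemma potential_finished st : dinv st -> potential st = 0 -> finished st.
Proof.
case=> Icn Iord Iinj Ionto Icd Ile Isort Ipt Icand Idone Idom Icur Ivis IS Ibd Icdb.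
rewrite /potential => /eqP; rewrite !addn_eq0 => /andP[/andP[/eqP H1 _] H3]; split.
  by case: (cur st) H3 => // c; rewrite big_ord_recr /= eqxx addn_eq0 andbF.
move=> e eE; move/eqP: H1; rewrite sum_nat_eq0 => /forallP /(_ (Ordinal eE)) /=.
by rewrite subn_eq0; apply: leq_trans.
Qed.

(** Both sums of the potential start at no more than [E * N]. Since idling keeps a finished state
    finished, the program may use a loop of this fixed length. *)
Lemma dsteps_finish (run : nat -> dstate) : dinv (run 0) ->
  (forall k, dstep (run k) (run k.+1)) ->
  dinv (run (2 * (E * N))) /\ (cur (run 0) = 0 -> finished (run (2 * (E * N)))).
Proof.
move=> I0 St.
have Ik k : dinv (run k) by elim: k => // k IH; apply: dstep_inv (St k).
split=> // cur0.
have H k : finished (run k) \/ potential (run k) + k <= potential (run 0).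
  elim: k => [|k [fk|IH]]; first by right; rewrite addn0.
  - have [lt|[f' _]] := dstep_potential (Ik k) (St k); last by left.
    left; case: fk => fc fp.
    case: (St k) => [i ci|i ci|e c0 eE pe|c0 Hd Hdd Hord Hcn Hpt Hvis Hcur] *.
    + by rewrite fc in ci.
    + by rewrite fc in ci.
    + by have := fp e eE; rewrite leqNgt pe.
    + by split=> // e eE; rewrite Hcn Hpt Hd.
  - have [lt|[f' _]] := dstep_potential (Ik k) (St k); last by left.
    by right; apply: leq_trans IH; rewrite addnS -addSn leq_add2r.
have [//|Hf] := H (2 * (E * N)); apply: potential_finished => //.
suff : potential (run 0) <= 2 * (E * N).
  by move=> P0; apply/eqP; rewrite -leqn0 -(leq_add2r (2 * (E * N))); apply: leq_trans Hf P0.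
rewrite /potential cur0 addn0 mul2n -addnn; apply: leq_add.
  have -> : E * N = \sum_(e < E) N by rewrite sum_nat_const card_ord.
  by apply: leq_sum => e _; apply: leq_subr.
have -> : E * N = \sum_(e < E) \sum_(i < N) 1.
  by rewrite sum_nat_const card_ord sum_nat_const card_ord muln1.
by apply: leq_sum => e _; apply: leq_sum => i _; case: (vis _ _ _).
Qed.

End Dijkstra.

(** * Big-step execution and its cost *)

Local Open Scope nat_scope.

Fixpoint expr_size (e : expr) : nat :=
  match e with
  | Const _ => 1
  | Fetch a => (expr_size a).+1
  | Op _ e1 e2 => expr_size e1 + expr_size e2
  end.

Fixpoint expr_const (e : expr) : nat :=
  match e with
  | Const z => absz z
  | Fetch a => expr_const a
  | Op _ e1 e2 => maxn (expr_const e1) (expr_const e2)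
  end.

Fixpoint cmd_size (c : cmd) : nat :=
  match c with
  | Skip => 1
  | Store a e => expr_size a + expr_size e
  | Toss a => (expr_size a).+1
  | Seq c1 c2 => maxn (cmd_size c1) (cmd_size c2)
  | If e c1 c2 => maxn (expr_size e) (maxn (cmd_size c1) (cmd_size c2))
  | While e c => maxn (expr_size e) (cmd_size c)
  end.

Fixpoint cmd_const (c : cmd) : nat :=
  match c with
  | Skip => 1
  | Store a e => maxn (expr_const a) (expr_const e)
  | Toss a => expr_const a
  | Seq c1 c2 => maxn (cmd_const c1) (cmd_const c2)
  | If e c1 c2 => maxn (expr_const e) (maxn (cmd_const c1) (cmd_const c2))
  | While e c => maxn (expr_const e) (cmd_const c)
  end.

Definition mem_bounded (X : nat) (m : memory) := forall a, absz (m a) <= X.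

Lemma expr_size_gt0 e : 0 < expr_size e.
Proof. by elim: e => //= o e1 H1 e2 H2; rewrite addn_gt0 H1. Qed.

Lemma cmd_size_gt0 c : 0 < cmd_size c.
Proof.
by elim: c => //= *; rewrite ?addn_gt0 ?leq_max ?expr_size_gt0 //; apply/orP; left.
Qed.

Section ExprBound.
Variables (X : nat) (m : memory).
Hypotheses (X_ge2 : 1 < X) (mX : mem_bounded X m).

(** For bounds at least 2 a sum is at most the product, so every operation adds the exponents. *)
Lemma eval_bound e : expr_const e <= X ->
  absz (eval m e) <= X ^ expr_size e.
Proof.
elim: e => [z|a IH|o e1 IH1 e2 IH2] /=; first by rewrite expn1.
  by move=> _; apply: (leq_trans (mX _)); rewrite -{1}(expn1 X) leq_exp2l.
rewrite geq_max => /andP[/IH1 H1 /IH2 H2]; rewrite expnD.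
have P1 : 2 <= X ^ expr_size e1.
  by apply: (leq_trans X_ge2); rewrite -{1}(expn1 X) leq_exp2l // expr_size_gt0.
have P2 : 2 <= X ^ expr_size e2.
  by apply: (leq_trans X_ge2); rewrite -{1}(expn1 X) leq_exp2l // expr_size_gt0.
move: (X ^ expr_size e1) (X ^ expr_size e2) H1 H2 P1 P2.
move: (eval m e1) (eval m e2) => x y p q H1 H2 P1 P2.
case: o => /=.
- have: absz (x + y)%R <= absz x + absz y by lia.
  nia.
- have: absz (x - y)%R <= absz x + absz y by lia.
  nia.
- by rewrite abszM leq_mul.
- apply: leq_trans (lez_div _ _) _; nia.
- case: (x <= y)%R => /=; nia.
Qed.

Let bl := (trunc_log 2 X).+1.

Lemma eval_bitlen e : expr_const e <= X -> bitlen (eval m e) <= expr_size e * bl.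
Proof.
move=> /eval_bound H; rewrite /bitlen.
have [z0|nz] := posnP (absz (eval m e)).
  by rewrite z0 trunc_log0 muln_gt0 expr_size_gt0.
rewrite -(ltn_exp2l _ _ (leqnn 2)).
apply: leq_ltn_trans (_ : absz (eval m e) < _); first exact: trunc_logP.
apply: leq_ltn_trans H _; rewrite mulnC expnM ltn_exp2r ?expr_size_gt0 //.
exact: trunc_log_ltn.
Qed.

Lemma eval_time_bound e : expr_const e <= X ->
  eval_time m e <= 4 * expr_size e ^ 2 * bl.
Proof.
elim: e => [z|a IH|o e1 IH1 e2 IH2] /=.
- by move=> /(@eval_bitlen (Const z)) /=; lia.
- move=> H; have := IH H; have := eval_bitlen H.
  have := @eval_bitlen (Const (m (eval m a))) (mX _) => /=.
  have := expr_size_gt0 a; move: (bitlen _) (bitlen _) => b1 b2; nia.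
- rewrite geq_max => /andP[H1 H2].
  have := IH1 H1; have := IH2 H2.
  have := eval_bitlen H1; have := eval_bitlen H2.
  have := expr_size_gt0 e1; have := expr_size_gt0 e2.
  move: (bitlen _) (bitlen _) => b1 b2; nia.
Qed.

End ExprBound.

(** [k] counts small steps. Only values written by [Store] are required to be at most [X]; addresses
    and intermediate results are then controlled by the size of the expressions. *)
Inductive exec (X : nat) :
    cmd -> memory -> seq bool -> memory -> seq bool -> nat -> Prop :=
  | ExSkip m r : exec X Skip m r m r 1
  | ExStore a e m r of absz (eval m e) <= X :
      exec X (Store a e) m r (update m (eval m a) (eval m e)) r 1
  | ExToss a m r :
      exec X (Toss a) m r (update m (eval m a) (head false r)%:Z) (behead r) 1
  | ExSeq c1 c2 m r m1 r1 m2 r2 k1 k2 of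
      exec X c1 m r m1 r1 k1 & exec X c2 m1 r1 m2 r2 k2 :
      exec X (Seq c1 c2) m r m2 r2 (k1 + k2).+1
  | ExIf e c1 c2 m r m1 r1 k of
      exec X (if eval m e != 0%R then c1 else c2) m r m1 r1 k :
      exec X (If e c1 c2) m r m1 r1 k.+1
  | ExWhileF e c m r of eval m e = 0%R : exec X (While e c) m r m r 1
  | ExWhileT e c m r m1 r1 m2 r2 k1 k2 of eval m e != 0%R &
      exec X c m r m1 r1 k1 & exec X (While e c) m1 r1 m2 r2 k2 :
      exec X (While e c) m r m2 r2 (k1 + k2).+1.

Lemma mem_bounded_update X m a z :
  mem_bounded X m -> absz z <= X -> mem_bounded X (update m a z).
Proof. by move=> mX zX a'; rewrite /update; case: eqP. Qed.

Lemma exec_run X G c m r m' r' k : 1 < X ->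
  exec X c m r m' r' k -> mem_bounded X m ->
  cmd_size c <= G -> cmd_const c <= X ->
  mem_bounded X m' /\
  forall todo w, exists2 w',
    iter k step (Config (c :: todo) m r w) = Config todo m' r' w' &
    w' <= w + k * (8 * G ^ 2 * (trunc_log 2 X).+1).
Proof.
move=> X2; set bl := (trunc_log 2 X).+1.
elim=> {c m r m' r' k}.
- move=> m r mX /= G1 _; split=> // todo w; exists (w + 1) => //.
  by rewrite leq_add2l mul1n !muln_gt0 G1.
- move=> a e m r eX mX /= aG; rewrite geq_max => /andP[ca ce]; split.
    exact: mem_bounded_update.
  move=> todo w; eexists; first reflexivity.
  rewrite leq_add2l mul1n.
  have := eval_time_bound X2 mX ca; have := eval_time_bound X2 mX ce.
  have := eval_bitlen X2 mX ca; have := eval_bitlen X2 mX ce.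
  rewrite -/bl; have := expr_size_gt0 a; have := expr_size_gt0 e.
  move=> p1 p2 b1 b2 t1 t2.
  have : (expr_size a + expr_size e) ^ 2 * bl <= G ^ 2 * bl.
    by rewrite leq_mul // leq_exp2r.
  move: (bitlen _) (bitlen _) (eval_time _ _) (eval_time _ _) b1 b2 t1 t2
   => b1 b2 t1 t2; nia.
- move=> a m r mX /= aG ca; split.
    by apply: mem_bounded_update => //; case: (head _ _) => //=; apply: ltnW.
  move=> todo w; eexists; first reflexivity.
  rewrite leq_add2l mul1n.
  have := eval_time_bound X2 mX ca; have := eval_bitlen X2 mX ca.
  rewrite -/bl; have := expr_size_gt0 a; move=> p1 b1 t1.
  have : (expr_size a).+1 ^ 2 * bl <= G ^ 2 * bl.
    by rewrite leq_mul // leq_exp2r.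
  have : 0 < bl by [].
  move: (bitlen _) (eval_time _ _) b1 t1 => b1 t1; nia.
- move=> c1 c2 m r m1 r1 m2 r2 k1 k2 _ IH1 _ IH2 mX /=.
  rewrite !geq_max => /andP[G1 G2] /andP[C1 C2].
  have [m1X H1] := IH1 mX G1 C1; have [m2X H2] := IH2 m1X G2 C2.
  split=> // todo w; rewrite -iterS iterSr /= addnC iterD.
  have [w1 -> L1] := H1 (c2 :: todo) (w + 1); have [w2 -> L2] := H2 todo w1.
  exists w2 => //; move: L1 L2.
  have : 0 < 8 * G ^ 2 * bl.
    by rewrite !muln_gt0 (leq_trans _ G1) // cmd_size_gt0.
  move: (8 * _ * _) => u; nia.
- move=> e c1 c2 m r m1 r1 k _ IH mX /=.
  rewrite !geq_max => /and3P[Ge G1 G2] /and3P[Ce C1 C2].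
  have [||m1X H] := IH mX; try by case: ifP.
  split=> // todo w; rewrite -iterS iterSr /=.
  have [w1 -> L1] := H todo (w + (eval_time m e + bitlen (eval m e))).
  exists w1 => //; apply: leq_trans L1 _; rewrite mulSn -addnA leq_add2l leq_add2r.
  have := eval_time_bound X2 mX Ce; have := eval_bitlen X2 mX Ce.
  rewrite -/bl; have := expr_size_gt0 e => p1 b1 t1.
  have : expr_size e ^ 2 * bl <= G ^ 2 * bl by rewrite leq_mul // leq_exp2r.
  move: (bitlen _) (eval_time _ _) b1 t1 => b1 t1; nia.
- move=> e c m r e0 mX /=; rewrite !geq_max => /andP[Ge G1] /andP[Ce C1].
  split=> // todo w; rewrite e0 /=; eexists; first reflexivity.
  rewrite leq_add2l mul1n.
  have := eval_time_bound X2 mX Ce; have := eval_bitlen X2 mX Ce.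
  rewrite e0 -/bl; have := expr_size_gt0 e => p1 b1 t1.
  have : expr_size e ^ 2 * bl <= G ^ 2 * bl by rewrite leq_mul // leq_exp2r.
  move: (bitlen _) (eval_time _ _) b1 t1 => b1 t1; nia.
- move=> e c m r m1 r1 m2 r2 k1 k2 e1 _ IH1 _ IH2 mX /=.
  rewrite !geq_max => /andP[Ge G1] /andP[Ce C1].
  have [m1X H1] := IH1 mX G1 C1.
  have [||m2X H2] := IH2 m1X; rewrite /= ?geq_max ?Ge ?Ce //.
  split=> // todo w; rewrite -iterS iterSr /= e1 addnC iterD.
  have [w1 -> L1] := H1 (While e c :: todo) (w + (eval_time m e + bitlen (eval m e))).
  have [w2 -> L2] := H2 todo w1; exists w2 => //.
  have := eval_time_bound X2 mX Ce; have := eval_bitlen X2 mX Ce.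
  rewrite -/bl; have := expr_size_gt0 e => p1 b1 t1.
  have : expr_size e ^ 2 * bl <= G ^ 2 * bl by rewrite leq_mul // leq_exp2r.
  move: L1 L2; move: (bitlen _) (eval_time _ _) b1 t1 => b1 t1; nia.
Qed.

(** * A structured language compiled to the machine *)

Local Open Scope nat_scope.

Inductive hexpr :=
  | Num of nat
  | Get of nat & hexpr
  | Bin of binop & hexpr & hexpr.

(** The only loop repeats as often as a register says, and in well-formed programs that register is
    a parameter; step counts can thus be read off the syntax. *)
Inductive prog :=
  | Nop
  | Set_ of nat & hexpr & hexpr
  | Flip of nat & hexpr
  | Then of prog & prog
  | Cond of hexpr & prog & prog
  | For of nat & nat & prog.

Definition state := nat -> nat -> nat.

Definition upd (st : state) (r i z : nat) : state :=
  fun r' => if r' == r then fun i' => if i' == i then z else st r i' else st r'.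

Definition nat_op (o : binop) (x y : nat) : nat :=
  match o with
  | OpAdd => x + y
  | OpSub => x - y
  | OpMul => x * y
  | OpDiv => x %/ y
  | OpLeq => x <= y
  end.

Fixpoint heval (st : state) (e : hexpr) : nat :=
  match e with
  | Num k => k
  | Get r a => st r (heval st a)
  | Bin o e1 e2 => nat_op o (heval st e1) (heval st e2)
  end.

Definition coin_tail (st : state) : state :=
  fun r => if r == 0 then fun i => st 0 i.+1 else st r.

(** The reduction modulo [st 3 0] bounds every value computed, whatever the program does. In region
    2 one is added, since 0 marks an output cell not yet written. *)
Fixpoint sem (p : prog) (st : state) : state :=
  match p with
  | Nop => st
  | Set_ r i e => upd st r (heval st i) (heval st e %% st 3 0 + (r == 2))
  | Flip r i => upd (coin_tail st) r (heval st i) (st 0 0)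
  | Then p1 p2 => sem p2 (sem p1 st)
  | Cond e p1 p2 => if heval st e != 0 then sem p1 st else sem p2 st
  | For x b p1 => iteri (st b 0) (fun i st' => sem p1 (upd st' x 0 i)) st
  end.

Fixpoint psteps (par : nat -> nat) (p : prog) : nat :=
  match p with
  | Nop | Set_ _ _ _ | Flip _ _ => 1
  | Then p1 p2 => (psteps par p1 + psteps par p2).+1
  | Cond e p1 p2 => (maxn (psteps par p1) (psteps par p2)).+1
  | For x b p1 => 5 + par b * (psteps par p1 + 5)
  end.

(** Regions 0 to 5 are reserved for coins, input, output, the modulus, loop counters and loop
    bounds; 64 is the stride of [haddr]. *)
Definition user (r : nat) := (5 < r) && (r < 64).

Fixpoint wf_expr (A : bool) (e : hexpr) : bool :=
  match e with
  | Num _ => true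
  | Get r a => (user r || (r == 1) && A) && wf_expr A a
  | Bin _ e1 e2 => wf_expr A e1 && wf_expr A e2
  end.

(** Output overwrites the cells of the input, so the flag [A] permits either reading region 1 or
    writing region 2, never both. *)
Fixpoint wf_prog (A : bool) (pars : seq nat) (p : prog) : bool :=
  match p with
  | Nop => true
  | Set_ r i e => [&& user r || (r == 2) && ~~ A, r \notin pars,
                     wf_expr A i & wf_expr A e]
  | Flip r i => [&& user r, r \notin pars & wf_expr A i]
  | Then p1 p2 => wf_prog A pars p1 && wf_prog A pars p2
  | Cond e p1 p2 => [&& wf_expr A e, wf_prog A pars p1 & wf_prog A pars p2]
  | For x b p1 => [&& user x, x \notin pars, user b, b \in pars
                    & wf_prog A pars p1]
  end.

Fixpoint mods (p : prog) : seq nat :=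
  match p with
  | Nop => [::]
  | Set_ r _ _ => [:: r]
  | Flip r _ => [:: 0; r]
  | Then p1 p2 => mods p1 ++ mods p2
  | Cond _ p1 p2 => mods p1 ++ mods p2
  | For x _ p1 => x :: mods p1
  end.

Lemma sem_frame p st r : r \notin mods p -> sem p st r = st r.
Proof.
elim: p st => [|r' i e|r' i|p1 IH1 p2 IH2|e p1 IH1 p2 IH2|x b p1 IH] st //=.
- by rewrite inE /upd => /negbTE->.
- by rewrite !inE negb_or /upd /coin_tail => /andP[/negbTE-> /negbTE->].
- by rewrite mem_cat negb_or => /andP[H1 H2]; rewrite IH2 // IH1.
- by rewrite mem_cat negb_or => /andP[H1 H2]; case: ifP => _; rewrite ?IH1 ?IH2.
- rewrite inE negb_or => /andP[/negbTE rx rp].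
  by elim: (st b 0) => //= k IHk; rewrite IH // /upd rx.
Qed.

(** Arrays are interleaved on the negative addresses; the nonnegative ones belong to input and
    output. *)
Definition haddr (r i : nat) : int := (- Posz (64 * i + r))%R.

Definition eaddr (r : nat) (e : expr) : expr :=
  Op OpSub (Const 0) (Op OpAdd (Op OpMul (Const 64) e) (Const (Posz r))).

(** Cell 3 of the input holds [M]; adding it makes the coordinates natural numbers. The comparison
    factor turns integer subtraction into the truncated one. *)
Fixpoint cexpr (e : hexpr) : expr :=
  match e with
  | Num k => Const (Posz k)
  | Get r a => if r == 1 then Op OpAdd (Fetch (cexpr a)) (Fetch (Const 3))
               else Fetch (eaddr r (cexpr a))
  | Bin OpSub e1 e2 => Op OpMul (Op OpSub (cexpr e1) (cexpr e2))
                                (Op OpLeq (cexpr e2) (cexpr e1))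
  | Bin o e1 e2 => Op o (cexpr e1) (cexpr e2)
  end.

Definition reg (r i : nat) : expr := Fetch (Const (haddr r i)).

Definition emod (e c : expr) : expr :=
  Op OpSub e (Op OpMul (Op OpDiv e c) c).

Definition target (r : nat) (e : expr) : expr :=
  if r == 2 then e else eaddr r e.

(** Counter and bound of a loop sit in hidden arrays 4 and 5 at index [d], the nesting depth, out of
    reach of the body. *)
Fixpoint comp (d : nat) (p : prog) : cmd :=
  match p with
  | Nop => Skip
  | Set_ r i e => Store (target r (cexpr i)) (emod (cexpr e) (reg 3 0))
  | Flip r i => Toss (eaddr r (cexpr i))
  | Then p1 p2 => Seq (comp d p1) (comp d p2)
  | Cond e p1 p2 => If (cexpr e) (comp d p1) (comp d p2)
  | For x b p1 =>
      Seq (Store (Const (haddr 5 d)) (reg b 0))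
     (Seq (Store (Const (haddr 4 d)) (Const 0))
          (While (Op OpLeq (Op OpAdd (reg 4 d) (Const 1)) (reg 5 d))
             (Seq (Store (Const (haddr x 0)) (reg 4 d))
             (Seq (comp d.+1 p1)
                  (Store (Const (haddr 4 d)) (Op OpAdd (reg 4 d) (Const 1)))))))
  end.

Lemma haddr_inj r i r' i' : r < 64 -> r' < 64 ->
  (haddr r i == haddr r' i') = (r == r') && (i == i').
Proof. rewrite /haddr => h h'; apply/eqP/andP => [H|[/eqP-> /eqP->]] //; lia. Qed.

Lemma haddr_neg r i (k : nat) : 0 < r -> (haddr r i == (Posz k)) = false.
Proof. rewrite /haddr => h; apply/eqP; lia. Qed.

(* How a memory represents a state: region 1 is the input shifted by M (and is
   readable only while A holds), region 2 records the output cells written so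
   far, with 0 standing for "not written". *)
Record represents (A : bool) (st : state) (m : memory) (r : seq bool) : Prop :=
  Represents {
  rep_inp : A -> forall i : nat, (m (Posz i) + m (Posz 3))%R = Posz (st 1 i);
  rep_out : forall i : nat, st 2 i = 0 \/ m (Posz i) = Posz (st 2 i).-1;
  rep_cap : m (haddr 3 0) = Posz (st 3 0);
  rep_user : forall r, user r -> forall i, m (haddr r i) = Posz (st r i);
  rep_coin : forall i, st 0 i = nth false r i }.

Section Compile.
Variables (A : bool) (st : state) (m : memory) (r : seq bool).
Hypothesis Rm : represents A st m r.

Lemma eval_eaddr q e (k : nat) : eval m e = (Posz k) -> eval m (eaddr q e) = haddr q k.
Proof. by move=> /= ->; rewrite /haddr; lia. Qed.

Lemma cexprP e : wf_expr A e -> eval m (cexpr e) = Posz (heval st e).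
Proof.
elim: e => [k|q a IH|o e1 IH1 e2 IH2] //=.
  case/andP=> uq /IH Ha; case: ifP uq => [/eqP-> /= |q1 /=].
    by rewrite /user /= => Atrue; rewrite Ha (rep_inp Rm).
  rewrite ?q1 /= orbF => uq.
  by have /= -> := @eval_eaddr q _ _ Ha; rewrite (rep_user Rm).
case/andP=> /IH1 H1 /IH2 H2; case: o => /=; rewrite H1 H2 ?divz_nat //.
rewrite lez_nat; case: leqP => H /=; lia.
Qed.

Lemma emodP e c (x y : nat) : eval m e = (Posz x) -> eval m c = (Posz y) ->
  eval m (emod e c) = Posz (x %% y).
Proof.
rewrite /emod /= => -> ->; rewrite divz_nat.
have := divn_eq x y; move: (x %/ y) (x %% y) => a b ->; lia.
Qed.

End Compile.

Lemma represents_upd A st m r q i (z : nat) : user q ->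
  represents A st m r ->
  represents A (upd st q i z) (update m (haddr q i) (Posz z)) r.
Proof.
move=> uq [H1 H2 H3 H4 H5]; have /andP[q5 q64] := uq.
have q0 : 0 < q by apply: leq_trans q5.
split.
- move=> a j; rewrite /update /upd ![in LHS](eq_sym _ (haddr _ _)) !haddr_neg //.
  by rewrite ltn_eqF ?(leq_trans _ q5) // -H1.
- move=> j; rewrite /update /upd ![in X in _ \/ X](eq_sym _ (haddr _ _)) !haddr_neg //.
  by rewrite ltn_eqF ?(leq_trans _ q5).
- by rewrite /update haddr_inj // /upd ltn_eqF //= ?H3 // (leq_trans _ q5).
- move=> q' uq' j; have /andP[_ q'64] := uq'.
  rewrite /update haddr_inj // /upd; case: eqP => [->|_] /=; last exact: H4.
  by case: eqP => // _; apply: H4.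
- by move=> j; rewrite /upd ltn_eqF.
Qed.

Lemma represents_hidden A st m r q d (z : int) : (3 < q < 6) ->
  represents A st m r -> represents A st (update m (haddr q d) z) r.
Proof.
move=> /andP[q3 q6] [H1 H2 H3 H4 H5].
have q0 : 0 < q by apply: leq_trans q3.
have q64 : q < 64 by apply: leq_trans q6 _.
split => //.
- move=> a j; rewrite /update ![in LHS](eq_sym _ (haddr _ _)) !haddr_neg //.
  by rewrite -H1.
- move=> j; rewrite /update ![in X in _ \/ X](eq_sym _ (haddr _ _)) !haddr_neg //.
- by rewrite /update haddr_inj // ltn_eqF.
- move=> q' /[dup] uq' /andP[lq q'64] i; rewrite /update haddr_inj //.
  by rewrite gtn_eqF ?H4 //; lia.
Qed.

Section CompProg.
Variables (A : bool) (pars : seq nat) (par : nat -> nat) (X : nat).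
Hypothesis capX : 0 < par 3 <= X.
Hypotheses (pars3 : 3 \in pars) (pars0 : 0 \notin pars).

Definition same_pars (st : state) := forall b, b \in pars -> st b 0 = par b.

Lemma sem_pars p st : wf_prog A pars p -> same_pars st -> same_pars (sem p st).
Proof.
move=> wf sp b bp; rewrite sem_frame ?sp //.
suff b0 : (b \in mods p) -> b = 0 \/ b \notin pars.
  by apply/negP => /b0[b0E|]; [move: pars0; rewrite -b0E bp|rewrite bp].
elim: p wf {sp} => [|q i e|q i|p1 IH1 p2 IH2|e p1 IH1 p2 IH2|x c p1 IH] //=.
- by case/and4P=> _ nq _ _; rewrite inE => /eqP->; right.
- by case/and3P=> _ nq _; rewrite !inE => /orP[/eqP->|/eqP->]; [left|right].
- by case/andP=> /IH1 H1 /IH2 H2; rewrite mem_cat => /orP[/H1|/H2].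
- by case/and3P=> _ /IH1 H1 /IH2 H2; rewrite mem_cat => /orP[/H1|/H2].
- by case/and5P=> _ nx _ _ /IH H; rewrite inE => /orP[/eqP->|/H] //; right.
Qed.

Lemma same_pars_upd st x i z : x \notin pars -> same_pars st ->
  same_pars (upd st x i z).
Proof.
by move=> xp sp b bp; rewrite /upd; case: eqP => [bx|]; [rewrite -bx bp in xp|rewrite sp].
Qed.

Definition keeps d (m m' : memory) := forall q j, 3 < q < 6 -> j < d ->
  m' (haddr q j) = m (haddr q j).

Lemma keeps_user d m q i z : user q -> keeps d m (update m (haddr q i) z).
Proof.
move=> /andP[q5 q64] q' j /andP[q'3 q'6] jd; rewrite /update haddr_inj //; last lia.
by rewrite ltn_eqF //; lia.
Qed.

Lemma keeps_trans d m1 m2 m3 : keeps d m1 m2 -> keeps d m2 m3 -> keeps d m1 m3.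
Proof. by move=> H1 H2 q j qb jd; rewrite H2 // H1. Qed.

(** [keeps d] carries the induction through nested loops: a body compiled at depth [d.+1] preserves
    the counter at depth [d]. *)
Lemma comp_exec p d st m r : wf_prog A pars p -> same_pars st ->
  represents A st m r -> mem_bounded X m ->
  exists m' r' k, [/\ exec X (comp d p) m r m' r' k, k <= psteps par p,
     represents A (sem p st) m' r', mem_bounded X m' & keeps d m m'].
Proof.
elim: p d st m r =>
  [|q i e|q i|p1 IH1 p2 IH2|e p1 IH1 p2 IH2|x b p1 IH] d st m r /=.
- by move=> _ _ Rm mX; exists m, r, 1; split=> //; exact: ExSkip.
- case/and4P=> uq qp wi we sp Rm mX.
  have Hi := cexprP Rm wi; have He := cexprP Rm we.
  have Hv : eval m (emod (cexpr e) (reg 3 0)) = Posz (heval st e %% st 3 0).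
    by apply: emodP => //=; rewrite (rep_cap Rm).
  have capE : st 3 0 = par 3 by exact: sp.
  have vX : heval st e %% st 3 0 <= X.
    case/andP: capX => c0 cX.
    by apply: leq_trans cX; rewrite capE; apply/ltnW; rewrite ltn_mod.
  exists (update m (eval m (target q (cexpr i))) (eval m (emod (cexpr e) (reg 3 0)))).
  exists r, 1; split => //.
  + by apply: ExStore; rewrite Hv.
  + rewrite Hv /target; case: eqP uq => [-> /=|/eqP q2].
      move=> nA; rewrite Hi.
      case: Rm => H1 H2 H3 H4 H5; split.
      - by move=> At; rewrite At in nA.
      - move=> j; rewrite /update eqz_nat /upd eqxx; case: ifP => _; last exact: H2.
        by right; rewrite addn1.
      - by rewrite /update haddr_neg.
      - move=> q' uq' j; rewrite /update haddr_neg; last by case/andP: uq'; lia.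
        by rewrite H4 // /upd; case: eqP uq' => // ->.
      - by move=> j; rewrite /upd /= H5.
    rewrite orbF addn0 => uq.
    by rewrite (@eval_eaddr m q _ _ Hi); apply: represents_upd.
  + by apply: mem_bounded_update => //; rewrite Hv.
  + rewrite /target; case: eqP uq => [-> /= _|/eqP q2].
      move=> q' j q'b jd; rewrite /update Hi haddr_neg //; lia.
    rewrite orbF => uq.
    by rewrite (@eval_eaddr m q _ _ Hi); apply: keeps_user.
- case/and3P=> uq qp wi sp Rm mX.
  have Hi := cexprP Rm wi.
  exists (update m (eval m (eaddr q (cexpr i))) (Posz (head false r))).
  exists (behead r), 1; split => //; first exact: ExToss.
  + rewrite (@eval_eaddr m q _ _ Hi).
    have -> : Posz (head false r) = Posz (st 0 0).
      by rewrite (rep_coin Rm) nth0.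
    apply: represents_upd => //.
    case: Rm => H1 H2 H3 H4 H5; split => //.
    * by move=> q' uq' j; rewrite /coin_tail; case: eqP uq' => [->|_ uq'] //; exact: H4.
    * by move=> j; rewrite /coin_tail /= H5 nth_behead.
  + apply: mem_bounded_update => //.
    by case: (head _ _) => //=; case/andP: capX; lia.
  + by rewrite (@eval_eaddr m q _ _ Hi); apply: keeps_user.
- case/andP=> w1 w2 sp Rm mX.
  have [m1 [r1 [k1 [E1 L1 R1 B1 P1]]]] := IH1 d st m r w1 sp Rm mX.
  have [m2 [r2 [k2 [E2 L2 R2 B2 P2]]]] := IH2 d _ m1 r1 w2 (sem_pars w1 sp) R1 B1.
  exists m2, r2, (k1 + k2).+1; split => //; first exact: ExSeq E1 E2.
    by rewrite ltnS leq_add.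
  exact: keeps_trans P1 P2.
- case/and3P=> we w1 w2 sp Rm mX.
  have He := cexprP Rm we.
  case: ifP => c0.
    have [m1 [r1 [k1 [E1 L1 R1 B1 P1]]]] := IH1 d st m r w1 sp Rm mX.
    exists m1, r1, k1.+1; split => //; last by rewrite ltnS leq_max L1.
    by apply: ExIf; rewrite He eqz_nat c0.
  have [m1 [r1 [k1 [E1 L1 R1 B1 P1]]]] := IH2 d st m r w2 sp Rm mX.
  exists m1, r1, k1.+1; split => //; last by rewrite ltnS leq_max L1 orbT.
  by apply: ExIf; rewrite He eqz_nat c0.
- case/and5P=> ux xp ub bp wp sp Rm mX.
  rewrite (sp _ bp).
  set N := par b.
  set m1 := update m (haddr 5 d) (Posz N).
  set m2 := update m1 (haddr 4 d) (Posz 0).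
  have bE : eval m (reg b 0) = Posz N by rewrite /= (rep_user Rm) // sp.
  have NX : N <= X by have := mX (haddr b 0); rewrite (rep_user Rm) // sp.
  have R2 : represents A st m2 r by apply: represents_hidden => //; apply: represents_hidden.
  have B2 : mem_bounded X m2 by apply: mem_bounded_update => //; apply: mem_bounded_update.
  have K2 : keeps d m m2.
    move=> q j qb jd; have q64 : q < 64 by lia.
    by rewrite /m2 /m1 /update !haddr_inj // (ltn_eqF jd) !andbF.
  have C2 : m2 (haddr 4 d) = Posz 0 by rewrite /m2 /update eqxx.
  have L2 : m2 (haddr 5 d) = Posz N.
    by rewrite /m2 /m1 /update haddr_inj //= eqxx.
  set W := While _ _.
  suff [m' [r' [k [E Lk R' B' K']]]] : exists m' r' k,
      [/\ exec X W m2 r m' r' k, k <= 1 + N * (psteps par p1 + 5),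
      represents A (iteri N (fun i st' => sem p1 (upd st' x 0 i)) st) m' r',
      mem_bounded X m' & keeps d m2 m'].
    exists m', r', (1 + (1 + k).+1).+1; split => //; last exact: keeps_trans K2 K'.
      apply: (ExSeq (m1 := m1) (r1 := r)).
        by rewrite /m1 -bE; apply: ExStore; rewrite bE.
      by apply: ExSeq E; apply: (@ExStore X (Const (haddr 4 d)) (Const 0) m1 r).
  (* Induction on the number [j] of iterations still to run, the counter being at [N - j]. *)
  suff H : forall j st0 m0 r0, j <= N -> same_pars st0 -> represents A st0 m0 r0 ->
      mem_bounded X m0 -> m0 (haddr 4 d) = Posz (N - j) -> m0 (haddr 5 d) = Posz N ->
      st0 = iteri (N - j) (fun i st' => sem p1 (upd st' x 0 i)) st ->
      exists m' r' k,
      [/\ exec X W m0 r0 m' r' k, k <= 1 + j * (psteps par p1 + 5),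
      represents A (iteri N (fun i st' => sem p1 (upd st' x 0 i)) st) m' r',
      mem_bounded X m' & keeps d m0 m'].
    by apply: (H N st m2 r) => //; rewrite subnn.
  elim=> [|j IHj] st0 m0 r0 jN sp0 R0 B0 c4 c5 stE.
    exists m0, r0, 1; split => //; last by rewrite -[in N in iteri N](subn0 N) -stE.
    apply: ExWhileF => /=; rewrite c4 c5; case: lerP => //; lia.
  set i := N - j.+1.
  set ma := update m0 (haddr x 0) (Posz i).
  have Ra : represents A (upd st0 x 0 i) ma r0 by apply: represents_upd.
  have iX : i <= X by rewrite /i; lia.
  have Ba : mem_bounded X ma by apply: mem_bounded_update.
  have [mb [rb [kb [Eb Lb Rb Bb Kb]]]] :=
    IH d.+1 _ _ _ wp (same_pars_upd _ _ xp sp0) Ra Ba.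
  have xne : x != 4 /\ x != 5 by case/andP: ux => *; lia.
  have x64 : x < 64 by case/andP: ux.
  have ka q : 3 < q < 6 -> forall j', ma (haddr q j') = m0 (haddr q j').
    move=> qb j'; rewrite /ma /update haddr_inj //; last lia.
    by rewrite ltn_eqF //; case/andP: ux; lia.
  have b4 : mb (haddr 4 d) = Posz i by rewrite Kb // ka.
  have b5 : mb (haddr 5 d) = Posz N by rewrite Kb // ka.
  set mc := update mb (haddr 4 d) (Posz i + 1)%R.
  have iS : (Posz i + 1)%R = Posz (N - j) by rewrite /i; lia.
  have [|||||||mz [rz [kz [Ez Lz Rz Bz Kz]]]] := IHj (sem p1 (upd st0 x 0 i)) mc rb.
  + lia.
  + by apply: sem_pars => //; apply: same_pars_upd.
  + exact: represents_hidden.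
  + by apply: mem_bounded_update; rewrite // iS /=; lia.
  + by rewrite /mc /update eqxx.
  + by rewrite /mc /update haddr_inj.
  + by rewrite stE -[N - j](_ : i.+1 = _) //= /i; lia.
  exists mz, rz, ((1 + (kb + 1).+1).+1 + kz).+1; split => //.
  + apply: (ExWhileT (m1 := mc) (r1 := rb)) => //=.
      by rewrite c4 c5; case: lerP => //; lia.
    apply: (ExSeq (m1 := ma) (r1 := r0)).
      rewrite /ma -c4.
      by apply: (@ExStore X (Const (haddr x 0)) (reg 4 d) m0 r0); rewrite /= c4.
    apply: ExSeq Eb _.
    rewrite /mc -b4.
    apply: (@ExStore X (Const (haddr 4 d)) (Op OpAdd (reg 4 d) (Const 1)) mb rb).
    by rewrite /= b4 iS /=; lia.
  + by move: Lz Lb; lia.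
  + apply: keeps_trans Kz => q j' qb jd.
    rewrite /mc /update haddr_inj ?(ltn_eqF jd) ?andbF; try lia.
    by rewrite Kb ?ka //; lia.
Qed.

End CompProg.

(** * Symbolic execution; logarithms, powers of two and random words *)

Local Open Scope nat_scope.

Arguments sem : simpl never.
Arguments upd : simpl never.

Notation V x := (Get x (Num 0)).
Notation "x [+] y" := (Bin OpAdd x y) (at level 50, left associativity).
Notation "x [-] y" := (Bin OpSub x y) (at level 50, left associativity).
Notation "x [*] y" := (Bin OpMul x y) (at level 40, left associativity).
Notation "x [/] y" := (Bin OpDiv x y) (at level 40, left associativity).
Notation "x [<=] y" := (Bin OpLeq x y) (at level 70).
Notation "p ;; q" := (Then p q) (at level 90, right associativity).
Notation "r <- e" := (Set_ r (Num 0) e) (at level 80).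
Notation "r @ i <- e" := (Set_ r i e) (at level 80, i at level 79).

Lemma sem_then p q st : sem (p ;; q) st = sem q (sem p st). Proof. by []. Qed.

Lemma sem_cond e p q st :
  sem (Cond e p q) st = if heval st e != 0 then sem p st else sem q st.
Proof. by []. Qed.

Lemma sem_nop st : sem Nop st = st. Proof. by []. Qed.

Lemma sem_set r i e st iv v : heval st i = iv -> heval st e = v -> v < st 3 0 ->
  r != 2 -> sem (Set_ r i e) st = upd st r iv v.
Proof. by move=> <- <- Hv /negbTE r2; rewrite /sem r2 addn0 modn_small. Qed.

Lemma sem_then_set r i e p st iv v : heval st i = iv -> heval st e = v -> v < st 3 0 ->
  r != 2 -> sem (Set_ r i e ;; p) st = sem p (upd st r iv v).
Proof. by move=> *; rewrite sem_then (@sem_set _ _ _ _ iv v). Qed.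

Definition agree (rs : seq nat) (st st' : state) :=
  forall r, r \notin rs -> st r = st' r.

Lemma sem_agree p st : agree (mods p) (sem p st) st.
Proof. by move=> r; apply: sem_frame. Qed.

Lemma upd_ne st r i z r' : r' != r -> upd st r i z r' = st r'.
Proof. by rewrite /upd => /negbTE->. Qed.

Lemma upd_eq st r i z i' : upd st r i z r i' = if i' == i then z else st r i'.
Proof. by rewrite /upd eqxx. Qed.

(** Loop rule in which [agree] hands every array untouched by the body to the preservation step, so
    that invariants stay short. *)
Lemma sem_for_inv x b p st (Inv : nat -> state -> Prop) :
  Inv 0 st ->
  (forall i ta, i < st b 0 -> agree (x :: mods p) ta st -> Inv i ta ->
     Inv i.+1 (sem p (upd ta x 0 i))) ->
  Inv (st b 0) (sem (For x b p) st).
Proof.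
move=> I0 Is; rewrite /sem -/sem.
suff H k : k <= st b 0 ->
   agree (x :: mods p) (iteri k (fun i st' => sem p (upd st' x 0 i)) st) st /\
   Inv k (iteri k (fun i st' => sem p (upd st' x 0 i)) st) by case: (H (st b 0)).
elim: k => [|k IH] kb /=; first by split.
have [A Ik] := IH (ltnW kb); split; last exact: Is.
move=> r; rewrite inE negb_or => /andP[rx rp].
by rewrite sem_agree // upd_ne // A // inE negb_or rx.
Qed.

Ltac rd := rewrite /= /upd /=.
Ltac sset iv v :=
  first [rewrite (@sem_then_set _ _ _ _ _ iv v) | rewrite (@sem_set _ _ _ _ iv v)].

(** It runs for [bnd] rounds although only logarithmically many have an effect, because the length
    of a loop has to be a parameter. *)
Definition log_prog (dst pw src bnd x : nat) : prog :=
  dst <- Num 0 ;; pw <- Num 2 ;;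
  For x bnd (Cond (V pw [<=] V src)
               (dst <- V dst [+] Num 1 ;; pw <- V pw [*] Num 2) Nop).

Lemma trunc_log_lt a : 0 < a -> trunc_log 2 a < a.
Proof.
move=> a0; apply: leq_trans (ltn_expl (trunc_log 2 a) (leqnn 2)) _.
exact: trunc_logP.
Qed.

Lemma log_progP dst pw src bnd x st :
  all (fun p => p.1 != p.2) [:: (dst, src); (dst, pw); (dst, 3); (dst, 2); (pw, src);
    (pw, bnd); (pw, 3); (pw, 2); (x, src); (x, dst); (x, 3); (x, pw); (dst, bnd)] ->
  0 < st src 0 <= st bnd 0 -> 2 * st bnd 0 < st 3 0 ->
  sem (log_prog dst pw src bnd x) st dst 0 = trunc_log 2 (st src 0).
Proof.
case/and5P=> /= ds dp d3 d2 /and5P[ps pb p3 p2 /and5P[xs xd x3 xp /andP[db _]]].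
move=> /andP[s0 sb] cap.
set a := st src 0 in s0 sb *.
have H2 : 2 < st 3 0 by lia.
rewrite /log_prog; sset 0 0; rewrite //; last by lia.
set st1 := upd st dst 0 0; sset 0 2; rewrite //; last by rewrite /st1 upd_ne // eq_sym.
set st2 := upd st1 pw 0 2.
have b2 : st2 bnd 0 = st bnd 0 by rewrite /st2 /st1 !upd_ne // eq_sym.
have s2 : st2 src 0 = a by rewrite /st2 /st1 !upd_ne // eq_sym.
have c2 : st2 3 0 = st 3 0 by rewrite /st2 /st1 !upd_ne // eq_sym.
pose Inv i (ta : state) := ta dst 0 = minn i (trunc_log 2 a) /\ ta pw 0 = 2 ^ (ta dst 0).+1.
suff [] : Inv (st2 bnd 0) (sem (For x bnd (Cond (V pw [<=] V src)
     (dst <- V dst [+] Num 1 ;; pw <- V pw [*] Num 2) Nop)) st2).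
  move=> -> _; rewrite b2; apply/minn_idPr/ltnW.
  exact: leq_trans (trunc_log_lt s0) sb.
apply: sem_for_inv.
  by rewrite /Inv /st2 !upd_eq upd_ne // /st1 upd_eq min0n.
move=> i ta ib A [Hd Hp].
have as_ : ta src 0 = a.
  by rewrite A ?s2 //= !inE !negb_or ![src == _]eq_sym xs ds ps.
have ac : ta 3 0 = st 3 0.
  by rewrite A ?c2 //= !inE !negb_or ![3 == _]eq_sym x3 d3 p3.
rewrite sem_cond /=.
rewrite !upd_ne //; try by rewrite eq_sym.
rewrite Hp as_ Hd.
have E : (2 ^ (minn i (trunc_log 2 a)).+1 <= a) = (i < trunc_log 2 a).
  apply/idP/idP => [H|H].
    rewrite ltnNge; apply/negP => H'; move: H; rewrite (minn_idPr H') leqNgt.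
    by rewrite trunc_log_ltn.
  rewrite (minn_idPl (ltnW H)); apply: leq_trans (trunc_logP (leqnn 2) s0).
  by rewrite leq_exp2l.
rewrite E; case: ltnP => iT /=.
  have pL : 2 ^ i.+1 <= a by rewrite -(minn_idPl (ltnW iT)) E.
  have di : ta dst 0 = i by rewrite Hd (minn_idPl (ltnW iT)).
  have pi : ta pw 0 = 2 ^ i.+1 by rewrite Hp di.
  have iL : i < 2 ^ i by apply: ltn_expl.
  sset 0 i.+1; rewrite //.
  - sset 0 (2 ^ i.+2); rewrite //.
    + by split; rewrite !(upd_eq, upd_ne) //= ?(minn_idPl iT) //; rewrite ?eqxx // eq_sym.
    + by rewrite /= upd_ne 1?eq_sym // upd_ne 1?eq_sym // pi -expnSr.
    + rewrite !upd_ne 1?eq_sym // ac.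
      have : 2 ^ i.+2 = 2 * 2 ^ i.+1 by rewrite expnS.
      lia.
  - by rewrite /= upd_ne 1?eq_sym // di addn1.
  - by rewrite upd_ne 1?eq_sym // ac; move: pL; rewrite expnS; lia.
rewrite sem_nop; split; rewrite !upd_ne 1?eq_sym //.
by rewrite Hd !(minn_idPr _) // ltnW // ltnS.
Qed.

Definition pow_prog : prog :=
  25 @ Num 0 <- Num 1 ;; For 41 14 (25 @ (V 41 [+] Num 1) <- Get 25 (V 41) [*] Num 2).

Lemma pow_progP st : 2 ^ st 14 0 < st 3 0 ->
  forall j, j <= st 14 0 -> sem pow_prog st 25 j = 2 ^ j.
Proof.
move=> cap; rewrite /pow_prog; sset 0 1; rewrite //; last first.
  by apply: leq_trans cap; rewrite ltnS expn_gt0.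
set st1 := upd st 25 0 1.
apply: (@sem_for_inv 41 14 _ st1 (fun k ta => forall j, j <= k -> ta 25 j = 2 ^ j)).
  by move=> j; rewrite leqn0 => /eqP->.
move=> i ta ib A H.
have ac : ta 3 0 = st 3 0 by rewrite A.
sset i.+1 (2 ^ i.+1); rewrite //.
- move=> j; rewrite leq_eqVlt => /orP[/eqP->|ji]; first by rewrite upd_eq eqxx.
  by rewrite upd_eq ltn_eqF // upd_ne // H.
- by rd; rewrite addn1.
- by rd; rewrite H // expnSr.
- by rd; rewrite ac; apply: leq_ltn_trans cap; rewrite leq_exp2l.
Qed.

(** Binary value of [k] coins starting at coin [o], most significant bit first. *)
Fixpoint bits_val (cf : nat -> nat) (o k : nat) : nat :=
  if k is k'.+1 then bits_val cf o k' * 2 + cf (o + k') else 0.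

Lemma bits_val_lt cf o k : (forall i, cf i < 2) -> bits_val cf o k < 2 ^ k.
Proof.
by move=> H; elim: k => //= k IH; rewrite expnSr; have := H (o + k); lia.
Qed.

Definition rand_prog : prog :=
  For 41 18 (40 <- Num 0 ;;
    For 42 13 (Flip 43 (Num 0) ;; 40 <- V 40 [*] Num 2 [+] V 43) ;;
    26 @ V 41 <- V 40).

Lemma rand_progP st : (forall i, st 0 i < 2) -> 2 ^ st 13 0 <= st 3 0 ->
  forall k, k < st 18 0 ->
  sem rand_prog st 26 k = bits_val (st 0) (k * st 13 0) (st 13 0).
Proof.
move=> coin cap; set m := st 13 0 in cap *.
have cap0 : 0 < st 3 0 by apply: leq_trans cap; rewrite expn_gt0.
rewrite /rand_prog; set body := Then _ _.
have [] // := @sem_for_inv 41 18 body st (fun k (ta : state) =>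
     (forall j, j < k -> ta 26 j = bits_val (st 0) (j * m) m) /\
     (forall j, ta 0 j = st 0 (k * m + j))).
move=> i ta ib A [H1 H2]; rewrite /body.
have am : ta 13 0 = m by rewrite A.
have ac : ta 3 0 = st 3 0 by rewrite A.
sset 0 0; rewrite //; last by rd; rewrite ac.
set ta1 := upd (upd ta 41 0 i) 40 0 0; rewrite sem_then.
have [||F1 F2] := @sem_for_inv 42 13
  (Flip 43 (Num 0) ;; 40 <- V 40 [*] Num 2 [+] V 43) ta1
  (fun k (tb : state) => tb 40 0 = bits_val (st 0) (i * m) k /\
     forall j, tb 0 j = st 0 (i * m + k + j)).
- by split=> // j; rewrite addn0 -H2.
- move=> k tb; rewrite [ta1 13 0]am => kb B [B1 B2].
  have bc : tb 3 0 = st 3 0 by rewrite B.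
  rewrite sem_then; set tc := sem (Flip _ _) _.
  sset 0 (bits_val (st 0) (i * m) k.+1); rewrite //.
  + split=> // j; rewrite /tc /sem; rd; rewrite /coin_tail; rd.
    by rewrite B2 addnS -addSn addnS.
  + by rewrite /tc /sem; rd; rewrite /coin_tail; rd; rewrite B1 B2 addn0.
  + apply: leq_trans (bits_val_lt (i * m) k.+1 coin) _.
    rewrite /tc /sem /upd /= /coin_tail /= bc; apply: leq_trans cap.
    by rewrite leq_exp2l.
rewrite [ta1 13 0]am in F1 F2.
set tz := sem (For 42 13 _) ta1 in F1 F2 *.
have AZ := @sem_agree _ ta1 : agree _ tz ta1.
sset i (bits_val (st 0) (i * m) m); rewrite //.
- split=> [j|j]; last by rd; rewrite F2 mulSn [m + _]addnC.
  rewrite ltnS leq_eqVlt upd_eq => /orP[/eqP->|ji]; first by rewrite eqxx.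
  by rewrite ltn_eqF // AZ // -H1.
- by rd; rewrite AZ.
- by rewrite AZ // [ta1 3 0]ac; apply: leq_trans (bits_val_lt _ _ coin) cap.
Qed.

(** * The hashing program *)

Local Open Scope nat_scope.

(** One plus the last position below [n] with value [v], or 0: what a table indexed by values
    contains after the positions have been written into it in order. *)
Fixpoint lasteq (f : nat -> nat) (n v : nat) : nat :=
  if n is n'.+1 then (if f n' == v then n else lasteq f n' v) else 0.

Lemma lasteq_le f n v : lasteq f n v <= n.
Proof. by elim: n => //= n IH; case: eqP => // _; apply: leqW. Qed.

Lemma lasteq_mem f n v : 0 < lasteq f n v -> f (lasteq f n v).-1 = v.
Proof. by elim: n => //= n IH; case: eqP. Qed.

Lemma lasteq_max f n v j : j < n -> f j = v -> j < lasteq f n v.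
Proof.
elim: n => //= n IH; rewrite ltnS leq_eqVlt => /orP[/eqP-> ->|jn fj].
  by rewrite eqxx.
by case: eqP => [_|_]; [apply: ltnW|apply: IH].
Qed.

Lemma leq_sum_prefix (F : nat -> nat) q r : q <= r ->
  \sum_(k < q) F k <= \sum_(k < r) F k.
Proof.
move=> qr; rewrite (big_ord_widen r F qr) [X in X <= _]big_mkcond.
by apply: leq_sum => k _; case: ifP.
Qed.

(** Renames hash values to numbers below [n] without sorting, so that counts need only [n] cells per
    level. *)
Definition last_label (f : nat -> nat) (n i : nat) := (lasteq f n (f i)).-1.

Lemma last_label_lt f n i : 0 < n -> last_label f n i < n.
Proof.
by move=> n0; rewrite /last_label; have := lasteq_le f n (f i); case: (lasteq _ _ _) => //=.
Qed.

Lemma last_labelP f n i j : i < n -> j < n ->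
  (last_label f n i == last_label f n j) = (f i == f j).
Proof.
move=> iN jN; apply/eqP/eqP => [|H]; last by rewrite /last_label H.
rewrite /last_label => H.
have Hi := lasteq_max iN (erefl (f i)); have Hj := lasteq_max jN (erefl (f j)).
rewrite -(lasteq_mem (leq_ltn_trans (leq0n _) Hi)).
by rewrite -(lasteq_mem (leq_ltn_trans (leq0n _) Hj)) H.
Qed.

Lemma lasteq_bucket_rep N E (lab : nat -> nat -> nat) :
  bucket_rep N E (fun e i => lasteq (lab e) N (lab e i)).
Proof.
move=> e i eE iN; have Hi := lasteq_max iN (erefl (lab e i)).
have H0 := leq_ltn_trans (leq0n _) Hi.
by rewrite H0 lasteq_le lasteq_mem.
Qed.

Lemma lasteq_rep_eq N (f : nat -> nat) i j : i < N -> j < N ->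
  (lasteq f N (f i) == lasteq f N (f j)) = (f i == f j).
Proof.
move=> iN jN; apply/eqP/eqP => [H|->//].
have Hi := lasteq_max iN (erefl (f i)); have Hj := lasteq_max jN (erefl (f j)).
rewrite -(lasteq_mem (leq_ltn_trans (leq0n _) Hi)).
by rewrite -(lasteq_mem (leq_ltn_trans (leq0n _) Hj)) H.
Qed.

Lemma lasteq_bucket_prev N E (lab : nat -> nat -> nat) :
  bucket_prev N E (fun e i => lasteq (lab e) N (lab e i))
                  (fun e i => lasteq (lab e) i (lab e i)).
Proof.
move=> e i eE iN; split; first exact: lasteq_le.
  by move=> H; rewrite (lasteq_mem H).
move=> j ji /eqP; rewrite (lasteq_rep_eq _ (ltn_trans ji iN) iN) => /eqP.
exact: lasteq_max.
Qed.

(** Hash values serve directly as addresses in array 28. Only cells written in the same pass are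
    read back, so this huge table is never initialised. *)
Definition point_scan : prog :=
  For 49 6 (51 <- Num 0 ;;
    For 50 8 (51 <- V 51 [+] Get 26 (V 47 [+] V 8 [+] V 50) [*]
      ((Get 1 (Num 4 [+] V 49 [*] V 8 [+] V 50) [+] Get 26 (V 47 [+] V 50))
       [/] Get 25 (V 48))) ;;
    27 @ V 49 <- V 51 ;;
    28 @ (V 51 [*] (V 16 [*] V 12) [+] (V 46 [*] V 12 [+] V 48)) <- V 49).

Definition point_read : prog :=
  For 49 6 (29 @ (V 48 [*] V 6 [+] V 49) <-
    Get 28 (Get 27 (V 49) [*] (V 16 [*] V 12) [+] (V 46 [*] V 12 [+] V 48))).

Definition point_prog : prog := point_scan ;; point_read.

(** Words of a class from its base on: [al] grid shifts, [al] point coefficients, then [Lv * n]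
    coefficients and [Lv * n] shifts for the counts. In [width] the truncated exponent is 0 from the
    level of the scale on, where counts are therefore not rounded. *)
Definition coef : hexpr := Get 26 (V 47 [+] Num 2 [*] V 8 [+] V 52).
Definition shift : hexpr := Get 26 (V 47 [+] Num 2 [*] V 8 [+] V 19 [+] V 52).
Definition width : hexpr := Get 25 (V 44 [-] V 48).

(** One count per level changes when a point enters or leaves. The new term is added before the old
    one is subtracted, to avoid truncation. *)
Definition recount_prog (src : nat) (o : binop) : prog :=
  For 48 12 (52 <- V 48 [*] V 6 [+] Get 29 (V 48 [*] V 6 [+] V src) ;;
    53 <- (V 53 [+] coef [*] ((Bin o (Get 30 (V 52)) (Num 1) [+] shift) [/] width))
          [-] coef [*] ((Get 30 (V 52) [+] shift) [/] width) ;;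
    30 @ V 52 <- Bin o (Get 30 (V 52)) (Num 1)).

Definition slide_prog : prog :=
  For 41 19 (30 @ V 41 <- Num 0) ;;
  53 <- Num 0 ;;
  For 54 6 (recount_prog 54 OpAdd ;;
    Cond (V 7 [<=] V 54) (55 <- V 54 [-] V 7 ;; recount_prog 55 OpSub) Nop ;;
    Cond (V 7 [<=] V 54 [+] Num 1) (31 @ (V 54 [+] Num 1 [-] V 7) <- V 53) Nop).

(** At the top scale all labels become 0. Array 33 maps a label to one plus the last window seen
    with it: read during the scan it yields the list predecessor, afterwards the head of the
    bucket. *)
Definition bucket_prog : prog :=
  Cond (V 14 [<=] V 44 [+] Num 1) (For 49 10 (31 @ V 49 <- Num 0)) Nop ;;
  For 49 10 (32 @ (V 46 [*] V 10 [+] V 49) <- Get 33 (Get 31 (V 49) [*] V 16 [+] V 46) ;;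
             33 @ (Get 31 (V 49) [*] V 16 [+] V 46) <- V 49 [+] Num 1) ;;
  For 49 10 (34 @ (V 46 [*] V 10 [+] V 49) <- Get 33 (Get 31 (V 49) [*] V 16 [+] V 46)) ;;
  Cond (V 44) (35 @ V 46 <- Get 25 (V 44)) (35 @ V 46 <- Num 0).

Definition hash_prog : prog :=
  For 44 14 (For 45 15 (
    46 <- V 44 [*] V 15 [+] V 45 ;; 47 <- V 46 [*] V 23 ;;
    For 48 12 point_prog ;; slide_prog ;; bucket_prog)).

Section HashSem.
Variable st0 : state.
Local Notation cap := (st0 3 0).
Local Notation n := (st0 6 0).
Local Notation s := (st0 7 0).
Local Notation al := (st0 8 0).
Local Notation N := (st0 10 0).
Local Notation Lv := (st0 12 0).
Local Notation Rn := (st0 14 0).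
Local Notation K := (st0 15 0).
Local Notation E := (st0 16 0).
Local Notation str := (st0 23 0).
Local Notation rnd := (st0 26).

Definition point_part (base l i q : nat) : nat :=
  \sum_(k < q) rnd (base + al + k) *
     ((st0 1 (4 + i * al + k) + rnd (base + k)) %/ 2 ^ l).
Definition point_hash base l i := point_part base l i al.
Definition point_label base l i := last_label (point_hash base l) n i.

(** The second quotient does not depend on [c]; it makes the hash of an empty window 0, the value
    from which sliding starts. *)
Definition count_term (base rho y c : nat) : nat :=
  rnd (base + 2 * al + y) *
  ((c + rnd (base + 2 * al + Lv * n + y)) %/ 2 ^ (rho - y %/ n)
   - rnd (base + 2 * al + Lv * n + y) %/ 2 ^ (rho - y %/ n)).
Definition count_hash base rho (cnt : nat -> nat) : nat :=
  \sum_(y < Lv * n) count_term base rho y (cnt y).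
Definition window_hash base rho i : nat :=
  count_hash base rho (fun y => wcount s (point_label base (y %/ n)) (y %% n) i).
(** Class [e] is repetition [e %% K] of scale [e %/ K]. *)
Definition class_label e i : nat :=
  if (e %/ K).+1 < Rn then window_hash (e * str) (e %/ K) i else 0.
(** At scale 0 nothing is rounded: up to hash collisions equal labels mean equal counts, whence
    length 0. *)
Definition class_weight e : nat := if e %/ K == 0 then 0 else 2 ^ (e %/ K).

Definition low (ta : state) := forall r, r <= 26 -> ta r = st0 r.

Lemma lowE ta : low ta ->
  (ta 1 = st0 1) * (ta 3 = st0 3) * (ta 6 = st0 6) * (ta 7 = st0 7) * (ta 8 = st0 8) *
  (ta 10 = st0 10) * (ta 12 = st0 12) * (ta 14 = st0 14) * (ta 15 = st0 15) *
  (ta 16 = st0 16) * (ta 19 = st0 19) * (ta 23 = st0 23) *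
  (ta 25 = st0 25) * (ta 26 = st0 26).
Proof. by move=> H; do !split; apply: H. Qed.

Lemma low_agree rs ta tb : all (ltn 26) rs -> agree rs ta tb -> low tb -> low ta.
Proof.
move=> /allP H A L r r26; rewrite A ?L //; apply/negP => /H.
by rewrite /= ltnNge r26.
Qed.

Lemma low_upd ta r i z : 26 < r -> low ta -> low (upd ta r i z).
Proof.
move=> r26 L q q26; rewrite upd_ne ?L //; apply/eqP => qr.
by move: q26; rewrite qr leqNgt r26.
Qed.

Hypotheses (n_gt0 : 0 < n) (E_gt0 : 0 < E) (Lv_gt0 : 0 < Lv).
Hypotheses (s_gt0 : 0 < s) (N_def : N = (n - s).+1) (le_sn : s <= n).
Hypothesis Lvn_def : st0 19 0 = Lv * n.
Hypothesis E_def : E = Rn * K.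
Hypothesis powE : forall j, j <= Rn -> st0 25 j = 2 ^ j.
Hypothesis Lv_le : Lv <= Rn.
Hypotheses (n_cap : n < cap) (Lvn_cap : Lv * n < cap) (E_cap : E < cap).
Hypotheses (str_cap : E * str < cap) (pow_cap : 2 ^ Rn < cap).
Hypothesis point_cap : forall base l i, i < n -> point_hash base l i < cap.
Hypothesis count_cap : forall base rho cnt,
  (forall y, y < Lv * n -> cnt y <= n) -> count_hash base rho cnt < cap.

Lemma cap_gt1 : 1 < cap.
Proof. exact: leq_ltn_trans n_gt0 n_cap. Qed.

Ltac rdl lo := rewrite /= /upd /= ?(lowE lo).

(** Within a class and level different hash values have different keys, so [lasteq] of the prefix
    scanned so far describes the table. *)
Lemma point_progP ta base e l : low ta -> ta 47 0 = base -> ta 46 0 = e -> ta 48 0 = l ->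
  e < E -> l < Lv ->
  (forall i, i < n -> sem point_prog ta 29 (l * n + i) = point_label base l i) /\
  (forall j, j < l * n -> sem point_prog ta 29 j = ta 29 j).
Proof.
move=> lo b47 b46 b48 eE lL.
set g := point_hash base l.
pose key v := v * (E * Lv) + (e * Lv + l).
have kb : e * Lv + l < E * Lv by rewrite -ltn_subRL; nia.
have key_inj u v : (key u == key v) = (u == v).
  by rewrite /key eqn_add2r eqn_pmul2r // muln_gt0 E_gt0.
rewrite /point_prog sem_then.
have [] := @sem_for_inv 49 6 _ ta (fun k (tb : state) =>
   (forall i, i < k -> tb 27 i = g i) /\
   (forall v, 0 < lasteq g k v -> tb 28 (key v) = (lasteq g k v).-1)) _ _ : 
   (forall i, i < ta 6 0 -> sem point_scan ta 27 i = g i) /\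
   (forall v, 0 < lasteq g (ta 6 0) v -> sem point_scan ta 28 (key v) = (lasteq g (ta 6 0) v).-1).
- by split.
- move=> i tb; rewrite (lowE lo) => iN A [H1 H2].
  have lb : low tb by apply: low_agree A lo.
  have c47 : tb 47 0 = base by rewrite A.
  have c46 : tb 46 0 = e by rewrite A.
  have c48 : tb 48 0 = l by rewrite A.
  sset 0 0; rewrite //; last by rdl lb; apply: ltnW cap_gt1.
  set t1 := upd (upd tb 49 0 i) 51 0 0; rewrite sem_then.
  have l1 : low t1 by do 2!apply: low_upd => //.
  have := @sem_for_inv 50 8 (51 <- V 51 [+] Get 26 (V 47 [+] V 8 [+] V 50) [*]
      ((Get 1 (Num 4 [+] V 49 [*] V 8 [+] V 50) [+] Get 26 (V 47 [+] V 50))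
       [/] Get 25 (V 48))) t1 (fun q (tc : state) => tc 51 0 = point_part base l i q).
  set t2 := sem (For 50 8 _) t1 => F.
  have {F} F : t2 51 0 = g i.
    rewrite /g /point_hash -(lowE l1); apply: F; first by rewrite /point_part big_ord0.
    move=> q tc; rewrite (lowE l1) => qa B Hq.
    have lc : low tc by apply: low_agree B l1.
    have le_g : point_part base l i q.+1 < cap.
      apply: leq_ltn_trans (point_cap base l iN).
      exact: (@leq_sum_prefix (fun k => rnd (base + al + k) *
         ((st0 1 (4 + i * al + k) + rnd (base + k)) %/ 2 ^ l)) q.+1 al qa).
    sset 0 (point_part base l i q.+1); rewrite //; last by rdl lc.
    rdl lc; rewrite Hq [in LHS]B // [in LHS]B // [in LHS]B // /t1 /upd /=.
    by rewrite c47 c48 /point_part big_ord_recr /= powE // ltnW // (leq_trans lL).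
  have A2 := @sem_agree _ t1 : agree _ t2 t1.
  have l2 : low t2 by apply: low_agree A2 l1.
  sset i (g i); rewrite //; [| by rewrite /= A2 | by rewrite (lowE l2) point_cap].
  sset (key (g i)) i; rewrite //.
  + split.
      move=> j; rewrite ltnS leq_eqVlt => /orP[/eqP->|ji]; first by rewrite upd_ne // upd_eq eqxx.
      by rewrite upd_ne // upd_eq ltn_eqF // A2 // -H1.
    move=> v /=; rewrite upd_eq key_inj eq_sym; case: eqP => [//|_ Hv].
    by rewrite upd_ne // A2 // -H2.
  + by rdl l2; rewrite F A2 // A2 // /t1 /upd /= c46 c48.
  + by rdl l2; rewrite A2.
  + by rdl l2; apply: ltn_trans n_cap.
rewrite (lowE lo) => G1 G2.
set t3 := sem point_scan ta in G1 G2 *.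
have A3 := @sem_agree point_scan ta : agree _ t3 ta.
have l3 : low t3 by apply: low_agree A3 lo.
have := @sem_for_inv 49 6 (29 @ (V 48 [*] V 6 [+] V 49) <-
    Get 28 (Get 27 (V 49) [*] (V 16 [*] V 12) [+] (V 46 [*] V 12 [+] V 48))) t3
  (fun k (tb : state) => (forall i, i < k -> tb 29 (l * n + i) = point_label base l i) /\
     (forall j, j < l * n -> tb 29 j = ta 29 j)).
rewrite (lowE l3); apply.
  by split=> // j _; rewrite A3.
move=> i tb iN A [H1 H2].
have lb : low tb by apply: low_agree A l3.
have Hi := lasteq_max iN (erefl (g i)).
sset (l * n + i) (point_label base l i); rewrite //.
- split=> j Hj; rewrite upd_eq.
    rewrite eqn_add2l; move: Hj; rewrite ltnS leq_eqVlt => /orP[/eqP->|ji].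
      by rewrite eqxx.
    by rewrite ltn_eqF // upd_ne // H1.
  by rewrite ltn_eqF ?upd_ne ?H2 // (leq_trans Hj) // leq_addr.
- by rdl lb; rewrite A // A3 // b48.
- rdl lb; rewrite !(A 27, A 28, A 46, A 48) // !(A3 46, A3 48) // b46 b48 G1 // -/(key (g i)) G2 //.
  exact: leq_ltn_trans Hi.
- rdl lb; apply: ltn_trans n_cap; exact: last_label_lt.
Qed.

(** By linearity a change of the count at [y0] exchanges a single summand, in which the constant
    quotients cancel. *)
Lemma count_hash_upd base rho cnt cnt' y0 : y0 < Lv * n ->
  (forall y, y != y0 -> cnt' y = cnt y) ->
  let u := rnd (base + 2 * al + Lv * n + y0) in
  let a := rnd (base + 2 * al + y0) in
  let w := 2 ^ (rho - y0 %/ n) in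
  count_hash base rho cnt + a * ((cnt' y0 + u) %/ w) - a * ((cnt y0 + u) %/ w)
    = count_hash base rho cnt'.
Proof.
move=> yL H u a w; rewrite /count_hash (bigD1 (Ordinal yL)) //= [in RHS](bigD1 (Ordinal yL)) //=.
have -> : \sum_(y < Lv * n | y != Ordinal yL) count_term base rho y (cnt' y) =
          \sum_(y < Lv * n | y != Ordinal yL) count_term base rho y (cnt y).
  by apply: eq_bigr => y ny; rewrite H // -val_eqE.
rewrite /count_term -/u -/a -/w !mulnBr.
have m1 : a * (u %/ w) <= a * ((cnt y0 + u) %/ w).
  by rewrite leq_mul2l leq_div2r ?orbT // leq_addl.
have m2 : a * (u %/ w) <= a * ((cnt' y0 + u) %/ w).
  by rewrite leq_mul2l leq_div2r ?orbT // leq_addl.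
move: m1 m2; move: (a * (u %/ w)) (a * ((cnt y0 + u) %/ w)) (a * ((cnt' y0 + u) %/ w)).
move: (\sum_(y < _ | _) _); lia.
Qed.

Lemma recount_progP src o ta base rho p (lb cnt0 : nat -> nat) : 
  src \in [:: 54; 55] -> low ta -> ta 47 0 = base -> ta 44 0 = rho -> ta src 0 = p ->
  rho <= Rn ->
  (forall l, l < Lv -> ta 29 (l * n + p) = lb l) -> (forall l, lb l < n) ->
  (forall y, y < Lv * n -> ta 30 y = cnt0 y) ->
  ta 53 0 = count_hash base rho cnt0 ->
  (forall y, y < Lv * n -> cnt0 y <= n /\ nat_op o (cnt0 y) 1 <= n) ->
  let cnt1 y := if y %% n == lb (y %/ n) then nat_op o (cnt0 y) 1 else cnt0 y in
  let tb := sem (recount_prog src o) ta in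
  (forall y, y < Lv * n -> tb 30 y = cnt1 y) /\ tb 53 0 = count_hash base rho cnt1.
Proof.
move=> srcE lo b47 b44 bsrc rR Hlb lbn Hc Hh Hb cnt1.
(* Hybrid counts: updated on the first [k] levels, old on the others. *)
pose cntk k y := if (y < k * n) && (y %% n == lb (y %/ n)) then nat_op o (cnt0 y) 1 else cnt0 y.
have ext cnt cnt' : (forall y, y < Lv * n -> cnt y = cnt' y) ->
   count_hash base rho cnt = count_hash base rho cnt'.
  by move=> H; apply: eq_bigr => y _; rewrite H.
suff [H1 H2] : (forall y, y < Lv * n -> sem (recount_prog src o) ta 30 y = cntk Lv y) /\
    sem (recount_prog src o) ta 53 0 = count_hash base rho (cntk Lv).
  have E1 y : y < Lv * n -> cntk Lv y = cnt1 y by rewrite /cntk => ->.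
  by split=> [y yL|]; [rewrite H1 // E1|rewrite H2; apply: ext].
rewrite /recount_prog; set body := Then _ _.
have := @sem_for_inv 48 12 body ta (fun k (tb : state) =>
   (forall y, y < Lv * n -> tb 30 y = cntk k y) /\ tb 53 0 = count_hash base rho (cntk k)).
rewrite (lowE lo); apply.
  have E0 y : cntk 0 y = cnt0 y by rewrite /cntk mul0n.
  by split=> [y yL|]; [rewrite Hc // E0|rewrite Hh; apply: ext].
move=> k tb kL A [H1 H2]; rewrite /body.
have lb_ : low tb by apply: low_agree A lo.
set y0 := k * n + lb k.
have y0L : y0 < Lv * n.
  rewrite /y0; apply: leq_trans (_ : k.+1 * n <= _); last by rewrite leq_mul2r kL orbT.
  by rewrite mulSn addnC ltn_add2r.
have y0d : y0 %/ n = k by rewrite /y0 divnMDl // divn_small ?addn0.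
have y0m : y0 %% n = lb k by rewrite /y0 modnMDl modn_small.
have ck : cntk k y0 = cnt0 y0.
  by rewrite /cntk ltnNge leq_addr.
have ck1 : cntk k.+1 y0 = nat_op o (cnt0 y0) 1.
  rewrite /cntk y0d y0m eqxx mulSn [n + _]addnC ltn_add2l lbn //.
have cne y : y != y0 -> cntk k.+1 y = cntk k y.
  move=> yy; rewrite /cntk; have [yk|yk] := ltnP y (k * n).
    by rewrite (leq_trans yk) // leq_mul2r leqnSn orbT.
  case: ltnP => //= yk1; case: eqP => // ym; case/eqP: yy.
  have yd : y %/ n = k.
    by apply/eqP; rewrite eqn_leq -ltnS ltn_divLR // yk1 leq_divRL.
  by rewrite (divn_eq y n) ym yd.
have [s54 s48] : src != 53 /\ src != 48 by move: srcE; rewrite !inE => /orP[] /eqP->.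
have [s52 s30] : src != 52 /\ src != 30 by move: srcE; rewrite !inE => /orP[] /eqP->.
have csrc : tb src 0 = p.
  by rewrite A //; move: srcE; rewrite !inE => /orP[] /eqP->.
have c29 : tb 29 (k * n + p) = lb k by rewrite A // Hlb.
have c47 : tb 47 0 = base by rewrite A.
have c44 : tb 44 0 = rho by rewrite A.
have kk : k <= Rn by apply: leq_trans (ltnW kL) Lv_le.
sset 0 y0; rewrite //; first last.
- by rdl lb_; apply: ltn_trans Lvn_cap.
- by rewrite /= [upd tb 48 0 k src]upd_ne //; rdl lb_; rewrite csrc c29.
set t1 := upd (upd tb 48 0 k) 52 0 y0.
have l1 : low t1 by do 2!apply: low_upd => //.
have bnd1 y : y < Lv * n -> cntk k.+1 y <= n.
  by move=> yL; have [h1 h2] := Hb y yL; rewrite /cntk; case: ifP.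
sset 0 (count_hash base rho (cntk k.+1)); rewrite //; first last.
- by rewrite (lowE l1); apply: count_cap.
- rewrite /coef /shift /width -(@count_hash_upd base rho (cntk k) (cntk k.+1) y0 y0L cne).
  rewrite ck ck1 y0d /t1; rdl lb_; rewrite Lvn_def c47 c44 H2 H1 // ck powE //.
  exact: leq_trans (leq_subr _ _) rR.
set t2 := upd t1 53 0 _.
have l2 : low t2 by apply: low_upd.
sset y0 (cntk k.+1 y0); rewrite //.
- split=> [y yL|//]; rewrite upd_eq; case: eqP => [->//|/eqP yy].
  by rewrite cne // -H1.
- by rewrite /t2 /t1; rdl lb_; rewrite H1 // ck ck1.
- by rewrite (lowE l2); apply: leq_ltn_trans (bnd1 _ y0L) n_cap.
Qed.

Definition count_range (base lo hi y : nat) : nat :=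
  \sum_(lo <= q < hi) (point_label base (y %/ n) q == y %% n).

Lemma count_range_le base lo hi y : count_range base lo hi y <= hi - lo.
Proof.
rewrite /count_range -[hi - lo]muln1 -sum_nat_const_nat.
by apply: leq_sum => q _; case: eqP.
Qed.

(** The invariant counts positions from [p - s] to [p - 1]; truncated subtraction makes this a
    prefix while the first window is being filled. *)
Lemma slide_progP ta base rho : low ta -> ta 47 0 = base -> ta 44 0 = rho -> rho <= Rn ->
  (forall l i, l < Lv -> i < n -> ta 29 (l * n + i) = point_label base l i) ->
  forall i, i < N -> sem slide_prog ta 31 i = window_hash base rho i.
Proof.
move=> lo b47 b44 rR Hlab.
rewrite /slide_prog sem_then.
have := @sem_for_inv 41 19 (30 @ V 41 <- Num 0) ta
   (fun k (tb : state) => forall y, y < k -> tb 30 y = 0).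
set t1 := sem _ ta; rewrite (lowE lo) Lvn_def => Z.
have {Z} Z y : y < Lv * n -> t1 30 y = 0.
  apply: Z => // i tb iL A H; have lb : low tb by apply: low_agree A lo.
  sset i 0; rewrite //; last by rdl lb; apply: ltnW cap_gt1.
  move=> j; rewrite ltnS leq_eqVlt upd_eq => /orP[/eqP->|ji]; first by rewrite eqxx.
  by rewrite ltn_eqF // upd_ne // H.
have A1 := @sem_agree _ ta : agree _ t1 ta.
have l1 : low t1 by apply: low_agree A1 lo.
sset 0 0; rewrite //; last by rewrite (lowE l1); apply: ltnW cap_gt1.
set t2 := upd t1 53 0 0.
have l2 : low t2 by apply: low_upd.
set body := Then _ _.
have := @sem_for_inv 54 6 body t2 (fun p (tb : state) =>
  [/\ forall y, y < Lv * n -> tb 30 y = count_range base (p - s) p y,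
      tb 53 0 = count_hash base rho (count_range base (p - s) p) &
      forall i, i + s <= p -> tb 31 i = window_hash base rho i]).
set t3 := sem _ t2; rewrite (lowE l2) => F.
suff [_ _ H] : [/\ forall y, y < Lv * n -> t3 30 y = count_range base (n - s) n y,
      t3 53 0 = count_hash base rho (count_range base (n - s) n) &
      forall i, i + s <= n -> t3 31 i = window_hash base rho i].
  by move=> i; rewrite N_def ltnS => iN; apply: H; rewrite -(subnK le_sn) leq_add2r.
apply: F.
  split.
  - by move=> y yL; rewrite /t2 upd_ne // Z // /count_range big_geq.
  - rewrite /t2 upd_eq /= /count_hash big1 // => y _.
    by rewrite /count_range big_geq // /count_term add0n subnn muln0.
  - by move=> i; rewrite leqn0 addn_eq0 => /andP[_ /eqP s0]; move: s_gt0; rewrite s0.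
move=> p tb pn A [H1 H2 H3]; rewrite /body sem_then.
have lb : low tb by apply: low_agree A l2.
have c47 : tb 47 0 = base by rewrite A // /t2 upd_ne // A1.
have c44 : tb 44 0 = rho by rewrite A // /t2 upd_ne // A1.
have c29 l i : l < Lv -> i < n -> tb 29 (l * n + i) = point_label base l i.
  by move=> lL iN; rewrite A // /t2 upd_ne // A1 // Hlab.
have lbn l i : point_label base l i < n by apply: last_label_lt.
set ta0 := upd tb 54 0 p.
have l0 : low ta0 by apply: low_upd.
have [] := @recount_progP 54 OpAdd ta0 base rho p (fun l => point_label base l p)
   (count_range base (p - s) p) isT l0 c47 c44 (erefl _) rR _ _ H1 H2 _.
- by move=> l lL; apply: c29.
- by move=> l.
- move=> y yL; have := count_range_le base (p - s) p y; rewrite /=; lia.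
set cntA := fun y => if _ then _ else _ => /= HA HB.
have cA y : cntA y = count_range base (p - s) p.+1 y.
  rewrite /cntA /count_range /= big_nat_recr ?leq_subr //= [point_label _ _ _ == _]eq_sym.
  by case: eqP; rewrite ?addn0.
set t4 := sem (recount_prog 54 OpAdd) ta0 in HA HB *.
have A4 := @sem_agree (recount_prog 54 OpAdd) ta0 : agree _ t4 ta0.
have l4 : low t4 by apply: low_agree A4 l0.
have extH cnt cnt' : (forall y, y < Lv * n -> cnt y = cnt' y) ->
   count_hash base rho cnt = count_hash base rho cnt'.
  by move=> H; apply: eq_bigr => y _; rewrite H.
rewrite sem_then; set t5 := sem (Cond _ _ _) t4.
have [H5 H6 A5] : [/\ forall y, y < Lv * n -> t5 30 y = count_range base (p.+1 - s) p.+1 y,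
   t5 53 0 = count_hash base rho (count_range base (p.+1 - s) p.+1)
   & agree [:: 48; 52; 53; 30; 55] t5 t4].
  rewrite /t5 sem_cond.
  have -> : heval t4 (V 7 [<=] V 54) = (s <= p) by rewrite /= (lowE l4) A4.
  case: (leqP s p) => sp /=; last first.
    rewrite sem_nop; have -> : p.+1 - s = p - s by lia.
    split=> [y yL||//]; first exact: etrans (HA y yL) (cA y).
    by rewrite HB; apply: extH => y _.
  have ps_cap : p - s < cap by apply: leq_ltn_trans (leq_subr _ _) (ltn_trans pn n_cap).
  sset 0 (p - s); rewrite //; [|by rewrite /= (lowE l4) A4|by rewrite (lowE l4)].
  set t6 := upd t4 55 0 (p - s).
  have l6 : low t6 by apply: low_upd.
  have [] := @recount_progP 55 OpSub t6 base rho (p - s)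
    (fun l => point_label base l (p - s)) (count_range base (p - s) p.+1)
    isT l6 _ _ (erefl _) rR _ _ _ _ _.
  - by rewrite /t6 upd_ne // A4.
  - by rewrite /t6 upd_ne // A4.
  - move=> l lL; rewrite /t6 upd_ne // A4 //; apply: c29 => //.
    exact: leq_ltn_trans (leq_subr _ _) pn.
  - by move=> l.
  - by move=> y yL; rewrite /t6 upd_ne //; exact: etrans (HA y yL) (cA y).
  - by rewrite /t6 upd_ne // HB; apply: extH => y _.
  - move=> y yL; have := count_range_le base (p - s) p.+1 y; rewrite /=; lia.
  set cntB := fun y => if _ then _ else _ => /= HA' HB'.
  have cB y : cntB y = count_range base (p.+1 - s) p.+1 y.
    have -> : p.+1 - s = (p - s).+1 by lia.
    rewrite /cntB /count_range /= [in LHS]big_ltn ?ltnS ?leq_subr // eq_sym.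
    by case: eqP => _; rewrite ?addn0 ?add0n // addKn.
  split=> [y yL||]; first exact: etrans (HA' y yL) (cB y).
    by rewrite HB'; apply: extH => y _.
  move=> r nr; have := @sem_agree (recount_prog 55 OpSub) t6 r; rewrite /= => ->.
    by rewrite /t6 upd_ne //; move: nr; rewrite !inE !negb_or => /and5P[].
  by move: nr; rewrite !inE !negb_or => /and5P[-> -> -> -> _].
have l5 : low t5 by apply: low_agree A5 l4.
rewrite sem_cond.
have -> : heval t5 (V 7 [<=] V 54 [+] Num 1) = (s <= p.+1).
  by rewrite /= (lowE l5) A5 // A4 // addn1.
have old i : t5 31 i = tb 31 i by rewrite A5 // A4.
case: (leqP s p.+1) => sp /=; last first.
  rewrite sem_nop; split=> // i; rewrite leq_eqVlt old => /orP[/eqP ip|]; last exact: H3.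
  by move: sp; rewrite -ip ltnNge leq_addl.
have HW : window_hash base rho (p.+1 - s) =
    count_hash base rho (count_range base (p.+1 - s) p.+1).
  apply: extH => y _; rewrite /count_range /wcount.
  rewrite -{2}[p.+1 - s]add0n big_addn subKn // big_mkord.
  by apply: eq_bigr => k _; rewrite addnC.
sset (p.+1 - s) (window_hash base rho (p.+1 - s)); rewrite //.
- split; [by move=> y yL; rewrite upd_ne // H5|by rewrite upd_ne|].
  move=> i; rewrite leq_eqVlt upd_eq => /orP[/eqP ip|ip].
    by rewrite -ip addnK eqxx.
  rewrite ltn_eqF ?old ?H3 //; lia.
- by rewrite /= (lowE l5) A5 // A4 // addn1.
- by rewrite /= H6 HW.
- rewrite (lowE l5) HW; apply: count_cap => y _.
  by apply: leq_trans (count_range_le _ _ _ _) _; lia.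
Qed.

Lemma bucket_progP ta e rho : low ta -> ta 46 0 = e -> ta 44 0 = rho -> e < E ->
  e %/ K = rho -> rho < Rn ->
  (forall i, i < N -> ta 31 i = window_hash (e * str) rho i) ->
  (forall v, ta 33 (v * E + e) = 0) ->
  let tb := sem bucket_prog ta in
  [/\ forall i, i < N -> tb 32 (e * N + i) = lasteq (class_label e) i (class_label e i) /\
        tb 34 (e * N + i) = lasteq (class_label e) N (class_label e i),
      forall j, j < e * N -> tb 32 j = ta 32 j /\ tb 34 j = ta 34 j,
      tb 35 e = class_weight e,
      forall e', e' != e -> tb 35 e' = ta 35 e' &
      forall v e', e' < E -> e' != e -> tb 33 (v * E + e') = ta 33 (v * E + e')].
Proof.
move=> lo b46 b44 eE eK rR Hw H33; set lab := class_label e.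
have N_cap : N < cap by rewrite N_def; apply: leq_ltn_trans n_cap; lia.
rewrite /bucket_prog sem_then; set t1 := sem (Cond _ _ _) ta.
have [A1 H1] : agree [:: 49; 31] t1 ta /\ forall i, i < N -> t1 31 i = lab i.
  rewrite /t1 sem_cond.
  have -> : heval ta (V 14 [<=] V 44 [+] Num 1) = (Rn <= rho.+1).
    by rewrite /= (lowE lo) b44 addn1.
  rewrite /lab /class_label eK; case: (ltnP rho.+1 Rn) => rt /=.
    by rewrite sem_nop.
  split; first exact: (@sem_agree (For 49 10 (31 @ V 49 <- Num 0)) ta).
  have := @sem_for_inv 49 10 (31 @ V 49 <- Num 0) ta
   (fun k (tb : state) => forall y, y < k -> tb 31 y = 0).
  rewrite (lowE lo); apply=> // i tb iL A H; have lb : low tb by apply: low_agree A lo.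
  sset i 0; rewrite //; last by rdl lb; apply: ltnW cap_gt1.
  move=> j; rewrite ltnS leq_eqVlt upd_eq => /orP[/eqP->|ji]; first by rewrite eqxx.
  by rewrite ltn_eqF // upd_ne // H.
have l1 : low t1 by apply: low_agree A1 lo.
have keyE u v e' : e' < E -> (u * E + e' == v * E + e) = (u == v) && (e' == e).
  move=> e'E; apply/eqP/andP => [H|[/eqP-> /eqP->]//].
  have := congr1 (fun x => x %/ E) H; have := congr1 (fun x => x %% E) H.
  by rewrite /= !modnMDl !divnMDl // !modn_small // !divn_small // !addn0 => -> ->.
rewrite sem_then.
set t2 := sem (For 49 10 (Then _ _)) t1.
have [H2 H3 H4 H5] : [/\ forall i, i < N -> t2 32 (e * N + i) = lasteq lab i (lab i),
   forall j, j < e * N -> t2 32 j = ta 32 j,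
   forall v, t2 33 (v * E + e) = lasteq lab N v &
   forall v e', e' < E -> e' != e -> t2 33 (v * E + e') = ta 33 (v * E + e')].
  have := @sem_for_inv 49 10 (32 @ (V 46 [*] V 10 [+] V 49) <-
             Get 33 (Get 31 (V 49) [*] V 16 [+] V 46) ;;
             33 @ (Get 31 (V 49) [*] V 16 [+] V 46) <- V 49 [+] Num 1) t1
   (fun k (tb : state) => [/\ forall i, i < k -> tb 32 (e * N + i) = lasteq lab i (lab i),
     forall j, j < e * N -> tb 32 j = ta 32 j,
     forall v, tb 33 (v * E + e) = lasteq lab k v &
     forall v e', e' < E -> e' != e -> tb 33 (v * E + e') = ta 33 (v * E + e')]).
  rewrite (lowE l1); apply.
    by split=> //= *; rewrite A1.
  move=> i tb iN A [I1 I2 I3 I4].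
  have lb : low tb by apply: low_agree A l1.
  have c46 : tb 46 0 = e by rewrite A // A1.
  have c31 : tb 31 i = lab i by rewrite A // H1.
  sset (e * N + i) (lasteq lab i (lab i)); rewrite //; first last.
  - by rdl lb; apply: leq_ltn_trans (lasteq_le _ _ _) (ltn_trans iN N_cap).
  - by rdl lb; rewrite c46 c31 I3.
  - by rdl lb; rewrite c46.
  sset (lab i * E + e) i.+1; rewrite //.
  - split.
    + move=> j; rewrite ltnS leq_eqVlt upd_ne // upd_eq eqn_add2l.
      case/orP=> [/eqP->|ji]; first by rewrite eqxx.
      by rewrite ltn_eqF // upd_ne // I1.
    + move=> j jN; rewrite upd_ne // upd_eq ltn_eqF; first by rewrite upd_ne // I2.
      by apply: leq_trans jN (leq_addr _ _).
    + move=> v; rewrite upd_eq keyE // eqxx andbT /= eq_sym; case: eqP => // _.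
      by rewrite upd_ne // upd_ne // I3.
    + by move=> v e' e'E ne; rewrite upd_eq keyE // (negbTE ne) andbF upd_ne // upd_ne // I4.
  - by rdl lb; rewrite c46 c31.
  - by rdl lb; rewrite addn1.
  - by rdl lb; apply: leq_ltn_trans iN N_cap.
have A2 := @sem_agree _ t1 : agree _ t2 t1.
have l2 : low t2 by apply: low_agree A2 l1.
rewrite sem_then; set t3 := sem (For 49 10 _) t2.
have [H6 H7] : (forall i, i < N -> t3 34 (e * N + i) = lasteq lab N (lab i)) /\
   (forall j, j < e * N -> t3 34 j = ta 34 j).
  have := @sem_for_inv 49 10 (34 @ (V 46 [*] V 10 [+] V 49) <-
      Get 33 (Get 31 (V 49) [*] V 16 [+] V 46)) t2
   (fun k (tb : state) =>
     (forall i, i < k -> tb 34 (e * N + i) = lasteq lab N (lab i)) /\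
     (forall j, j < e * N -> tb 34 j = ta 34 j)).
  rewrite (lowE l2); apply.
    by split=> // j _; rewrite A2 // A1.
  move=> i tb iN A [I1 I2].
  have lb : low tb by apply: low_agree A l2.
  have c46 : tb 46 0 = e by rewrite A // A2 // A1.
  have c31 : tb 31 i = lab i by rewrite A // A2 // H1.
  sset (e * N + i) (lasteq lab N (lab i)); rewrite //.
  - split.
    + move=> j; rewrite ltnS leq_eqVlt upd_eq eqn_add2l.
      case/orP=> [/eqP->|ji]; first by rewrite eqxx.
      by rewrite ltn_eqF // upd_ne // I1.
    + move=> j jN; rewrite upd_eq ltn_eqF; first by rewrite upd_ne // I2.
      by apply: leq_trans jN (leq_addr _ _).
  - by rdl lb; rewrite c46.
  - by rdl lb; rewrite c46 c31 A // H4.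
  - by rdl lb; apply: leq_ltn_trans (lasteq_le _ _ _) N_cap.
have A3 := @sem_agree _ t2 : agree _ t3 t2.
have l3 : low t3 by apply: low_agree A3 l2.
have c46 : t3 46 0 = e by rewrite A3 // A2 // A1.
have -> : sem (Cond (V 44) (35 @ V 46 <- Get 25 (V 44)) (35 @ V 46 <- Num 0)) t3 =
    upd t3 35 e (class_weight e).
  rewrite sem_cond /class_weight eK /= A3 // A2 // A1 // b44.
  case: eqP => /= [r0|r0].
    by sset e 0; rewrite // (lowE l3); apply: ltnW cap_gt1.
  sset e (2 ^ rho); rewrite //=.
    by rewrite (lowE l3) A3 // A2 // A1 // b44 powE // ltnW.
  by rewrite (lowE l3); apply: leq_ltn_trans pow_cap; rewrite leq_exp2l // ltnW.
split=> /=.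
- by move=> i iN; rewrite !upd_ne // H6 // A3 // H2.
- by move=> j jN; rewrite !upd_ne // H7 // A3 // H3.
- by rewrite upd_eq eqxx.
- by move=> e' /negbTE ne; rewrite upd_eq ne A3 // A2 // A1.
- by move=> v e' e'E ne; rewrite upd_ne // A3 // H5.
Qed.

(** The last clause keeps table 33 empty for the classes still to come, as [lasteq] requires 0 for
    labels not seen. *)
Definition hash_done (k : nat) (tb : state) :=
  [/\ forall e i, e < k -> i < N ->
        tb 32 (e * N + i) = lasteq (class_label e) i (class_label e i) /\
        tb 34 (e * N + i) = lasteq (class_label e) N (class_label e i),
      forall e, e < k -> tb 35 e = class_weight e &
      forall v e, k <= e < E -> tb 33 (v * E + e) = 0].

Lemma hash_progP ta : low ta -> (forall y, ta 33 y = 0) ->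
  hash_done E (sem hash_prog ta).
Proof.
move=> lo Z; rewrite E_def /hash_prog.
have := @sem_for_inv 44 14 (For 45 15 (
    46 <- V 44 [*] V 15 [+] V 45 ;; 47 <- V 46 [*] V 23 ;;
    For 48 12 point_prog ;; slide_prog ;; bucket_prog)) ta
   (fun rho tb => hash_done (rho * K) tb).
rewrite (lowE lo); apply; first by split.
move=> rho tb rR A D.
have lb : low tb by apply: low_agree A lo.
set tb1 := upd tb 44 0 rho.
have lb1 : low tb1 by apply: low_upd.
have D1 : hash_done (rho * K + 0) tb1 by rewrite addn0.
have := @sem_for_inv 45 15 (
    46 <- V 44 [*] V 15 [+] V 45 ;; 47 <- V 46 [*] V 23 ;;
    For 48 12 point_prog ;; slide_prog ;; bucket_prog) tb1
   (fun k tc => hash_done (rho * K + k) tc) D1.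
rewrite (lowE lb1) [rho.+1 * K]mulSnr; apply.
move=> k tc kK B [D2 D3 D4] {D D1}.
have lc : low tc by apply: low_agree B lb1.
have c44 : tc 44 0 = rho by rewrite B.
set e := rho * K + k.
have eE : e < E.
  rewrite E_def /e; apply: leq_trans (_ : rho.+1 * K <= _); first by rewrite mulSnr ltn_add2l.
  by rewrite leq_mul2r rR orbT.
have eK : e %/ K = rho by rewrite /e divnMDl ?divn_small ?addn0 // (leq_ltn_trans _ kK).
sset 0 e; rewrite //; first last.
- by rdl lc; apply: ltn_trans E_cap.
- by rdl lc; rewrite c44.
set t1 := upd (upd tc 45 0 k) 46 0 e.
have l1 : low t1 by do 2!apply: low_upd => //.
sset 0 (e * str); rewrite //; first last.
- by rewrite (lowE l1); apply: leq_ltn_trans str_cap; rewrite leq_mul2r ltnW ?orbT.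
- by rewrite /= (lowE l1).
set t2 := upd t1 47 0 (e * str).
have l2 : low t2 by apply: low_upd.
rewrite sem_then; set t3 := sem (For 48 12 point_prog) t2.
have H3 l i : l < Lv -> i < n -> t3 29 (l * n + i) = point_label (e * str) l i.
  have := @sem_for_inv 48 12 point_prog t2 (fun k (td : state) =>
    forall l i, l < k -> i < n -> td 29 (l * n + i) = point_label (e * str) l i).
  rewrite (lowE l2); apply=> // l' td lL C H.
  have ld : low (upd td 48 0 l') by apply: low_upd => //; apply: low_agree C l2.
  have [||P1 P2] := @point_progP (upd td 48 0 l') (e * str) e l' ld _ _ (erefl _) eE lL.
  - by rewrite upd_ne // C.
  - by rewrite upd_ne // C.
  move=> l'' i''; rewrite ltnS leq_eqVlt => /orP[/eqP->|ll iN]; first exact: P1.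
  rewrite P2 ?upd_ne ?H //; apply: leq_trans (_ : l''.+1 * n <= _).
    by rewrite mulSnr ltn_add2l.
  by rewrite leq_mul2r ll orbT.
have A3 := @sem_agree (For 48 12 point_prog) t2 : agree _ t3 t2.
have l3 : low t3 by apply: low_agree A3 l2.
rewrite sem_then; set t4 := sem slide_prog t3.
have A4 := @sem_agree slide_prog t3 : agree _ t4 t3.
have l4 : low t4 by apply: low_agree A4 l3.
have H4 i : i < N -> t4 31 i = window_hash (e * str) rho i.
  apply: slide_progP => //; first by rewrite A3.
    by rewrite A3.
  exact: ltnW.
have same r : r \in [:: 32; 33; 34; 35] -> t4 r = tc r.
  by rewrite !inE => /or4P[] /eqP->; rewrite A4 // A3.
have [|||F1 F2 F3 F4 F5] := @bucket_progP t4 e rho l4 _ _ eE eK rR H4.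
- by rewrite A4 // A3.
- by rewrite A4 // A3.
- by move=> v; rewrite same // D4 // leqnn.
rewrite addnS; split.
- move=> e' i; rewrite ltnS leq_eqVlt => /orP[/eqP->|ee] iN; first exact: F1.
  have [|-> ->] := F2 (e' * N + i); last by rewrite !same //; apply: D2.
  apply: leq_trans (_ : e'.+1 * N <= _); first by rewrite mulSnr ltn_add2l.
  by rewrite leq_mul2r ee orbT.
- move=> e'; rewrite ltnS leq_eqVlt => /orP[/eqP->|ee]; first exact: F3.
  by rewrite F4 ?same ?D3 // ltn_eqF.
- move=> v e' /andP[ee e'E]; rewrite F5 // ?same // ?D4 ?(ltnW ee) //.
  by rewrite gtn_eqF.
Qed.

End HashSem.

(** * The programs for Dijkstra's algorithm and the coordinates *)

Local Open Scope nat_scope.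

Lemma sem_set_out i e st iv v : heval st i = iv -> heval st e = v -> v < st 3 0 ->
  sem (Set_ 2 i e) st = upd st 2 iv v.+1.
Proof. by move=> <- <- Hv; rewrite /sem addn1 modn_small. Qed.

Lemma clear_progP r x b st : r != x -> r != 2 -> x != 3 -> r != 3 -> 0 < st 3 0 ->
  forall y, y < st b 0 -> sem (For x b (r @ V x <- Num 0)) st r y = 0.
Proof.
move=> rx r2 x3 r3 cap0.
apply: (@sem_for_inv x b (r @ V x <- Num 0) st
  (fun k (tb : state) => forall y, y < k -> tb r y = 0)) => // i tb iL A H.
have c3 : tb 3 0 = st 3 0.
  by rewrite A //= !inE !negb_or ![3 == _]eq_sym x3 r3.
sset i 0; rewrite //.
- move=> j; rewrite ltnS leq_eqVlt upd_eq => /orP[/eqP->|ji]; first by rewrite eqxx.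
  by rewrite ltn_eqF // upd_ne // H.
- by rewrite /= upd_eq.
- by rewrite upd_ne ?c3 // eq_sym.
Qed.

Definition settle_prog : prog :=
  36 @ V 52 <- V 48 ;; 37 @ V 45 <- V 52 ;; 45 <- V 45 [+] Num 1.

Definition relax_prog : prog :=
  52 <- V 47 [-] Num 1 ;; Cond (Get 36 (V 52)) Nop settle_prog ;;
  47 <- Get 32 (V 56 [*] V 10 [+] V 52).

(** Array 38 holds the pointers of the classes. Candidates are at least 1, so 0 in register 53 means
    that none was found. *)
Definition best_body : prog :=
  Cond (Get 38 (V 54) [+] Num 1 [<=] V 45)
    (55 <- Get 36 (Get 37 (Get 38 (V 54))) [+] Get 35 (V 54) ;;
     Cond (V 53 [<=] V 55)
       (Cond (V 53) Nop (53 <- V 55 ;; 56 <- V 54)) (53 <- V 55 ;; 56 <- V 54)) Nop.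

(** A bucket is marked in round [z] by the stamp [z + 1] in array 39; the sum of both truncated
    differences tests inequality. *)
Definition visit_prog : prog :=
  57 <- Get 37 (Get 38 (V 56)) ;; 38 @ V 56 <- Get 38 (V 56) [+] Num 1 ;; 48 <- V 53 ;;
  58 <- Get 34 (V 56 [*] V 10 [+] V 57) ;; 59 <- V 56 [*] V 10 [+] V 58 ;;
  Cond ((Get 39 (V 59) [-] (V 44 [+] Num 1)) [+] ((V 44 [+] Num 1) [-] Get 39 (V 59)))
    (39 @ V 59 <- V 44 [+] Num 1 ;; 47 <- V 58) Nop.

Definition pick_prog : prog :=
  53 <- Num 0 ;; For 54 16 best_body ;; Cond (V 53) visit_prog Nop.

Definition step_prog : prog := Cond (V 47) relax_prog pick_prog.

(** The condition computes a remainder: node 49 becomes a seed, with stored distance 1, when its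
    word is divisible by the power of two in register 46. *)
Definition seed_prog : prog :=
  50 <- Get 26 (V 16 [*] V 23 [+] V 44 [*] V 10 [+] V 49) ;;
  Cond (V 50 [-] (V 50 [/] V 46) [*] V 46) Nop
    (36 @ V 49 <- Num 1 ;; 37 @ V 45 <- V 49 ;; 45 <- V 45 [+] Num 1).

Definition coord_prog : prog :=
  For 49 10 (36 @ V 49 <- Num 0) ;; For 54 16 (38 @ V 54 <- Num 0) ;;
  For 51 21 (39 @ V 51 <- Num 0) ;;
  45 <- Num 0 ;; 46 <- Get 25 (V 44 [/] V 20 [+] Num 1) ;; 47 <- Num 0 ;; 48 <- Num 1 ;;
  For 49 10 seed_prog ;;
  For 51 21 step_prog ;;
  For 49 10 (2 @ (Num 1 [+] V 49 [*] V 17 [+] V 44) <- Get 36 (V 49) [*] V 22).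

Definition out_prog : prog := For 44 17 coord_prog ;; 2 @ Num 0 <- V 7.

Section OutSem.
Variable st0 : state.
Local Notation cap := (st0 3 0).
Local Notation N := (st0 10 0).
Local Notation Rn := (st0 14 0).
Local Notation E := (st0 16 0).
Local Notation t := (st0 17 0).
Local Notation RB := (st0 20 0).
Local Notation F := (st0 22 0).
Local Notation str := (st0 23 0).
Local Notation rnd := (st0 26).
Let rep e i := st0 34 (e * N + i).
Let prev e i := st0 32 (e * N + i).
Let wt e := st0 35 e.

Definition lowb (ta : state) := forall r, 2 < r <= 35 -> ta r = st0 r.

Lemma lowbE ta : lowb ta ->
  (ta 3 = st0 3) * (ta 7 = st0 7) * (ta 10 = st0 10) * (ta 16 = st0 16) *
  (ta 17 = st0 17) * (ta 20 = st0 20) * (ta 21 = st0 21) *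
  (ta 22 = st0 22) * (ta 23 = st0 23) * (ta 25 = st0 25) * (ta 26 = st0 26) *
  (ta 32 = st0 32) * (ta 34 = st0 34) * (ta 35 = st0 35).
Proof. by move=> H; do !split; apply: H. Qed.

Definition high r := (r == 2) || (35 < r).

Lemma lowb_agree rs ta tb : all high rs -> agree rs ta tb -> lowb tb -> lowb ta.
Proof.
move=> /allP H A L r rb; rewrite A ?L //; apply/negP => /H.
by case/andP: rb; rewrite /high => r2 r35; rewrite gtn_eqF //= ltnNge r35.
Qed.

Lemma lowb_upd ta r i z : high r -> lowb ta -> lowb (upd ta r i z).
Proof.
move=> hr L q qb; rewrite upd_ne ?L //; apply/eqP => qr.
by move: hr qb; rewrite qr /high => /orP[/eqP->|] //; case: (ltnP 35 r); rewrite ?andbF.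
Qed.

Variable W : nat.
Hypotheses (wtW : forall e, e < E -> wt e <= W) (W_cap : (1 + N * W) * F < cap).
Hypotheses (F_gt0 : 0 < F) (N_gt0 : 0 < N) (N_cap : N < cap) (t_cap : t < cap).
Hypotheses (E_cap : E < cap) (EN_cap : E * N < cap) (s_cap : st0 7 0 < cap).
Hypotheses (repP : bucket_rep N E rep) (prevP : bucket_prev N E rep prev).
Hypothesis steps_def : st0 21 0 = 2 * (E * N).
Hypothesis powE : forall j, j <= Rn -> st0 25 j = 2 ^ j.
Hypotheses (pow_cap : 2 ^ Rn < cap) (dens_le : forall z, z < t -> z %/ RB < Rn).
Hypothesis rnd_cap : forall k, rnd k < cap.
Hypothesis connected : exists2 e0, e0 < E &
  forall i j, i < N -> j < N -> rep e0 i = rep e0 j.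

Lemma capW : 1 + N * W < cap.
Proof. by apply: leq_ltn_trans W_cap; rewrite leq_pmulr. Qed.

Definition view z (ta : state) := DState (ta 36) (ta 37) (ta 45 0) (ta 38)
  (fun e r => ta 39 (e * N + r) == z.+1) (ta 47 0) (ta 56 0) (ta 48 0).

Definition seeds z : {set 'I_N} :=
  [set i : 'I_N | rnd (E * str + z * N + i) %% 2 ^ (z %/ RB).+1 == 0].

Ltac rdb lo := rewrite /= /upd /= ?(lowbE lo).

Lemma cand_le z (S : {set 'I_N}) ta e : dinv E rep wt S W (view z ta) -> e < E ->
  ta 38 e < ta 45 0 ->
  0 < ta 36 (ta 37 (ta 38 e)) + wt e <= 1 + N * W.
Proof.
move=> I eE pe; have [oN d0] := iv_ord I pe.
rewrite addn_gt0 d0 /=; apply: leq_trans (leq_add (iv_bd I pe) (wtW eE)) _.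
rewrite -addnA leq_add2l -mulSnr leq_mul2r; apply/orP; right.
exact: leq_trans pe (iv_cn I).
Qed.

Lemma pick_best z (S : {set 'I_N}) ta : lowb ta -> dinv E rep wt S W (view z ta) ->
  let tb := sem (For 54 16 best_body) (upd ta 53 0 0) in
  (tb 53 0 = 0 /\ tb 56 0 = ta 56 0 /\ forall e, e < E -> ta 45 0 <= ta 38 e) \/
  [/\ 0 < tb 53 0, tb 56 0 < E, ta 38 (tb 56 0) < ta 45 0,
      tb 53 0 = cand wt (view z ta) (tb 56 0) &
      forall e, e < E -> ta 38 e < ta 45 0 ->
        cand wt (view z ta) (tb 56 0) <= cand wt (view z ta) e].
Proof.
move=> lo I; set t1 := upd ta 53 0 0.
have l1 : lowb t1 by apply: lowb_upd.
have := @sem_for_inv 54 16 best_body t1 (fun k (tb : state) =>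
  (tb 53 0 = 0 /\ tb 56 0 = ta 56 0 /\ forall e, e < k -> ta 45 0 <= ta 38 e) \/
  [/\ 0 < tb 53 0, tb 56 0 < k, ta 38 (tb 56 0) < ta 45 0,
      tb 53 0 = cand wt (view z ta) (tb 56 0) &
      forall e, e < k -> ta 38 e < ta 45 0 ->
        cand wt (view z ta) (tb 56 0) <= cand wt (view z ta) e]).
rewrite (lowbE l1); apply; first by left.
move=> e tb eE A H.
have lb : lowb tb by apply: lowb_agree A l1.
have [c45 c38] : tb 45 = ta 45 /\ tb 38 = ta 38 by rewrite !A.
have [c36 c37] : tb 36 = ta 36 /\ tb 37 = ta 37 by rewrite !A.
set te := upd tb 54 0 e.
have le_ : lowb te by apply: lowb_upd.
rewrite /best_body sem_cond.
have -> : heval te (Get 38 (V 54) [+] Num 1 [<=] V 45) = (ta 38 e < ta 45 0).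
  by rewrite /te; rdb lb; rewrite c38 c45 addn1.
case: (ltnP (ta 38 e) (ta 45 0)) => pe /=; last first.
  rewrite sem_nop /te /upd /=; case: H => [[h1 [h2 h3]]|[h1 h2 h3 h4 h5]].
    by left; do 2!split=> //; move=> e'; rewrite ltnS leq_eqVlt => /orP[/eqP->|/h3].
  right; split=> //; first exact: ltnW.
  move=> e'; rewrite ltnS leq_eqVlt => /orP[/eqP->|/h5//].
  by rewrite ltnNge pe.
have cl := cand_le I eE pe; have [c0 cW] := andP cl.
set c := ta 36 (ta 37 (ta 38 e)) + wt e in c0 cW.
sset 0 c; rewrite //; first last.
- by rewrite (lowbE le_); apply: leq_ltn_trans cW capW.
- by rewrite /te; rdb lb; rewrite c36 c37 c38.
set t2 := upd te 55 0 c.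
have l2 : lowb t2 by apply: lowb_upd.
have new : (tb 53 0 = 0 \/ c < tb 53 0) ->
  (tb 53 0 = 0 -> forall e', e' < e -> ta 45 0 <= ta 38 e') ->
  let tc := sem (53 <- V 55 ;; 56 <- V 54) t2 in
  (tc 53 0 = 0 /\ tc 56 0 = ta 56 0 /\ forall e', e' < e.+1 -> ta 45 0 <= ta 38 e') \/
  [/\ 0 < tc 53 0, tc 56 0 < e.+1, ta 38 (tc 56 0) < ta 45 0,
      tc 53 0 = cand wt (view z ta) (tc 56 0) &
      forall e', e' < e.+1 -> ta 38 e' < ta 45 0 ->
        cand wt (view z ta) (tc 56 0) <= cand wt (view z ta) e'].
  move=> h hz; sset 0 c; rewrite //; last by rewrite (lowbE l2); apply: leq_ltn_trans cW capW.
  sset 0 e; rewrite //; last by rdb l2; apply: ltn_trans E_cap.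
  right; rewrite /upd /=; split=> //.
  move=> e'; rewrite ltnS leq_eqVlt => /orP[/eqP->//|ee pe'].
  case: H => [[h1 [h2 h3]]|[h1 h2 h3 h4 h5]].
    by move: (h3 _ ee); rewrite leqNgt pe'.
  case: h => [h|h]; first by move: h1; rewrite h.
  by apply: leq_trans (ltnW h) _; rewrite h4 h5.
rewrite sem_cond.
have -> : heval t2 (V 53 [<=] V 55) = (tb 53 0 <= c) by [].
case: (leqP (tb 53 0) c) => hc /=; last first.
  apply: new; first by right.
  by move=> h; move: hc; rewrite h.
rewrite sem_cond; have -> : heval t2 (V 53) = tb 53 0 by [].
case: eqP => /= hz.
  apply: new; first by left.
  by move=> _; case: H => [[_ [_ h]] //|[h]]; rewrite hz in h.
rewrite sem_nop /t2 /te /upd /=; case: H => [[h1] //|[h1 h2 h3 h4 h5]].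
right; split=> //; first exact: ltnW.
move=> e'; rewrite ltnS leq_eqVlt => /orP[/eqP->|/h5//] _.
by rewrite -h4.
Qed.

(** The bounds carried by [dinv] keep each value below [cap], so no assignment is distorted by the
    reduction. *)
Lemma step_progP z (S : {set 'I_N}) ta : lowb ta -> ta 44 0 = z -> z < t ->
  dinv E rep wt S W (view z ta) ->
  dstep N E rep prev wt (view z ta) (view z (sem step_prog ta)).
Proof.
move=> lo b44 zt I; rewrite /step_prog sem_cond.
have -> : heval ta (V 47) = ta 47 0 by [].
case: eqP => /= cur0; last first.
  have [|cN ceE _] := iv_cur I; first by rewrite lt0n; apply/eqP.
  rewrite /= in cN ceE.
  pose i := (ta 47 0).-1; have ciE : ta 47 0 = i.+1 by rewrite /i prednK // lt0n; apply/eqP.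
  have iN : i < N by rewrite ciE in cN.
  rewrite /relax_prog; sset 0 i; rewrite //; first last.
  - by rewrite (lowbE lo); apply: ltn_trans N_cap.
  - by rewrite /= ciE subn1.
  set t1 := upd ta 52 0 i.
  have l1 : lowb t1 by apply: lowb_upd.
  have prevN : prev (ta 56 0) i < cap.
    by have [pl _ _] := prevP ceE iN; apply: leq_ltn_trans pl (ltn_trans iN N_cap).
  rewrite sem_then sem_cond; have -> : heval t1 (Get 36 (V 52)) = ta 36 i by [].
  case: eqP => /= di.
    have cdE := iv_cdb I; rewrite /= in cdE.
    have cdc : ta 48 0 < cap.
      apply: leq_ltn_trans cdE _; apply: leq_ltn_trans capW.
      by rewrite leq_add2l leq_mul2r (iv_cn I) orbT.
    have cnN : ta 45 0 < N.
      rewrite ltn_neqAle (iv_cn I) andbT; apply/eqP => cE.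
      pose o (p : 'I_N) : 'I_N := insubd p (ta 37 p).
      have pc (p : 'I_N) : p < cn (view z ta) by rewrite /= cE.
      have oE p : val (o p) = ta 37 p.
        by rewrite val_insubd; case: (iv_ord I (pc p)) => /= ->.
      have oinj : injective o.
        move=> p q /(congr1 val); rewrite !oE => H; apply/val_inj.
        exact: (iv_inj I (pc p) (pc q)) H.
      have [o' _ oK] := injF_bij oinj.
      have := oE (o' (Ordinal iN)); rewrite oK /= => pE.
      by case: (iv_ord I (pc (o' (Ordinal iN)))) => /= _; rewrite -pE di.
    rewrite /settle_prog; sset i (ta 48 0); rewrite //; last by rewrite (lowbE l1).
    set t2 := upd t1 36 i (ta 48 0).
    have l2 : lowb t2 by apply: lowb_upd.
    sset (ta 45 0) i; rewrite //; last by rewrite (lowbE l2); apply: ltn_trans N_cap.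
    set t3 := upd t2 37 (ta 45 0) i.
    have l3 : lowb t3 by apply: lowb_upd.
    rewrite [X in sem _ X](@sem_set _ _ _ _ 0 (ta 45 0).+1); rewrite //; first last.
    - by rewrite (lowbE l3); apply: leq_ltn_trans cnN N_cap.
    - by rewrite /= /t3 /t2 /t1 /upd /= addn1.
    set t4 := upd t3 45 0 _.
    have l4 : lowb t4 by apply: lowb_upd.
    sset 0 (prev (ta 56 0) i); rewrite //; first last.
    - by rewrite (lowbE l4).
    - by rewrite /= !(lowbE l4).
    by apply: (@DSettle _ _ _ _ _ _ _ i).
  rewrite sem_nop; sset 0 (prev (ta 56 0) i); rewrite //; first last.
  - by rewrite (lowbE l1).
  - by rewrite /= !(lowbE l1).
  by apply: (@DSkip _ _ _ _ _ _ _ i) => //; apply/eqP.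
rewrite /pick_prog; sset 0 0; rewrite //; last first.
  by rewrite (lowbE lo); apply: leq_ltn_trans N_cap.
rewrite sem_then.
have := pick_best lo I; set tb := sem (For 54 16 _) _ => /= H.
have A := @sem_agree (For 54 16 best_body) (upd ta 53 0 0) : agree _ tb _.
have lb : lowb tb by apply: lowb_agree A _ => //; apply: lowb_upd.
rewrite sem_cond; have -> : heval tb (V 53) = tb 53 0 by [].
case: H => [[b0 [ce0 noc]]|[b0 ceE pe bE emin]].
  rewrite b0 /= sem_nop.
  apply: DDone => //=; try (by move=> *; rewrite A); by rewrite A.
rewrite -[tb 53 0 != 0]lt0n b0.
set e := tb 56 0 in ceE pe bE emin.
set j := ta 37 (ta 38 e).
have [jN dj] := iv_ord I pe; rewrite /= -/j in jN dj.
have [r0 rr jr] := repP ceE jN.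
have keyN : e * N + rep e j <= E * N.
  apply: leq_trans (_ : e.+1 * N <= _); last by rewrite leq_mul2r ceE orbT.
  by rewrite mulSnr leq_add2l; case/andP: r0.
have [c37 c38] : tb 37 = ta 37 /\ tb 38 = ta 38 by rewrite !A.
have c39 : tb 39 = ta 39 by rewrite A.
have c44 : tb 44 0 = z by rewrite A.
rewrite /visit_prog; sset 0 j; rewrite //; first last.
- by rewrite (lowbE lb); apply: ltn_trans N_cap.
- by rewrite /= c37 c38.
set t1 := upd tb 57 0 j.
have l1 : lowb t1 by apply: lowb_upd.
sset e (ta 38 e).+1; rewrite //; first last.
- by rewrite (lowbE l1); apply: leq_ltn_trans pe (leq_ltn_trans (iv_cn I) N_cap).
- by rewrite /= /t1 /upd /= c38 addn1.
set t2 := upd t1 38 e _.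
have l2 : lowb t2 by apply: lowb_upd.
sset 0 (tb 53 0); rewrite //; last first.
  by rewrite (lowbE l2) bE; case/andP: (cand_le I ceE pe) => _ h; apply: leq_ltn_trans h capW.
set t3 := upd t2 48 0 _.
have l3 : lowb t3 by apply: lowb_upd.
sset 0 (rep e j); rewrite //; first last.
- by rewrite (lowbE l3); case/andP: r0 => _ h; apply: leq_ltn_trans h N_cap.
- by rewrite /= !(lowbE l3).
set t4 := upd t3 58 0 _.
have l4 : lowb t4 by apply: lowb_upd.
sset 0 (e * N + rep e j); rewrite //; first last.
- by rewrite (lowbE l4); apply: leq_ltn_trans EN_cap.
- by rewrite /= !(lowbE l4).
set t5 := upd t4 59 0 _.
have l5 : lowb t5 by apply: lowb_upd.
(* Bucket names run from 1 to [N], so after a shift by one [e * N + r] is a mixed-radix code. *)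
have kE e' r : e' < E -> 0 < r <= N ->
   (e' * N + r == e * N + rep e j) = (e' == e) && (r == rep e j).
  move=> e'E /andP[r1 rN]; apply/eqP/andP => [H|[/eqP-> /eqP->]//].
  have H' : e' * N + r.-1 = e * N + (rep e j).-1.
    by case/andP: r0; case: (r) r1 H => // r'; case: (rep e j) => // r'' _; rewrite !addnS => -[].
  have l' : r.-1 < N by rewrite prednK.
  have l'' : (rep e j).-1 < N by case/andP: r0 => h1 h2; rewrite prednK.
  have ee := congr1 (fun x => x %/ N) H'.
  rewrite /= !divnMDl // !divn_small // !addn0 in ee.
  by split; [rewrite ee|move: H; rewrite ee => /addnI->].
rewrite sem_cond.
have -> : heval t5 ((Get 39 (V 59) [-] (V 44 [+] Num 1)) [+] ((V 44 [+] Num 1) [-] Get 39 (V 59)))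
   = ndist (ta 39 (e * N + rep e j)) z.+1.
  by rewrite /= /t5 /t4 /t3 /t2 /t1 /upd /= c39 c44 addn1.
have -> : (ndist (ta 39 (e * N + rep e j)) z.+1 != 0) = (ta 39 (e * N + rep e j) != z.+1).
  by rewrite /ndist; lia.
have ddE k : ta 36 k = tb 36 k by rewrite A.
case: eqP => /= vE.
  rewrite sem_nop; apply: (@DPick _ _ _ _ _ _ _ e) => //=.
  - by rewrite /t5 /t4 /t3 /t2 /t1 /upd /= A.
  - by rewrite /t5 /t4 /t3 /t2 /t1 /upd /= A.
  - by move=> k; rewrite /t5 /t4 /t3 /t2 /t1 /upd /= c38.
  - move=> e' r e'E rN; rewrite -/j /t5 /t4 /t3 /t2 /t1 /upd /= c39.
    case: (_ == z.+1) / eqP => //= ne; apply/esym/negbTE; rewrite -kE //.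
    by apply/eqP => h; apply: ne; rewrite h.
  - by rewrite -/j vE eqxx /t5 /t4 /t3 /t2 /t1 /upd /= A.
sset (e * N + rep e j) z.+1; rewrite //; first last.
- by rewrite (lowbE l5); apply: leq_ltn_trans zt t_cap.
- by rewrite /= /t5 /t4 /t3 /t2 /t1 /upd /= c44 addn1.
set t6 := upd t5 39 _ _.
have l6 : lowb t6 by apply: lowb_upd.
sset 0 (rep e j); rewrite //; last first.
  by rewrite (lowbE l6); case/andP: r0 => _ h; apply: leq_ltn_trans h N_cap.
apply: (@DPick _ _ _ _ _ _ _ e) => //=.
- by rewrite /t6 /t5 /t4 /t3 /t2 /t1 /upd /= A.
- by rewrite /t6 /t5 /t4 /t3 /t2 /t1 /upd /= A.
- by move=> k; rewrite /t6 /t5 /t4 /t3 /t2 /t1 /upd /= c38.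
- move=> e' r e'E rN; rewrite -/j /t6 /t5 /t4 /t3 /t2 /t1 /upd /= c39 kE //.
  by case: (_ && _); rewrite ?eqxx ?orbT ?orbF.
- by rewrite -/j; case: eqP vE.
Qed.

(** Without seeds no node is settled and the coordinate is 0 everywhere. Otherwise all stored
    distances are too large by one, which differences do not see. *)
Definition coord_spec z (D : nat -> nat) :=
  (seeds z != set0 -> greatest_lip E rep wt (seeds z) (fun i => (D i).-1) /\
     forall i, i < N -> 0 < D i) /\
  (seeds z = set0 -> forall i, i < N -> D i = 0).

Lemma coord_progP z ta : lowb ta -> ta 44 0 = z -> z < t ->
  exists D, [/\ coord_spec z D,
    forall i, i < N -> sem coord_prog ta 2 (1 + i * t + z) = (D i * F).+1 &
    forall j, (forall i, i < N -> j != 1 + i * t + z) -> sem coord_prog ta 2 j = ta 2 j].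
Proof.
move=> lo b44 zt.
have cap0 : 0 < cap by apply: leq_ltn_trans N_cap.
rewrite /coord_prog sem_then.
have Z1 := @clear_progP 36 49 10 ta isT isT isT isT.
set t1 := sem _ ta in Z1 *; rewrite !(lowbE lo) in Z1; have {}Z1 := Z1 cap0.
have A1 := @sem_agree _ ta : agree _ t1 ta.
have l1 : lowb t1 by apply: lowb_agree A1 lo.
rewrite sem_then.
have Z2 := @clear_progP 38 54 16 t1 isT isT isT isT.
set t2 := sem _ t1 in Z2 *; rewrite !(lowbE l1) in Z2; have {}Z2 := Z2 cap0.
have A2 := @sem_agree _ t1 : agree _ t2 t1.
have l2 : lowb t2 by apply: lowb_agree A2 l1.
rewrite sem_then.
have Z3 := @clear_progP 39 51 21 t2 isT isT isT isT.
set t3 := sem _ t2 in Z3 *; rewrite !(lowbE l2) steps_def in Z3; have {}Z3 := Z3 cap0.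
have A3 := @sem_agree _ t2 : agree _ t3 t2.
have l3 : lowb t3 by apply: lowb_agree A3 l2.
have c44 : t3 44 0 = z by rewrite A3 // A2 // A1.
have zR : z %/ RB < Rn by apply: dens_le.
sset 0 0; rewrite //; last by rewrite (lowbE l3).
set t4 := upd t3 45 0 0; have l4 : lowb t4 by apply: lowb_upd.
sset 0 (2 ^ (z %/ RB).+1); rewrite //; first last.
- by rewrite (lowbE l4); apply: leq_ltn_trans pow_cap; rewrite leq_exp2l.
- by rewrite /= !(lowbE l4) /t4 upd_ne // c44 addn1 powE.
set t5 := upd t4 46 0 _; have l5 : lowb t5 by apply: lowb_upd.
sset 0 0; rewrite //; last by rewrite (lowbE l5).
set t6 := upd t5 47 0 0; have l6 : lowb t6 by apply: lowb_upd.
sset 0 1; rewrite //; last by rewrite (lowbE l6); apply: leq_ltn_trans N_cap.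
set t7 := upd t6 48 0 1; have l7 : lowb t7 by apply: lowb_upd.
pose inS i := rnd (E * str + z * N + i) %% 2 ^ (z %/ RB).+1 == 0.
rewrite sem_then; set t8 := sem (For 49 10 seed_prog) t7.
have A8 := @sem_agree (For 49 10 seed_prog) t7 : agree _ t8 t7.
have l8 : lowb t8 by apply: lowb_agree A8 l7.
have [S1 S2 S3 S4 S5] : [/\ t8 45 0 <= N,
   forall p, p < t8 45 0 -> t8 37 p < N /\ t8 36 (t8 37 p) = 1,
   forall p q, p < q -> q < t8 45 0 -> t8 37 p < t8 37 q,
   forall i, i < N -> inS i -> exists2 p, p < t8 45 0 & t8 37 p = i &
   forall i, i < N -> t8 36 i = inS i].
  have := @sem_for_inv 49 10 seed_prog t7 (fun k (tb : state) => [/\ tb 45 0 <= k,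
   forall p, p < tb 45 0 -> tb 37 p < k /\ tb 36 (tb 37 p) = 1,
   forall p q, p < q -> q < tb 45 0 -> tb 37 p < tb 37 q,
   forall i, i < k -> inS i -> exists2 p, p < tb 45 0 & tb 37 p = i &
   forall i, i < N -> tb 36 i = (i < k) && inS i]).
  rewrite -/t8 (lowbE l7) => H.
  suff [h1 h2 h3 h4 h5] : [/\ t8 45 0 <= N,
   forall p, p < t8 45 0 -> t8 37 p < N /\ t8 36 (t8 37 p) = 1,
   forall p q, p < q -> q < t8 45 0 -> t8 37 p < t8 37 q,
   forall i, i < N -> inS i -> exists2 p, p < t8 45 0 & t8 37 p = i &
   forall i, i < N -> t8 36 i = (i < N) && inS i].
    by split=> // i iN; rewrite h5 // iN.
  apply: H.
    split=> // i iN; rewrite /t7 /t6 /t5 /t4 /upd /= A3 // A2 // Z1 //.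
  move=> i tb iN A [I1 I2 I3 I4 I5].
  have lb : lowb tb by apply: lowb_agree A l7.
  have d44 : tb 44 0 = z by rewrite A.
  have d46 : tb 46 0 = 2 ^ (z %/ RB).+1 by rewrite A.
  rewrite /seed_prog sem_then.
  set u := rnd (E * str + z * N + i).
  have uc : u < cap by apply: rnd_cap.
  rewrite (@sem_set _ _ _ _ 0 u) //; first last.
  - by rdb lb.
  - by rdb lb; rewrite d44.
  set ta1 := upd (upd tb 49 0 i) 50 0 u.
  have la1 : lowb ta1 by do 2!apply: lowb_upd => //.
  rewrite sem_cond.
  have -> : heval ta1 (V 50 [-] (V 50 [/] V 46) [*] V 46) = u %% 2 ^ (z %/ RB).+1.
    rewrite /= /ta1 /upd /= d46.
    by rewrite {1}(divn_eq u (2 ^ (z %/ RB).+1)) addKn.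
  rewrite -[X in if ~~ X then _ else _]/(inS i).
  case: (boolP (inS i)) => iS /=; last first.
    rewrite sem_nop /ta1 /upd /=; split=> //.
    - exact: leqW.
    - by move=> p pc; have [h1 h2] := I2 p pc; split=> //; apply: ltnW.
    - move=> k; rewrite ltnS leq_eqVlt => /orP[/eqP->|]; last exact: I4.
      by move=> kS; rewrite kS in iS.
    - move=> k kN; rewrite I5 // ltnS [k <= i]leq_eqVlt.
      by case: eqP => [->|//]; rewrite ltnn (negbTE iS).
  sset i 1; rewrite //; last by rewrite (lowbE la1); apply: leq_ltn_trans N_cap.
  set ta2 := upd ta1 36 i 1; have la2 : lowb ta2 by apply: lowb_upd.
  sset (tb 45 0) i; rewrite //; last by rewrite (lowbE la2); apply: ltn_trans N_cap.
  set ta3 := upd ta2 37 (tb 45 0) i; have la3 : lowb ta3 by apply: lowb_upd.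
  sset 0 (tb 45 0).+1; rewrite //; first last.
  - by rewrite (lowbE la3); apply: leq_ltn_trans N_cap; apply: leq_ltn_trans I1 iN.
  - by rewrite /= /ta3 /ta2 /ta1 /upd /= addn1.
  rewrite /ta3 /ta2 /ta1 /upd /=; split=> //.
  - move=> p; rewrite ltnS leq_eqVlt => /orP[/eqP->|pc]; first by rewrite !eqxx.
    rewrite (ltn_eqF pc); have [h1 h2] := I2 p pc.
    by rewrite (ltn_eqF h1) h2; split=> //; apply: ltnW.
  - move=> p q pq; rewrite ltnS leq_eqVlt => /orP[/eqP qE|qc].
      by rewrite qE eqxx ltn_eqF; [have [] := I2 p; rewrite -?qE|rewrite -qE].
    by rewrite !ltn_eqF ?(ltn_trans pq) //; apply: I3.
  - move=> k; rewrite ltnS leq_eqVlt => /orP[/eqP->|ki] kS.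
      by exists (tb 45 0); rewrite ?eqxx.
    have [p pc pk] := I4 k ki kS; exists p; first exact: ltnW.
    by rewrite ltn_eqF.
  - move=> k kN; rewrite I5 // ltnS [k <= i]leq_eqVlt; case: eqP => [->|//].
    by rewrite iS.
have inSE (i : 'I_N) : (i \in seeds z) = inS i by rewrite inE.
have I0 : dinv E rep wt (seeds z) W (view z t8).
  have c38 e : e < E -> t8 38 e = 0.
    by move=> eE; rewrite A8 // /t7 /t6 /t5 /t4 /upd /= A3 // Z2.
  have c47 : t8 47 0 = 0 by rewrite A8.
  have c48 : t8 48 0 = 1 by rewrite A8.
  split=> //=.
  - by move=> p pc; have [h1 ->] := S2 p pc.
  - move=> p q pc qc h; have := @S3 p q; have := @S3 q p; rewrite h ltnn.
    by move=> h1 h2; case: (ltngtP p q) => // pq; [have := h2 pq qc|have := h1 pq pc].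
  - by move=> i iN; rewrite S5 //; case: (boolP (inS i)) => // iS _; apply: S4.
  - by rewrite c48.
  - by move=> p pc; have [_ ->] := S2 p pc; rewrite c48.
  - by move=> p q pq qc; have [_ ->] := S2 q qc; have [_ ->] := S2 p (leq_ltn_trans pq qc).
  - by move=> e eE; rewrite c38.
  - move=> e eE; rewrite /cand /= c38 // c48 => h.
    by have [_ ->] := S2 0 h.
  - by move=> e p i eE; rewrite c38.
  - move=> g gl gS i iN; rewrite S5 //; case: (boolP (inS i)) => // iS _.
    by have /= -> := gS (Ordinal iN); rewrite // inSE.
  - by rewrite c47.
  - move=> e i eE iN; rewrite A8 // /t7 /t6 /t5 /t4 /upd /= Z3 //.
    have [/andP[_ rN] _ _] := repP eE iN.
    apply: leq_ltn_trans (_ : E * N < _).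
      apply: leq_trans (_ : e.+1 * N <= _); last by rewrite leq_mul2r eE orbT.
      by rewrite mulSnr leq_add2l.
    by rewrite mul2n -addnn -{1}[E * N]addn0 ltn_add2l muln_gt0 N_gt0 (leq_ltn_trans _ eE).
  - by move=> i; rewrite inSE S5 // => ->.
  - by move=> p pc; have [_ ->] := S2 p pc.
  - by rewrite c48.
rewrite sem_then; set t9 := sem (For 51 21 step_prog) t8.
pose T k := iteri k (fun i st' => sem step_prog (upd st' 51 0 i)) t8.
have TP k : [/\ lowb (T k), T k 44 0 = z & dinv E rep wt (seeds z) W (view z (T k))].
  elim: k => [|k [h1 h2 h3]]; first by split=> //; rewrite /T /= A8.
  have l' : lowb (upd (T k) 51 0 k) by apply: lowb_upd.
  have A' := @sem_agree step_prog (upd (T k) 51 0 k).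
  split; [exact: (lowb_agree _ A')|by rewrite [T _]/= A'|].
  exact: (dstep_inv repP prevP wtW h3 (step_progP l' h2 zt h3)).
have St k : dstep N E rep prev wt (view z (T k)) (view z (T k.+1)).
  have [h1 h2 h3] := TP k.
  by apply: (@step_progP z (seeds z) (upd (T k) 51 0 k)) => //; apply: lowb_upd.
have t9E : t9 = T (2 * (E * N)) by rewrite /t9 /sem -/sem (lowbE l8) steps_def.
have [I9 F9] := @dsteps_finish _ _ _ _ _ repP prevP (seeds z) W wtW
   (fun k => view z (T k)) I0 St.
rewrite -t9E in I9 F9.
have {}F9 : finished E (view z t9) by apply: F9; rewrite /T /= A8.
have l9 : lowb t9 by rewrite t9E; case: (TP (2 * (E * N))).
have z9 : t9 44 0 = z by rewrite t9E; case: (TP (2 * (E * N))).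
have bD i : i < N -> t9 36 i * F < cap.
  move=> iN; apply: leq_ltn_trans W_cap; rewrite leq_mul2r; apply/orP; right.
  have [->//|d0] := posnP (t9 36 i).
  have [p pc <-] := iv_onto I9 iN d0; apply: leq_trans (iv_bd I9 pc) _.
  rewrite leq_add2l leq_mul2r; apply/orP; right.
  exact: leq_trans (ltnW pc) (iv_cn I9).
exists (t9 36); split.
- split=> [/set0Pn[x xS]|S0].
    have c0 : 0 < cn (view z t9).
      have d1 := iv_S I9 xS.
      have [|p pc _] := iv_onto I9 (ltn_ord x); first by rewrite d1.
      exact: leq_ltn_trans pc.
    have [e0 e0E e0_one] := connected.
    exact: (finished_greatest I9 F9 c0 e0E e0_one).
  (* With no seeds every constant is an admissible potential, and the one equal to the stored value
     contradicts [iv_dom]. *)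
  move=> i iN; apply/eqP; rewrite -leqn0 leqNgt; apply/negP => d0.
  have := @iv_dom _ _ _ _ _ _ _ I9 (fun=> t9 36 i) _ _ i iN d0; rewrite ltnn.
  move=> h; have : false by apply: h => [e j k *|j]; rewrite ?leq_addr // S0 inE.
  by [].
- have := @sem_for_inv 49 10 (2 @ (Num 1 [+] V 49 [*] V 17 [+] V 44) <-
      Get 36 (V 49) [*] V 22) t9 (fun k (tb : state) => forall i, i < k ->
      tb 2 (1 + i * t + z) = (t9 36 i * F).+1).
  rewrite (lowbE l9); apply=> // i tb iN A H.
  have lb : lowb tb by apply: lowb_agree A l9.
  have d44 : tb 44 0 = z by rewrite A.
  rewrite (@sem_set_out _ _ _ (1 + i * t + z) (t9 36 i * F)); first last.
  + by rdb lb; apply: bD.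
  + by rdb lb; rewrite A.
  + by rdb lb; rewrite d44.
  move=> j; rewrite ltnS leq_eqVlt upd_eq => /orP[/eqP->|ji]; first by rewrite eqxx.
  rewrite ifN ?upd_ne ?H // eqn_add2r eqn_add2l eqn_pmul2r ?(leq_ltn_trans _ zt) //.
  by rewrite ltn_eqF.
move=> j nj.
have -> : ta 2 j = t9 2 j.
  have := @sem_agree (For 51 21 step_prog) t8 2 isT; rewrite -/t9 => ->.
  by rewrite A8 // /t7 /t6 /t5 /t4 /upd /= A3 // A2 // A1.
apply: (@sem_for_inv 49 10 (2 @ (Num 1 [+] V 49 [*] V 17 [+] V 44) <-
      Get 36 (V 49) [*] V 22) t9 (fun k (tb : state) => tb 2 j = t9 2 j)) => //.
rewrite (lowbE l9) => i tb iN A H.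
have lb : lowb tb by apply: lowb_agree A l9.
have d44 : tb 44 0 = z by rewrite A.
rewrite (@sem_set_out _ _ _ (1 + i * t + z) (t9 36 i * F)); first last.
+ by rdb lb; apply: bD.
+ by rdb lb; rewrite A.
+ by rdb lb; rewrite d44.
by rewrite upd_eq (negbTE (nj i iN)) upd_ne.
Qed.

Lemma out_progP ta : lowb ta ->
  exists D, [/\ forall z, z < t -> coord_spec z (D z),
    forall z i, z < t -> i < N ->
      sem out_prog ta 2 (1 + i * t + z) = (D z i * F).+1 &
    sem out_prog ta 2 0 = (st0 7 0).+1].
Proof.
move=> lo; rewrite /out_prog sem_then; set tb := sem (For 44 17 _) ta.
have Ab := @sem_agree (For 44 17 coord_prog) ta : agree _ tb ta.
have lb : lowb tb by apply: lowb_agree Ab lo.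
rewrite (@sem_set_out _ _ _ 0 (st0 7 0)) //; first last.
- by rewrite (lowbE lb).
- by rewrite /= (lowbE lb).
have := @sem_for_inv 44 17 coord_prog ta (fun k (tc : state) =>
  exists D, forall z, z < k -> coord_spec z (D z) /\ forall i, i < N ->
      tc 2 (1 + i * t + z) = (D z i * F).+1).
rewrite -/tb (lowbE lo) => H.
have [|z tc zt A [D HD]|D HD] := H; first by exists (fun _ _ => 0).
  have lc : lowb (upd tc 44 0 z) by apply: lowb_upd => //; apply: lowb_agree A lo.
  have [D' [h1 h2 h3]] := coord_progP lc (erefl (upd tc 44 0 z 44 0)) zt.
  exists (fun z' => if z' == z then D' else D z') => z'.
  rewrite ltnS leq_eqVlt; case: eqP => [-> _|_ /= zz]; first by split.
  have [g1 g2] := HD z' zz; split=> // i iN.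
  rewrite h3; first by rewrite [LHS]g2.
  move=> i' i'N; apply/eqP => /(congr1 (fun x => x.-1 %% t)).
  by rewrite /= !add0n !modnMDl !modn_small ?(ltn_trans zz) // => E1; rewrite E1 ltnn in zz.
exists D; split.
- by move=> z /HD[].
- by move=> z i /HD[_ h] iN; rewrite upd_eq /= h.
- by rewrite upd_eq.
Qed.

End OutSem.

(** * The whole program *)

Local Open Scope nat_scope.

Lemma sem_set_raw r i e st : sem (Set_ r i e) st =
  upd st r (heval st i) (heval st e %% st 3 0 + (r == 2)).
Proof. by []. Qed.

Lemma rand_prog_out st k : st 18 0 <= k -> sem rand_prog st 26 k = st 26 k.
Proof.
move=> kE; rewrite /rand_prog; set body := Then _ _.
apply: (@sem_for_inv 41 18 body _ (fun _ (tb : state) => tb 26 k = st 26 k)) => //.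
move=> i tb iE A H; rewrite /body !sem_then; set tc := sem (For _ _ _) _.
have Ac : agree [:: 42; 0; 43; 40] tc (upd tb 41 0 i).
  move=> r h; rewrite /tc sem_agree // sem_agree //.
  by move: h; rewrite !inE !negb_or => /and4P[].
rewrite sem_set_raw upd_eq ifN; first by rewrite Ac // upd_ne.
by rewrite /= Ac // upd_eq gtn_eqF // (leq_trans iE).
Qed.

Ltac pset v t1 t2 :=
  rewrite (@sem_then_set _ _ _ _ _ 0 v); [ | reflexivity | t1 | t2 | reflexivity].

Section Program.
Variables (b c : nat).

(** Three failures of probability [2 ^- (CK * L)] must stay below the inverse of [n ^ c]: since
    [n <= 2 ^ (2 * L)], the part [2 * c] covers [n ^ c] and 3 covers the factor 3. *)
Definition CK := 2 * c + 3.
(** The word length [th * L] must beat a union bound over pairs, levels and classes; [bad_count]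
    spends 13 powers of [2 ^ L] and two of [2 ^ K]. *)
Definition th := 13 + 2 * CK.
(** [48 * K] trials of success probability at least 1/48 all fail with probability at most
    [expR (- K)]. *)
Definition CB := 48 * CK.
(** Chosen so that [vF] is [2 * m * m], the loss between graph and window distance, times [4 * L],
    the loss of one Bourgain coordinate. *)
Definition CF := 8 * th ^ 2.
(** Exceeds the exponent of [n + 1] in all values computed; [b] accounts for the size of the
    coordinates. *)
Definition cap_exp := b + 4 * th + CK + CB + CF + 60.

Section Values.
Variables (n s al : nat).
Definition vL := trunc_log 2 n.
Definition vLv := (trunc_log 2 s).+1.
Definition vN := (n - s).+1.
Definition vK := CK * vL.
(** These scales reach past [4 * Lv * s * s], the largest quantity that [scale_exists] has to
    cover. *)
Definition vRn := 8 * vL.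
Definition vE := vRn * vK.
Definition vm := th * vL.
Definition vRB := CB * vL.
(** [2 * L] sampling densities with [RB] random sets each. *)
Definition vt := 2 * vL * vRB.
Definition vLvn := vLv * n.
Definition vstr := 2 * al + 2 * vLvn.
(** The words of all classes, followed by one word per coordinate and window for the seed sets. *)
Definition vEE := vE * vstr + vt * vN.
Definition v2EN := 2 * (vE * vN).
Definition vF := CF * (vL * (vL * vL)).
Definition vcap := n.+1 ^ cap_exp.

(** The position in the list is the register number. *)
Definition params : nat -> nat :=
  nth 0 [:: 0; 0; 0; vcap; 0; 0; n; s; al; 0; vN; vL; vLv; vm; vRn; vK; vE; vt;
            vEE; vLvn; vRB; v2EN; vF; vstr].
End Values.

Definition header_prog : prog :=
  9 <- Get 1 (Num 3) [/] Num 2 ;; 6 <- Get 1 (Num 0) [-] V 9 ;;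
  7 <- Get 1 (Num 1) [-] V 9 ;; 8 <- Get 1 (Num 2) [-] V 9.

Definition logs_prog : prog := log_prog 11 40 6 6 41 ;; log_prog 24 40 7 6 41.

Definition params_prog : prog :=
  12 <- V 24 [+] Num 1 ;; 10 <- V 6 [-] V 7 [+] Num 1 ;; 15 <- Num CK [*] V 11 ;;
  14 <- Num 8 [*] V 11 ;; 16 <- V 14 [*] V 15 ;; 13 <- Num th [*] V 11 ;;
  20 <- Num CB [*] V 11 ;; 17 <- Num 2 [*] V 11 [*] V 20 ;; 19 <- V 12 [*] V 6 ;;
  23 <- Num 2 [*] V 8 [+] Num 2 [*] V 19 ;; 18 <- V 16 [*] V 23 [+] V 17 [*] V 10 ;;
  21 <- Num 2 [*] (V 16 [*] V 10) ;; 22 <- Num CF [*] (V 11 [*] (V 11 [*] V 11)).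

Definition build_prog : prog := pow_prog ;; rand_prog ;; hash_prog.

Fixpoint epow (e : expr) (k : nat) : expr :=
  if k is k'.+1 then Op OpMul e (epow e k') else Const 1.

(** The modulus comes from an expression of constant length. Phases are compiled separately because
    a loop bound must already be a parameter, and earlier phases compute those of later ones. *)
Definition main_cmd : cmd :=
  Seq (Store (Const (haddr 3 0)) (epow (Op OpAdd (Fetch (Const 0)) (Const 1)) cap_exp))
 (Seq (comp 0 header_prog) (Seq (comp 0 logs_prog) (Seq (comp 0 params_prog)
 (Seq (comp 0 build_prog) (comp 0 out_prog))))).

Lemma eval_epow m e k (x : nat) : eval m e = Posz x -> eval m (epow e k) = Posz (x ^ k).
Proof. by move=> H; elim: k => //= k ->; rewrite H expnS. Qed.

Definition pars3 : seq nat := [:: 3; 6; 7; 8] ++ iota 10 14.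

Lemma wf_all : [/\ wf_prog true [:: 3] header_prog, wf_prog true [:: 3; 6; 7] logs_prog,
  wf_prog true [:: 3] params_prog, wf_prog true pars3 build_prog
  & wf_prog false pars3 out_prog].
Proof. by split. Qed.

Section Bounds.
Variables (n s : nat).
Hypotheses (s_gt0 : 0 < s) (le_sn : s <= n).
Local Notation Y := n.+1.

(** A calculus of exponents: products add them, and a sum costs one more as [n + 1 >= 2]. *)
Definition pY (a x : nat) := x <= Y ^ a.

Lemma n_gt0 : 0 < n. Proof. exact: leq_trans s_gt0 le_sn. Qed.

Lemma Y_ge2 : 1 < Y. Proof. by rewrite ltnS n_gt0. Qed.

Lemma pY_mul a a' x y : pY a x -> pY a' y -> pY (a + a') (x * y).
Proof. by rewrite /pY expnD; apply: leq_mul. Qed.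

Lemma pY_W a a' x : a <= a' -> pY a x -> pY a' x.
Proof. by move=> aa H; apply: leq_trans H _; rewrite leq_exp2l // Y_ge2. Qed.

Lemma pY_add a x y : pY a x -> pY a y -> pY a.+1 (x + y).
Proof.
rewrite /pY expnS => Hx Hy; apply: leq_trans (leq_add Hx Hy) _.
by rewrite addnn -mul2n leq_mul2r Y_ge2 orbT.
Qed.

Lemma pY_le a x y : x <= y -> pY a y -> pY a x.
Proof. exact: leq_trans. Qed.

Lemma pY_const k : pY k k.
Proof. by apply: ltnW; apply: ltn_expl; apply: Y_ge2. Qed.

Lemma pY_n : pY 1 n. Proof. by rewrite /pY expn1. Qed.

Lemma pY_cap a x : pY a x -> a < cap_exp -> x < vcap n.
Proof. by move=> H aD; apply: leq_ltn_trans H _; rewrite ltn_exp2l // Y_ge2. Qed.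

Lemma vL_lt : vL n < n. Proof. by apply: trunc_log_lt; apply: n_gt0. Qed.

Lemma pY_L : pY 1 (vL n).
Proof. by apply: pY_le pY_n; apply: ltnW; apply: vL_lt. Qed.

Lemma pY_2L k : pY k (2 ^ (k * vL n)).
Proof.
rewrite /pY mulnC expnM; case: k => [//|k]; rewrite leq_exp2r //.
by apply: leqW; apply: trunc_logP; rewrite ?n_gt0.
Qed.

Lemma vLv_le : vLv s <= (vL n).+1.
Proof. by rewrite ltnS leq_trunc_log. Qed.

Lemma pY_Lv : pY 1 (vLv s).
Proof. by rewrite /pY expn1; apply: leq_trans vLv_le _; rewrite ltnS ltnW // vL_lt. Qed.

Lemma vN_le : vN n s <= n. Proof. by rewrite /vN; lia. Qed.

Lemma pY_N : pY 1 (vN n s). Proof. by apply: pY_le pY_n; apply: vN_le. Qed.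

Lemma pY_K : pY (CK + 1) (vK n). Proof. exact: pY_mul (pY_const _) pY_L. Qed.

Lemma pY_Rn : pY 9 (vRn n). Proof. exact: pY_mul (pY_const _) pY_L. Qed.

Lemma pY_E : pY (CK + 10) (vE n).
Proof. by apply: pY_W (pY_mul pY_Rn pY_K); lia. Qed.

Lemma pY_m : pY (th + 1) (vm n). Proof. exact: pY_mul (pY_const _) pY_L. Qed.

Lemma pY_RB : pY (CB + 1) (vRB n). Proof. exact: pY_mul (pY_const _) pY_L. Qed.

Lemma pY_t : pY (CB + 4) (vt n).
Proof. by apply: pY_W (pY_mul (pY_mul (pY_const 2) pY_L) pY_RB); lia. Qed.

Lemma pY_Lvn : pY 2 (vLvn n s). Proof. exact: pY_mul pY_Lv pY_n. Qed.

Lemma pY_str al : al <= n -> pY 5 (vstr n s al).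
Proof.
move=> le_al; apply: pY_add; last exact: pY_mul (pY_const 2) pY_Lvn.
by apply: pY_W (pY_mul (pY_const 2) (pY_le le_al pY_n)).
Qed.

Lemma pY_EE al : al <= n -> pY (CK + CB + 17) (vEE n s al).
Proof.
move=> le_al; rewrite addnS; apply: pY_add.
  by apply: pY_W (pY_mul pY_E (pY_str le_al)); lia.
by apply: pY_W (pY_mul pY_t pY_N); lia.
Qed.

Lemma pY_2EN : pY (CK + 13) (v2EN n s).
Proof. by apply: pY_W (pY_mul (pY_const 2) (pY_mul pY_E pY_N)); lia. Qed.

Lemma pY_F : pY (CF + 3) (vF n).
Proof. exact: pY_mul (pY_const _) (pY_mul pY_L (pY_mul pY_L pY_L)). Qed.

End Bounds.

Section Semantics.
Variables (n s al M : nat) (x : nat -> nat -> nat) (st : state).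
Hypotheses (s_gt0 : 0 < s) (le_sn : s <= n) (al_gt0 : 0 < al) (le_al : al <= n).
Hypothesis le_M : M <= n ^ b.
Hypotheses (h0 : st 1 0 = n + M) (h1 : st 1 1 = s + M) (h2 : st 1 2 = al + M).
Hypotheses (h3 : st 1 3 = M + M) (hx : forall i k, i < n -> k < al ->
  st 1 (4 + i * al + k) = x i k) (x_le : forall i k, i < n -> k < al -> x i k <= 2 * M).
Hypotheses (hcap : st 3 0 = vcap n) (coin : forall i, st 0 i < 2).
Hypothesis init0 : forall r i, 5 < r -> st r i = 0.
Local Notation cap := (vcap n).

Let st1 := sem header_prog st.
Let st2 := sem logs_prog st1.
Let st3 := sem params_prog st2.

Let Yg := Y_ge2 s_gt0 le_sn.
Let ltcap a y : pY n a y -> a < cap_exp -> y < cap := @pY_cap n s s_gt0 le_sn a y.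
Let pYn := pY_n n.

Lemma pY_M : pY n (b + 1) (2 * M).
Proof.
rewrite /pY addn1 expnS; apply: leq_mul => //; apply: leq_trans le_M _.
by case: (b) => [//|b']; rewrite leq_exp2r.
Qed.

(** Cell 3, itself read with the shift by [M], shows [2 * M]; half of it undoes the shift in the
    other cells. *)
Lemma header_sem : st1 = upd (upd (upd (upd st 9 0 M) 6 0 n) 7 0 s) 8 0 al.
Proof.
have MC : M < cap by apply: leq_ltn_trans (ltcap pY_M _); rewrite /cap_exp; lia.
have nC : n < cap by apply: ltcap pYn _; rewrite /cap_exp; lia.
rewrite /st1 /header_prog; sset 0 M; rewrite //; first last.
- by rewrite hcap.
- by rewrite /= h3 addnn -muln2 mulnK.
sset 0 n; rewrite //; first last.
- by rd; rewrite hcap.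
- by rd; rewrite h0 addnK.
sset 0 s; rewrite //; first last.
- by rd; rewrite hcap; apply: leq_ltn_trans nC.
- by rd; rewrite h1 addnK.
sset 0 al; rewrite //; first last.
- by rd; rewrite hcap; apply: leq_ltn_trans nC.
- by rd; rewrite h2 addnK.
Qed.

Lemma st1_pars : same_pars [:: 3; 6; 7] (params n s al) st1.
Proof.
move=> r; rewrite header_sem !inE => /or3P[] /eqP->; by rd.
Qed.

Lemma logs_sem : [/\ st2 11 0 = vL n, st2 24 0 = trunc_log 2 s &
  agree [:: 11; 24; 40; 41] st2 st1].
Proof.
have c1 : st1 3 0 = cap by rewrite header_sem; rd.
have n1 : st1 6 0 = n by rewrite header_sem; rd.
have s1 : st1 7 0 = s by rewrite header_sem; rd.
have C2 : 2 * n < cap.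
  by apply: ltcap (pY_mul (pY_const s_gt0 le_sn 2) pYn) _; rewrite /cap_exp; lia.
have A2 := @sem_agree logs_prog st1.
rewrite /st2 /logs_prog sem_then; set sa := sem (log_prog 11 40 6 6 41) st1.
have Aa := @sem_agree (log_prog 11 40 6 6 41) st1 : agree _ sa st1.
split.
- rewrite sem_agree // /sa log_progP ?n1 ?c1 //.
  by rewrite leqnn (leq_trans s_gt0).
- by rewrite log_progP //; rewrite !Aa // ?n1 ?s1 ?c1 // s_gt0.
- move=> r; rewrite !inE !negb_or => /and4P[r1 r2 r3 r4].
  by rewrite -sem_then A2 //= !inE !negb_or r1 r2 r3 r4.
Qed.

Lemma params_sem : same_pars pars3 (params n s al) st3 /\
  forall r, 24 < r -> r != 40 -> r != 41 -> st3 r = st r.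
Proof.
have [L2 Ls2 A2] := logs_sem.
have old r : r \notin [:: 6; 7; 8; 9; 11; 24; 40; 41] -> st2 r = st r.
  rewrite !inE !negb_or => /and5P[r6 r7 r8 r9 /and4P[r1 r2 r3 r4]].
  by rewrite A2 ?inE ?negb_or ?r1 ?r2 ?r3 ?r4 // header_sem !upd_ne.
have c3 : st2 3 0 = cap by rewrite old.
have n2 : st2 6 0 = n by rewrite A2 // header_sem; rd.
have s2 : st2 7 0 = s by rewrite A2 // header_sem; rd.
have a2 : st2 8 0 = al by rewrite A2 // header_sem; rd.
have E3 : st3 = upd (upd (upd (upd (upd (upd (upd (upd (upd (upd (upd (upd (upd st2
   12 0 (vLv s)) 10 0 (vN n s)) 15 0 (vK n)) 14 0 (vRn n)) 16 0 (vE n)) 13 0 (vm n))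
   20 0 (vRB n)) 17 0 (vt n)) 19 0 (vLvn n s)) 23 0 (vstr n s al)) 18 0 (vEE n s al))
   21 0 (v2EN n s)) 22 0 (vF n).
  rewrite /st3 /params_prog.
  pset (vLv s) ltac:(by rd; rewrite Ls2 addn1) ltac:(by rd; rewrite c3; apply: ltcap (pY_Lv s_gt0 le_sn) _; rewrite /cap_exp; lia).
  pset (vN n s) ltac:(by rd; rewrite n2 s2 addn1) ltac:(by rd; rewrite c3; apply: ltcap (pY_N s_gt0 le_sn) _; rewrite /cap_exp; lia).
  pset (vK n) ltac:(by rd; rewrite L2) ltac:(by rd; rewrite c3; apply: ltcap (pY_K s_gt0 le_sn) _; rewrite /cap_exp; lia).
  pset (vRn n) ltac:(by rd; rewrite L2) ltac:(by rd; rewrite c3; apply: ltcap (pY_Rn s_gt0 le_sn) _; rewrite /cap_exp; lia).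
  pset (vE n) ltac:(by rd) ltac:(by rd; rewrite c3; apply: ltcap (pY_E s_gt0 le_sn) _; rewrite /cap_exp; lia).
  pset (vm n) ltac:(by rd; rewrite L2) ltac:(by rd; rewrite c3; apply: ltcap (pY_m s_gt0 le_sn) _; rewrite /cap_exp; lia).
  pset (vRB n) ltac:(by rd; rewrite L2) ltac:(by rd; rewrite c3; apply: ltcap (pY_RB s_gt0 le_sn) _; rewrite /cap_exp; lia).
  pset (vt n) ltac:(by rd; rewrite L2) ltac:(by rd; rewrite c3; apply: ltcap (pY_t s_gt0 le_sn) _; rewrite /cap_exp; lia).
  pset (vLvn n s) ltac:(by rd; rewrite n2) ltac:(by rd; rewrite c3; apply: ltcap (pY_Lvn s_gt0 le_sn) _; rewrite /cap_exp; lia).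
  pset (vstr n s al) ltac:(by rd; rewrite a2) ltac:(by rd; rewrite c3; apply: ltcap (pY_str s_gt0 le_sn le_al) _; rewrite /cap_exp; lia).
  pset (vEE n s al) ltac:(by rd) ltac:(by rd; rewrite c3; apply: ltcap (pY_EE s_gt0 le_sn le_al) _; rewrite /cap_exp; lia).
  pset (v2EN n s) ltac:(by rd) ltac:(by rd; rewrite c3; apply: ltcap (pY_2EN s_gt0 le_sn) _; rewrite /cap_exp; lia).
  rewrite (@sem_set _ _ _ _ 0 (vF n)); [reflexivity | reflexivity | by rd; rewrite L2 | | reflexivity].
  by rd; rewrite c3; apply: ltcap (pY_F s_gt0 le_sn) _; rewrite /cap_exp; lia.
split=> [r rp|r r24 r40 r41].
  have : r \in pars3 by [].
  rewrite E3 /pars3 /= !inE.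
  do 17!(case/orP=> [/eqP->|]; [by rd; rewrite ?c3 ?n2 ?s2 ?a2 ?L2|]).
  by move/eqP->; rd.
clear E3 old c3 n2 s2 a2 L2 Ls2.
have nm (rs : seq nat) : all (fun q => q <= 24) rs -> r \notin rs.
  by move=> /allP H; apply/negP => /H; rewrite leqNgt r24.
rewrite /st3 (@sem_agree params_prog) ?nm // A2; last first.
  by rewrite !inE !negb_or r40 r41 !gtn_eqF // (leq_ltn_trans _ r24).
by rewrite /st1 (@sem_agree header_prog) ?nm.
Qed.

Let st4 := sem build_prog st3.
Let st5 := sem out_prog st4.

Definition words (k : nat) : nat :=
  if k < vEE n s al then bits_val (st 0) (k * vm n) (vm n) else 0.

(** Input, parameters and words only: the labels and weights computed from this state link the
    machine to the probabilistic analysis. *)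
Definition ideal (rnd : nat -> nat) : state := fun r i =>
  if r == 26 then rnd i else if r == 1 then st 1 i else params n s al r.

Definition ideal_seeds (rnd : nat -> nat) z : {set 'I_(vN n s)} :=
  [set i : 'I_(vN n s) | rnd (vE n * vstr n s al + z * vN n s + i)
                          %% 2 ^ (z %/ vRB n).+1 == 0].

Definition ideal_spec (rnd : nat -> nat) z (D : nat -> nat) :=
  (ideal_seeds rnd z != set0 ->
     greatest_lip (vE n) (class_label (ideal rnd)) (class_weight (ideal rnd))
        (ideal_seeds rnd z) (fun i => (D i).-1) /\
     forall i, i < vN n s -> 0 < D i) /\
  (ideal_seeds rnd z = set0 -> forall i, i < vN n s -> D i = 0).

Lemma words_lt k : words k < 2 ^ vm n.
Proof. by rewrite /words; case: ifP => _; rewrite ?expn_gt0 // bits_val_lt. Qed.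

Lemma words_cap k : words k < cap.
Proof.
apply: leq_trans (words_lt k) _; apply: ltnW.
by apply: ltcap (pY_2L s_gt0 le_sn th) _; rewrite /cap_exp; lia.
Qed.

Lemma build_sem : 1 < n -> let sR := sem rand_prog (sem pow_prog st3) in
  [/\ same_pars pars3 (params n s al) sR, forall j, j <= vRn n -> sR 25 j = 2 ^ j,
      sR 26 =1 words, sR 1 = st 1 & forall y, sR 33 y = 0].
Proof.
move=> n2 sR; have [P3 old] := params_sem.
have c3 : st3 3 0 = cap by exact: P3.
have R3 : st3 14 0 = vRn n by exact: P3.
have A1 := @sem_agree pow_prog st3; have A2 := @sem_agree rand_prog (sem pow_prog st3).
have [_ _ A3] := logs_sem.
have P4 : same_pars pars3 (params n s al) sR.
  move=> r rp; rewrite /sR A2 ?A1 ?P3 //; apply: contraL rp; rewrite /= !inE;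
  by do ![case/orP=> [/eqP->//|]] => /eqP->.
have coin0 i : sem pow_prog st3 0 i < 2.
  by rewrite A1 // /st3 sem_agree // A3 // /st1 sem_agree.
have c4 : sem pow_prog st3 3 0 = cap by rewrite A1.
have mE : sem pow_prog st3 13 0 = vm n by rewrite A1 // P3.
have EEE : sem pow_prog st3 18 0 = vEE n s al by rewrite A1 // P3.
have st30 : sem pow_prog st3 0 = st 0.
  by rewrite A1 // /st3 sem_agree // A3 // /st1 sem_agree.
split=> //.
- move=> j jR; rewrite /sR A2 // pow_progP ?R3 // c3.
  by apply: ltcap (pY_2L s_gt0 le_sn 8) _; rewrite /cap_exp; lia.
- move=> k; rewrite /words; case: ltnP => kE.
    rewrite /sR rand_progP ?mE ?EEE ?c4 // ?st30 //.
    by apply: ltnW; apply: ltcap (pY_2L s_gt0 le_sn th) _; rewrite /cap_exp; lia.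
  by rewrite /sR rand_prog_out ?EEE // (A1 26) // old // init0.
- by rewrite /sR A2 // A1 // /st3 sem_agree // A3 // /st1 sem_agree.
- by move=> y; rewrite /sR A2 // A1 // old // init0.
Qed.

(** The arrays produced by hashing agree with the labels of [ideal words], and equal bucket heads
    mean equal labels, so Dijkstra on the arrays and the graph of the analysis have the same
    potentials. *)
Lemma final_core sR : 1 < n ->
  same_pars pars3 (params n s al) sR -> (forall j, j <= vRn n -> sR 25 j = 2 ^ j) ->
  sR 26 =1 words -> sR 1 = st 1 -> (forall y, sR 33 y = 0) ->
  let sF := sem out_prog (sem hash_prog sR) in
  exists D, [/\ forall z, z < vt n -> ideal_spec words z (D z),
    forall z i, z < vt n -> i < vN n s ->
      sF 2 (1 + i * vt n + z) = (D z i * vF n).+1 & sF 2 0 = s.+1].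
Proof.
move=> n2 PR powR wR iR zR sF; rewrite {}/sF; set sH := sem hash_prog sR.
have AH := @sem_agree hash_prog sR : agree _ sH sR.
have L_gt0 : 0 < vL n by rewrite trunc_log_gt0.
have q r : r \in pars3 -> sR r 0 = params n s al r by exact: PR.
have [q3 q6 q7 q8 q10] : [/\ sR 3 0 = cap, sR 6 0 = n, sR 7 0 = s, sR 8 0 = al
  & sR 10 0 = vN n s] by split; apply: q.
have [q12 q14 q15 q16 q17] : [/\ sR 12 0 = vLv s, sR 14 0 = vRn n, sR 15 0 = vK n,
  sR 16 0 = vE n & sR 17 0 = vt n] by split; apply: q.
have [q19 q20 q21 q22 q23] : [/\ sR 19 0 = vLvn n s, sR 20 0 = vRB n, sR 21 0 = v2EN n s,
  sR 22 0 = vF n & sR 23 0 = vstr n s al] by split; apply: q.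
have K_gt0 : 0 < vK n by rewrite /vK /CK addn3 muln_gt0.
have Rn_gt0 : 0 < vRn n by rewrite /vRn muln_gt0.
have E_gt0 : 0 < vE n by rewrite /vE muln_gt0 Rn_gt0.
have w26 : sR 26 = words by apply: boolp.funext.
have bnd a y : pY n a y -> a < cap_exp -> y < cap by exact: ltcap.
have gs := s_gt0; have gl := le_sn.
have pw := pY_2L gs gl th.
have pM : pY n (th + b + 2) (2 * M + 2 ^ vm n).
  rewrite addn2; apply: (pY_add gs gl); first by apply: (pY_W gs gl _ pY_M); lia.
  by apply: (pY_W gs gl _ pw); lia.
have HD : hash_done sR (sR 16 0) sH.
  apply: hash_progP => //; rewrite ?q3 ?q6 ?q7 ?q8 ?q10 ?q12 ?q14 ?q15 ?q16 ?q19 ?q23 //.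
  - by apply: leq_trans (vLv_le le_sn) _; rewrite /vRn; lia.
  - by apply: bnd pYn _; rewrite /cap_exp; lia.
  - by apply: bnd (pY_Lvn gs gl) _; rewrite /cap_exp; lia.
  - by apply: bnd (pY_E gs gl) _; rewrite /cap_exp; lia.
  - apply: bnd (pY_mul (pY_E gs gl) (pY_str gs gl le_al)) _; rewrite /cap_exp; lia.
  - by apply: bnd (pY_2L gs gl 8) _; rewrite /cap_exp; lia.
  - move=> base l i iN; apply: leq_ltn_trans (_ : al * (2 ^ vm n * (2 * M + 2 ^ vm n)) < _).
      rewrite /point_hash /point_part q8.
      have -> : al * (2 ^ vm n * (2 * M + 2 ^ vm n)) =
         \sum_(k < al) (2 ^ vm n * (2 * M + 2 ^ vm n)) by rewrite sum_nat_const card_ord.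
      apply: leq_sum => k _; rewrite w26; apply: leq_mul; first exact: ltnW (words_lt _).
      apply: leq_trans (leq_div _ _) _; rewrite iR hx // leq_add ?x_le //.
      exact: ltnW (words_lt _).
    apply: bnd (pY_mul (pY_le le_al pYn) (pY_mul pw pM)) _; rewrite /cap_exp; lia.
  - move=> base rho cnt Hc.
    apply: leq_ltn_trans (_ : vLvn n s * (2 ^ vm n * (n + 2 ^ vm n)) < _).
      rewrite /count_hash q12 q6.
      have -> : vLvn n s * (2 ^ vm n * (n + 2 ^ vm n)) =
         \sum_(y < vLv s * n) (2 ^ vm n * (n + 2 ^ vm n)) by rewrite sum_nat_const card_ord.
      apply: leq_sum => y _; rewrite /count_term w26; apply: leq_mul; first exact: ltnW (words_lt _).
      apply: leq_trans (leq_subr _ _) (leq_trans (leq_div _ _) _).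
      by rewrite leq_add ?Hc ?(ltnW (words_lt _)).
    have pn : pY n (th + 2) (n + 2 ^ vm n).
      rewrite addn2; apply: (pY_add gs gl); first by apply: (pY_W gs gl _ pYn); lia.
      by apply: (pY_W gs gl _ pw); lia.
    apply: bnd (pY_mul (pY_Lvn gs gl) (pY_mul pw pn)) _; rewrite /cap_exp; lia.
case: HD => H1 H2 _.
have qH r : r \notin mods hash_prog -> sH r = sR r by exact: AH.
have labE : class_label sR = class_label (ideal words).
  apply: boolp.funext => e; apply: boolp.funext => i.
  rewrite /class_label /window_hash /count_hash /count_term /point_label /point_hash /point_part.
  by rewrite w26 iR q6 q7 q8 q12 q14 q15 q23.
have wtE : class_weight sR = class_weight (ideal words).
  by apply: boolp.funext => e; rewrite /class_weight q15.
rewrite labE wtE q10 q16 in H1 H2.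
have ediv e : e < vE n -> e %/ vK n < vRn n by move=> eE; rewrite ltn_divLR.
have wt_le e : e < vE n -> class_weight (ideal words) e <= 2 ^ vRn n.
  move=> eE; rewrite /class_weight /=; case: eqP => // _.
  by rewrite leq_exp2l // ltnW // -[ideal words 15 0]/(vK n) ediv.
have repE e i : e < vE n -> i < vN n s -> sH 34 (e * vN n s + i) =
   lasteq (class_label (ideal words) e) (vN n s) (class_label (ideal words) e i).
  by move=> eE iN; case: (H1 e i eE iN).
have prevE e i : e < vE n -> i < vN n s -> sH 32 (e * vN n s + i) =
   lasteq (class_label (ideal words) e) i (class_label (ideal words) e i).
  by move=> eE iN; case: (H1 e i eE iN).
have BR := @lasteq_bucket_rep (vN n s) (vE n) (class_label (ideal words)).
have BP := @lasteq_bucket_prev (vN n s) (vE n) (class_label (ideal words)).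
(* The last class belongs to the top scale and serves as the class joining all windows. *)
have top : (vE n).-1 %/ vK n = (vRn n).-1.
  rewrite /vE; case: (vRn n) Rn_gt0 => // r' _; case: (vK n) K_gt0 => // k' _.
  by rewrite mulSnr addnS /= divnMDl // divn_small ?addn0.
have rH r : r \in pars3 -> sH r 0 = params n s al r.
  move=> rp; rewrite qH ?q //; apply: contraL rp; rewrite /= !inE;
  by do ![case/orP=> [/eqP->//|]] => /eqP->.
have [r3 r7 r10 r14 r16] : [/\ sH 3 0 = cap, sH 7 0 = s, sH 10 0 = vN n s,
  sH 14 0 = vRn n & sH 16 0 = vE n] by split; apply: rH.
have [r17 r20 r21 r22 r23] : [/\ sH 17 0 = vt n, sH 20 0 = vRB n, sH 21 0 = v2EN n s,
  sH 22 0 = vF n & sH 23 0 = vstr n s al] by split; apply: rH.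
have h26 : sH 26 = words by rewrite qH.
have h25 j : j <= vRn n -> sH 25 j = 2 ^ j by move=> jR; rewrite qH // powR.
clear wR iR zR PR q rH powR.
have [] : exists D, [/\ forall z, z < sH 17 0 -> coord_spec sH z (D z),
   forall z i, z < sH 17 0 -> i < sH 10 0 ->
     sem out_prog sH 2 (1 + i * sH 17 0 + z) = (D z i * sH 22 0).+1 &
   sem out_prog sH 2 0 = (sH 7 0).+1].
  apply: (out_progP (st0 := sH) (W := 2 ^ vRn n)) => //; rewrite ?h26 ?r3 ?r7 ?r10 ?r14 ?r16 ?r17 ?r20 ?r21 ?r22 ?r23 //.
  - by move=> e eE; rewrite H2 // wt_le.
  - apply: bnd (pY_mul (_ : pY n 11 _) (pY_F gs gl)) _; last by rewrite /cap_exp; lia.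
    apply: (pY_add gs gl); first by apply: (pY_W gs gl _ (pY_const gs gl 1)).
    by apply: (pY_W gs gl _ (pY_mul (pY_N gs gl) (pY_2L gs gl 8))).
  - have th0 : 0 < th by [].
    by rewrite /vF /CF !muln_gt0 th0 L_gt0.
  - by apply: bnd (pY_N gs gl) _; rewrite /cap_exp; lia.
  - by apply: bnd (pY_t gs gl) _; rewrite /cap_exp; lia.
  - by apply: bnd (pY_E gs gl) _; rewrite /cap_exp; lia.
  - by apply: bnd (pY_mul (pY_E gs gl) (pY_N gs gl)) _; rewrite /cap_exp; lia.
  - by apply: bnd (pY_le le_sn pYn) _; rewrite /cap_exp; lia.
  - move=> e i eE iN; have [h1' h2' h3'] := BR e i eE iN.
    rewrite repE // h1' h3' repE //; last by case/andP: h1'; lia.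
  - move=> e i eE iN; have [h1' h2' h3'] := BP e i eE iN.
    rewrite prevE //; split=> //.
      by move=> p0; rewrite !repE ?h2' //; move: h1' iN p0; lia.
    by move=> j ji; rewrite !repE ?(ltn_trans ji iN) //; apply: h3'.
  - by apply: bnd (pY_2L gs gl 8) _; rewrite /cap_exp; lia.
  - have RB_gt0 : 0 < vRB n by rewrite /vRB /CB /CK addn3 !muln_gt0 L_gt0.
    move=> z zt; rewrite ltn_divLR //; apply: leq_trans zt _.
    by rewrite /vt /vRn leq_mul2r leq_mul2r !orbT.
  - exact: words_cap.
  - exists (vE n).-1; first by rewrite prednK.
    move=> i j iN jN; rewrite !repE ?prednK //.
    by rewrite /class_label -[ideal words 15 0]/(vK n) top -[ideal words 14 0]/(vRn n) prednK // ltnn.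
move=> D [D1 D2 D3]; rewrite r17 in D1 D2; rewrite r10 r22 in D2; rewrite r7 in D3.
exists D; split=> // z zt.
have {D1} := D1 z zt; rewrite /coord_spec /seeds /ideal_spec /ideal_seeds.
rewrite r10 r16 r20 r23 h26 => -[S1 S2]; split=> // S0.
have [G1 G2] := S1 S0; split=> //.
have lipE g : lip (vN n s) (vE n) (fun e i => sH 34 (e * vN n s + i)) (fun e => sH 35 e) g <->
   lip (vN n s) (vE n) (class_label (ideal words)) (class_weight (ideal words)) g.
  split=> H e i j eE iN jN lij; [rewrite -H2 //|rewrite H2 //]; apply: H => //.
    by rewrite !repE // lij.
  by apply/eqP; rewrite -(lasteq_rep_eq _ iN jN); apply/eqP; rewrite -!repE.
case: G1 => g1 g2 g3; split=> //; first exact/lipE.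
by move=> g /lipE gl'; apply: g3.
Qed.

Lemma final_sem : 1 < n -> exists D, [/\ forall z, z < vt n -> ideal_spec words z (D z),
    forall z i, z < vt n -> i < vN n s ->
      st5 2 (1 + i * vt n + z) = (D z i * vF n).+1 & st5 2 0 = s.+1].
Proof.
by move=> n2; have [PR powR wR iR zR] := build_sem n2; exact: (final_core n2 PR powR wR iR zR).
Qed.

End Semantics.
End Program.

(** * The compiled program on the input memory *)

Local Open Scope nat_scope.

Lemma nth_flatten_uniform (T : Type) (x0 : T) (ss : seq (seq T)) a i k :
  all (fun u => size u == a) ss -> i < size ss -> k < a ->
  nth x0 (flatten ss) (i * a + k) = nth x0 (nth [::] ss i) k.
Proof.
elim: ss i => [|u ss IH] [|i] //= /andP[/eqP su H] iS ka; rewrite nth_cat su.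
  by rewrite ka.
by rewrite mulSn -addnA ltnNge leq_addr /= addKn IH.
Qed.

Section Exec.
Variables (b c : nat) (n s al M : nat) (v : 'I_n -> 'rV[int]_al).
Hypotheses (s_gt0 : 0 < s) (le_sn : s <= n) (al_gt0 : 0 < al) (le_al : al <= n).
Hypothesis le_M : M <= n ^ b.
Hypothesis v_bound : forall (i : 'I_n) (k : 'I_al), (`|v i 0%R k| <= Posz M)%R.

Let m0 := input_memory s M v.
Local Notation P := (main_cmd b c).
Local Notation cap := (vcap b c n).

Definition inp (i : nat) : nat := absz (m0 (Posz i) + Posz M)%R.
Definition coord (i k : nat) : nat := inp (4 + i * al + k).

Definition init_state (r : seq bool) : state := fun q i =>
  if q == 0 then nth false r i : nat else if q == 1 then inp i
  else if (q == 3) && (i == 0) then cap else 0.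

Lemma input_cell (i : 'I_n) (k : 'I_al) : m0 (Posz (4 + i * al + k)) = v i 0%R k.
Proof.
rewrite /m0 /input_memory -addnA nth_cat /= addKn.
rewrite (@nth_flatten_uniform _ 0%R _ al) ?size_map -?enumT ?size_enum_ord //.
  rewrite (nth_map i) ?size_enum_ord // (nth_map k) ?size_enum_ord //.
  by rewrite !nth_ord_enum.
by apply/allP => u /mapP[j _ ->]; rewrite size_map size_enum_ord.
Qed.

Lemma input_ge (i : nat) : (0 <= m0 (Posz i) + Posz M)%R /\ absz (m0 (Posz i)) <= maxn n M.
Proof.
suff : (0 <= m0 (Posz i))%R /\ absz (m0 (Posz i)) <= maxn n M \/
       absz (m0 (Posz i)) <= M.
  move: (m0 _) => z [[h1 h2]|h]; split=> //.
  - by rewrite addr_ge0.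
  - by rewrite -lerBlDr sub0r; case: z h => u /=; lia.
  - by rewrite leq_max h orbT.
rewrite /m0 /input_memory; move: i => [|[|[|[|i]]]] /=.
- by left; rewrite leq_max leqnn.
- by left; rewrite leq_max le_sn.
- by left; rewrite leq_max le_al.
- by left; rewrite leq_max leqnn orbT.
right; set sq := flatten _.
have [iL|iL] := ltnP i (size sq); last by rewrite nth_default.
have : nth 0%R sq i \in sq by apply: mem_nth.
by case/allpairsP=> -[j k] /= [_ _ ->]; have := v_bound j k; lia.
Qed.

Definition bound_X := cap + cmd_const P + 2.

Lemma cap_ge : n < cap /\ M < cap.
Proof.
split.
  by apply: (@pY_cap b c n s s_gt0 le_sn _ _ (pY_n n)); rewrite /cap_exp; lia.
apply: leq_ltn_trans (@pY_cap b c n s s_gt0 le_sn _ _ (pY_M s_gt0 le_sn le_M) _); first lia.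
by rewrite /cap_exp; lia.
Qed.

Lemma init_represents r :
  represents true (init_state r) (update m0 (haddr 3 0) (Posz cap)) r.
Proof.
have up (i : nat) : update m0 (haddr 3 0) (Posz cap) (Posz i) = m0 (Posz i).
  by rewrite /update eq_sym haddr_neg.
split.
- move=> _ i; rewrite !up /init_state /= /inp.
  by have [h _] := input_ge i; rewrite gez0_abs.
- by left.
- by rewrite /update eqxx.
- move=> q /andP[q5 q64] i; rewrite /update haddr_inj // /init_state.
  have -> : (q == 3) = false by apply: gtn_eqF; apply: leq_trans q5.
  have -> : (q == 0) = false by apply: gtn_eqF; apply: leq_trans q5.
  have -> : (q == 1) = false by apply: gtn_eqF; apply: leq_trans q5.
  rewrite /= /m0 /input_memory /haddr.
  by case: (64 * i + q) (leq_trans q5 (leq_addl (64 * i) q)).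
- by [].
Qed.

Definition total_steps : nat :=
  6 + (psteps (params b c n s al) header_prog + psteps (params b c n s al) logs_prog +
       psteps (params b c n s al) (params_prog c) + psteps (params b c n s al) build_prog +
       psteps (params b c n s al) out_prog).

Lemma main_exec r : exists m' r' k, [/\ exec bound_X P m0 r m' r' k, k <= total_steps,
  mem_bounded bound_X m0 &
  represents false (sem out_prog (sem build_prog (sem (params_prog c)
    (sem logs_prog (sem header_prog (init_state r)))))) m' r'].
Proof.
have [nC MC] := cap_ge.
have [W0 W1 W2 W3 W4] := wf_all c.
have m0X : mem_bounded bound_X m0.
  case=> [i|i]; last by rewrite /m0 /input_memory.
  have [_ h] := input_ge i; apply: leq_trans h _; rewrite geq_max /bound_X; lia.
have capX : 0 < params b c n s al 3 <= bound_X.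
  change (0 < cap <= bound_X).
  by rewrite {1}/vcap expn_gt0 /= /bound_X -addnA leq_addr.
set st := init_state r.
have i0 : inp 0 = n + M by rewrite /inp /m0 /=; lia.
have i1 : inp 1 = s + M by rewrite /inp /m0 /=; lia.
have i2 : inp 2 = al + M by rewrite /inp /m0 /=; lia.
have i3 : inp 3 = M + M by rewrite /inp /m0 /=; lia.
pose m1 := update m0 (haddr 3 0) (Posz cap).
have R1 : represents true st m1 r := init_represents r.
have B1 : mem_bounded bound_X m1.
  by apply: mem_bounded_update => //=; rewrite /bound_X -addnA leq_addr.
have E0 : exec bound_X (Store (Const (haddr 3 0))
    (epow (Op OpAdd (Fetch (Const 0)) (Const 1)) (cap_exp b c))) m0 r m1 r 1.
  have ev : eval m0 (epow (Op OpAdd (Fetch (Const 0)) (Const 1)) (cap_exp b c)) = Posz cap.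
    by rewrite (eval_epow _ (x := n.+1)) //= -addn1 PoszD.
  rewrite /m1 -ev; apply: ExStore; rewrite ev /= /bound_X -addnA leq_addr //.
have sp0 : same_pars [:: 3] (params b c n s al) st by move=> q; rewrite inE => /eqP->.
have [ma [ra [ka [Ea La Ra Ba _]]]] := @comp_exec true [:: 3] (params b c n s al) bound_X
   capX isT isT header_prog 0 st m1 r W0 sp0 R1 B1.
have sp1 := @st1_pars b c n s al M st s_gt0 le_sn al_gt0 le_al le_M i0 i1 i2 i3 (erefl _).
have [mb [rb [kb [Eb Lb Rb Bb _]]]] := @comp_exec true [:: 3; 6; 7] (params b c n s al) bound_X
   capX isT isT logs_prog 0 _ ma ra W1 sp1 Ra Ba.
have sp2 : same_pars [:: 3] (params b c n s al) (sem logs_prog (sem header_prog st)).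
  by move=> q qE; apply: (@sem_pars true [:: 3; 6; 7] _ isT logs_prog _ W1 sp1);
     move: qE; rewrite !inE => ->.
have [mc [rc [kc [Ec Lc Rc Bc _]]]] := @comp_exec true [:: 3] (params b c n s al) bound_X
   capX isT isT (params_prog c) 0 _ mb rb W2 sp2 Rb Bb.
have [sp3 _] := @params_sem b c n s al M st s_gt0 le_sn al_gt0 le_al le_M i0 i1 i2 i3 (erefl _).
have [md [rd_ [kd [Ed Ld Rd Bd _]]]] := @comp_exec true pars3 (params b c n s al) bound_X
   capX isT isT build_prog 0 _ mc rc W3 sp3 Rc Bc.
have sp4 := @sem_pars true pars3 (params b c n s al) isT build_prog _ W3 sp3.
(* From here on the output may overwrite the input, so the clause on region 1 is dropped. *)
have Rd' : represents false (sem build_prog (sem (params_prog c)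
    (sem logs_prog (sem header_prog st)))) md rd_ by case: Rd => *; split.
have [me [re [ke [Ee Le Re Be _]]]] := @comp_exec false pars3 (params b c n s al) bound_X
   capX isT isT out_prog 0 _ md rd_ W4 sp4 Rd' Bd.
exists me, re, (1 + (ka + (kb + (kc + (kd + ke).+1).+1).+1).+1).+1; split=> //.
  by do 5!(apply: ExSeq; first eassumption).
by rewrite /total_steps; lia.
Qed.

End Exec.

(** * Running time *)

Local Open Scope nat_scope.

(** Constants and powers of [L + 1] are absorbed, so polylogarithmic loop lengths count as [b1]. *)
Definition bigO (B g : nat -> nat -> nat -> nat) := exists C k, forall n s al,
  0 < s -> s <= n -> 0 < al -> al <= n -> g n s al <= C * (B n s al * (vL n).+1 ^ k).

Definition b1 (n s al : nat) := 1.
Definition bn (n s al : nat) := n.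
Definition bal (n s al : nat) := al.
Definition bna (n s al : nat) := n * al.

Lemma bigO_W B B' g : (forall n s al, 0 < s -> s <= n -> 0 < al -> al <= n ->
  B n s al <= B' n s al) -> bigO B g -> bigO B' g.
Proof.
move=> H [C [k Hg]]; exists C, k => n s al s0 sn a0 an.
by apply: leq_trans (Hg _ _ _ s0 sn a0 an) _; rewrite leq_mul2l leq_mul2r H ?orbT.
Qed.

Lemma bigO_le B g g' : (forall n s al, 0 < s -> s <= n -> 0 < al -> al <= n ->
  g' n s al <= g n s al) -> bigO B g -> bigO B g'.
Proof.
move=> H [C [k Hg]]; exists C, k => n s al s0 sn a0 an.
exact: leq_trans (H _ _ _ s0 sn a0 an) (Hg _ _ _ s0 sn a0 an).
Qed.

Lemma bigO_add B g h : bigO B g -> bigO B h -> bigO B (fun n s al => g n s al + h n s al).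
Proof.
move=> [C [k Hg]] [C' [k' Hh]]; exists (C + C'), (k + k') => n s al s0 sn a0 an.
rewrite mulnDl; apply: leq_add.
  apply: leq_trans (Hg _ _ _ s0 sn a0 an) _; rewrite !leq_mul2l.
  by rewrite leq_pexp2l ?leq_addr ?orbT.
apply: leq_trans (Hh _ _ _ s0 sn a0 an) _; rewrite !leq_mul2l.
by rewrite leq_pexp2l ?leq_addl ?orbT.
Qed.

Lemma bigO_mul B B' g h : bigO B g -> bigO B' h ->
  bigO (fun n s al => B n s al * B' n s al) (fun n s al => g n s al * h n s al).
Proof.
move=> [C [k Hg]] [C' [k' Hh]]; exists (C * C'), (k + k') => n s al s0 sn a0 an.
apply: leq_trans (leq_mul (Hg _ _ _ s0 sn a0 an) (Hh _ _ _ s0 sn a0 an)) _.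
by rewrite expnD; apply: eq_leq; nia.
Qed.

Lemma bigO_const B c0 : (forall n s al, 0 < s -> s <= n -> 0 < al -> al <= n ->
  0 < B n s al) -> bigO B (fun _ _ _ => c0).
Proof.
move=> H; exists c0, 0 => n s al s0 sn a0 an; rewrite expn0 muln1.
by rewrite leq_pmulr // H.
Qed.

Section Steps.
Variables (b c : nat).
Definition ps (p : prog) n s al := psteps (params b c n s al) p.
Definition pr (r : nat) n s al := params b c n s al r.

Definition posB (B : nat -> nat -> nat -> nat) := forall n s al,
  0 < s -> s <= n -> 0 < al -> al <= n -> 0 < B n s al.

Lemma pos_all : [/\ posB b1, posB bn, posB bal & posB bna].
Proof.
by split=> n s al s0 sn a0 an //; rewrite /bn /bna ?muln_gt0 ?a0 ?andbT (leq_trans s0).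
Qed.

Lemma bO_prim B p : posB B -> (forall n s al, ps p n s al = 1) -> bigO B (ps p).
Proof. by move=> pB H; apply: bigO_le (bigO_const 1 pB) => *; rewrite H. Qed.

Lemma bO_then B p q : posB B -> bigO B (ps p) -> bigO B (ps q) -> bigO B (ps (Then p q)).
Proof.
move=> pB Hp Hq; apply: bigO_le (bigO_add (bigO_add Hp Hq) (bigO_const 1 pB)) => n s al *.
by rewrite addn1.
Qed.

Lemma bO_cond B e p q : posB B -> bigO B (ps p) -> bigO B (ps q) ->
  bigO B (ps (Cond e p q)).
Proof.
move=> pB Hp Hq; apply: bigO_le (bigO_add (bigO_add Hp Hq) (bigO_const 1 pB)) => n s al *.
by rewrite addn1 /ps /= ltnS geq_max leq_addr leq_addl.
Qed.

Lemma bO_for B B1 B2 x r p : posB B -> posB B2 ->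
  (forall n s al, B1 n s al * B2 n s al <= B n s al) ->
  bigO B1 (pr r) -> bigO B2 (ps p) -> bigO B (ps (For x r p)).
Proof.
move=> pB p2 HB Hr Hp; apply: bigO_le (bigO_add (bigO_const 5 pB) (_ : bigO B
  (fun n s al => pr r n s al * (ps p n s al + 5)))) => //.
apply: bigO_W (bigO_mul Hr (bigO_add Hp (bigO_const 5 p2))) => n s al *.
exact: HB.
Qed.

Lemma vL_log (k : nat) : bigO b1 (fun n _ _ => k * vL n).
Proof.
by exists k, 1 => n s al _ _ _ _; rewrite expn1 mul1n leq_mul2l leqnSn orbT.
Qed.

Lemma bO_logs : [/\ bigO b1 (pr 12), bigO b1 (pr 13), bigO b1 (pr 14), bigO b1 (pr 15)
  & bigO b1 (pr 16) /\ bigO b1 (pr 17)].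
Proof.
have L1 k := vL_log k.
split; try exact: L1.
  exists 1, 1 => n s al s0 sn _ _; rewrite !mul1n expn1; exact: vLv_le sn.
split; first exact: bigO_mul (L1 8) (L1 (CK c)).
exact: bigO_mul (L1 2) (L1 (CB c)).
Qed.

Lemma bO_ns : [/\ bigO bn (pr 6), bigO bn (pr 10), bigO bn (pr 19), bigO bn (pr 21)
  & bigO bal (pr 8) /\ bigO bna (pr 18)].
Proof.
have [l12 l13 l14 l15 [l16 l17]] := bO_logs; have [p1 pn pa pna] := pos_all.
have h6 : bigO bn (pr 6) by exists 1, 0 => n s al *; rewrite mul1n muln1.
have h8 : bigO bal (pr 8) by exists 1, 0 => n s al *; rewrite mul1n muln1.
have h10 : bigO bn (pr 10).
  by apply: bigO_le h6 => n s al s0 sn _ _; apply: vN_le.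
have h19 : bigO bn (pr 19).
  by apply: bigO_W (bigO_mul l12 h6) => n s al *; rewrite /b1 mul1n.
have nna : forall g, bigO bn g -> bigO bna g.
  by move=> g; apply: bigO_W => n s al *; rewrite /bna leq_pmulr.
split=> //.
  apply: bigO_W (bigO_mul (bigO_const 2 p1) (bigO_mul l16 h10)) => n s al *.
  by rewrite /b1 !mul1n.
split=> //; apply: bigO_add.
  apply: bigO_W (bigO_mul l16 (bigO_add (B := bna) (g := fun n s al => 2 * al)
    (h := fun n s al => 2 * vLvn n s) _ _)).
  - by move=> n s al *; rewrite /b1 mul1n.
  - apply: bigO_W (bigO_mul (bigO_const 2 p1) h8) => n s al s0 sn *.
    by rewrite /b1 /bna /bal mul1n leq_pmull // (leq_trans s0).
  - apply: nna; apply: bigO_W (bigO_mul (bigO_const 2 p1) h19) => n s al *.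
    by rewrite /b1 mul1n.
by apply: nna; apply: bigO_W (bigO_mul l17 h10) => n s al *; rewrite /b1 mul1n.
Qed.

(** Recursion on the syntax of the programs. The product [n * al] arises where points are hashed and
    where the random words are drawn; the other long loops have length [n] up to logarithms. *)
Lemma bO_total : bigO bna (fun n s al => total_steps b c n s al).
Proof.
have [l12 l13 l14 l15 [l16 l17]] := bO_logs; have [p1 pn pa pna] := pos_all.
have [h6 h10 h19 h21 [h8 h18]] := bO_ns.
have m1 B : forall n s al, b1 n s al * B n s al <= B n s al.
  by move=> *; rewrite /b1 mul1n.
have nal n s al : bn n s al * bal n s al <= bna n s al by [].
have al1 n s al : bal n s al * b1 n s al <= bal n s al by rewrite /b1 muln1.
have na1 n s al : bna n s al * b1 n s al <= bna n s al by rewrite /b1 muln1.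
have E r : (r \in [:: 12; 13; 14; 15; 16; 17]) -> bigO b1 (pr r).
  by rewrite !inE; do ![case/orP=> [/eqP->//|]] => /eqP->.
have F r : (r \in [:: 6; 10; 19; 21]) -> bigO bn (pr r).
  by rewrite !inE; do ![case/orP=> [/eqP->//|]] => /eqP->.
apply: bigO_add; first exact: bigO_const.
repeat apply: bigO_add; rewrite -/(ps _);
  rewrite /header_prog /logs_prog /log_prog /params_prog /build_prog /out_prog /pow_prog
    /rand_prog /hash_prog /point_prog /point_scan /point_read /slide_prog /recount_prog
    /bucket_prog /coord_prog /seed_prog /step_prog /relax_prog /settle_prog /pick_prog
    /best_body /visit_prog;
  repeat first
  [ apply: bO_then => // | apply: bO_cond => // | by apply: bO_prim
  | apply: (bO_for _ p1 p1 (m1 b1)); [by apply: E|]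
  | apply: (bO_for _ pa pa (m1 bal)); [by apply: E|]
  | apply: (bO_for _ pna pna (m1 bna)); [by apply: E|]
  | apply: (bO_for _ pna pa nal); [by apply: F|]
  | apply: (bO_for _ pa p1 al1); [exact: h8|]
  | apply: (bO_for _ pna p1 na1); [exact: h18|] ].
Qed.

End Steps.

(** * Triangle inequality for windows; existence of graph distances *)

Local Open Scope ring_scope.

Section Metric.
Variables (s : nat) (dn : nat -> nat -> nat).
Hypothesis dn0 : forall i, dn i i = 0%N.
Hypothesis dnT : forall i j k, (dn i k <= dn i j + dn j k)%N.

Lemma wdist0 i : wdist s dn i i = 0%N.
Proof.
apply/eqP; rewrite -leqn0; apply: leq_trans (wdist_le dn i i (1%g : 'S_s)) _.
by rewrite leqn0 /match_cost big1 // => k _; rewrite perm1 dn0 min0n.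
Qed.

(** Matchings compose, and truncation at [s] preserves the triangle inequality. *)
Lemma wdistT i j k : (wdist s dn i k <= wdist s dn i j + wdist s dn j k)%N.
Proof.
have [t1 ->] := wdist_ex s dn i j; have [t2 ->] := wdist_ex s dn j k.
apply: leq_trans (wdist_le dn i k (t1 * t2)%g) _.
rewrite /match_cost [X in (_ <= _ + X)%N](reindex_inj (@perm_inj _ t1)) -big_split /=.
apply: leq_sum => q _; rewrite permM.
by have := dnT (i + q) (j + t1 q) (k + t2 (t1 q)); lia.
Qed.

End Metric.

Section GreatestExists.
Variables (N E : nat) (lab : nat -> nat -> nat) (wt : nat -> nat) (e0 : nat).
Hypotheses (e0E : (e0 < E)%N).
Hypothesis one : forall i j, (i < N)%N -> (j < N)%N -> lab e0 i = lab e0 j.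

(** The pointwise maximum of all potentials vanishing at [x], finite because the class [e0] bounds
    them by [wt e0]. *)
Lemma greatest_exists : exists d : 'I_N -> nat -> nat,
  forall x, greatest_lip E lab wt [set x] (d x).
Proof.
pose P (x : 'I_N) (y k : nat) := boolp.asbool
  (exists g, [/\ lip N E lab wt g, g x = 0%N & g y = k]).
pose d (x : 'I_N) y := (\max_(k < (wt e0).+1 | P x y k) k)%N.
have le_e0 g (x : 'I_N) y : lip N E lab wt g -> g x = 0%N -> (y < N)%N -> (g y <= wt e0)%N.
  by move=> gl gx yN; have := gl e0 y x e0E yN (ltn_ord x) (one yN (ltn_ord x)); rewrite gx.
have dmax g (x : 'I_N) y : lip N E lab wt g -> g x = 0%N -> (y < N)%N -> (g y <= d x y)%N.
  move=> gl gx yN; have gy : (g y < (wt e0).+1)%N by rewrite ltnS (le_e0 g x).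
  apply: (@leq_bigmax_cond _ (fun k : 'I_(wt e0).+1 => P x y k) (fun k => k : nat) (Ordinal gy)).
  by apply/boolp.asboolP; exists g.
have dex (x : 'I_N) y : exists g, [/\ lip N E lab wt g, g x = 0%N & g y = d x y].
  have P0 : P x y (ord0 : 'I_(wt e0).+1).
    by apply/boolp.asboolP; exists (fun=> 0%N).
  have [|k kP dk] := @eq_bigmax_cond _ (fun k : 'I_(wt e0).+1 => P x y k) (fun k => k : nat).
    by apply/card_gt0P; exists ord0.
  have dE : d x y = k by exact: dk.
  by rewrite dE; move/boolp.asboolP: kP.
exists d => x; split.
- move=> e i j eE iN jN lij; have [g [gl gx gi]] := dex x i; rewrite -gi.
  by apply: leq_trans (gl e i j eE iN jN lij) _; rewrite leq_add2r dmax.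
- move=> i; rewrite inE => /eqP->; have [g [_ gx <-]] := dex x x; exact: gx.
- by move=> g gl gS i iN; apply: dmax => //; apply: gS; rewrite inE.
Qed.
End GreatestExists.

(** * Analysis of the hashes *)

Local Open Scope ring_scope.

Lemma expR_pow2 (R : realType) (k : nat) : expR (- k%:R) <= 2 ^- k :> R.
Proof.
rewrite expRN lef_pV2 ?posrE ?expR_gt0 ?exprn_gt0 //.
have -> : expR k%:R = expR 1 ^+ k :> R by rewrite -expRM_natl mulr1.
by rewrite lerXn2r ?nnegrE ?expR_ge0 //; have := expR_ge1Dx (1 : R); lra.
Qed.

Section Hashing.
Variables (R : realType) (b c n s al M : nat) (v : 'I_n -> 'rV[int]_al).
Hypotheses (s_gt0 : (0 < s)%N) (le_sn : (s <= n)%N) (n_gt1 : (1 < n)%N).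

Local Notation N := (vN n s).
Local Notation E := (vE c n).
Local Notation K := (vK c n).
Local Notation Rn := (vRn n).
Local Notation L := (vL n).
Local Notation Lv := (vLv s).
Local Notation m := (vm c n).
Local Notation EE := (vEE c n s al).
Local Notation str := (vstr n s al).
Local Notation Om := {ffun 'I_EE -> 'I_(2 ^ m)}.
Local Notation x := (coord s M v).

Definition rn (w : Om) (k : nat) : nat := oapp (fun i => w i : nat) 0%N (insub k).

Lemma rnE (w : Om) k (h : (k < EE)%N) : rn w k = w (Ordinal h).
Proof. by rewrite /rn insubT. Qed.

Definition pst (w : Om) : state := ideal b c n s al (init_state b c s M v [::]) (rn w).

Definition cnt (w : Om) e y i : nat :=
  wcount s (point_label (pst w) (e * str) (y %/ n)) (y %% n) i.

Definition dnat i j : nat := \sum_(k < al) ndist (x i k) (x j k).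
Definition wd i j : nat := wdist s dnat i j.

Lemma L_gt0 : (0 < L)%N. Proof. by rewrite trunc_log_gt0. Qed.

Lemma n_pos : (0 < n)%N. Proof. exact: ltnW. Qed.

Lemma block_lt e k : (e < E)%N -> (k < str)%N -> (e * str + k < EE)%N.
Proof.
move=> eE ks; apply: leq_trans (leq_addr _ _); apply: leq_trans (_ : e.+1 * str <= _)%N.
  by rewrite mulSnr ltn_add2l.
by rewrite leq_mul2r eE orbT.
Qed.

Definition same_pt (w : Om) e l i j : bool := [forall k : 'I_al,
  (x i k + rn w (e * str + k)) %/ 2 ^ l == (x j k + rn w (e * str + k)) %/ 2 ^ l]%N.

Definition hash_pt (w : Om) e l i : nat := point_hash (pst w) (e * str) l i.

Lemma hash_ptE w e l i : hash_pt w e l i =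
  (\sum_(k < al) rn w (e * str + al + k) * ((x i k + rn w (e * str + k)) %/ 2 ^ l))%N.
Proof. by []. Qed.

Lemma same_pt_hash w e l i j : same_pt w e l i j -> hash_pt w e l i = hash_pt w e l j.
Proof.
by move=> /forallP H; rewrite !hash_ptE; apply: eq_bigr => k _; rewrite (eqP (H k)).
Qed.

Section Class.
Variables (e : nat).
Hypothesis eE : (e < E)%N.
Local Notation base := (e * str)%N.

Lemma idx1_lt (k : 'I_al) : (base + k < EE)%N.
Proof. by apply: block_lt => //; rewrite /vstr; have := ltn_ord k; lia. Qed.
Lemma idx2_lt (k : 'I_al) : (base + al + k < EE)%N.
Proof. by rewrite -addnA; apply: block_lt => //; rewrite /vstr; have := ltn_ord k; lia. Qed.
Lemma idx3_lt (y : 'I_(Lv * n)) : (base + 2 * al + y < EE)%N.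
Proof.
by rewrite -addnA; apply: block_lt => //; rewrite /vstr /vLvn; have := ltn_ord y; lia.
Qed.
Lemma idx4_lt (y : 'I_(Lv * n)) : (base + 2 * al + Lv * n + y < EE)%N.
Proof.
have -> : (base + 2 * al + Lv * n + y = base + (2 * al + Lv * n + y))%N by rewrite !addnA.
by apply: block_lt => //; rewrite /vstr /vLvn; have := ltn_ord y; lia.
Qed.

Definition i1 k := Ordinal (idx1_lt k).
Definition i2 k := Ordinal (idx2_lt k).
Definition i3 y := Ordinal (idx3_lt y).
Definition i4 y := Ordinal (idx4_lt y).

Lemma i1_inj : injective i1.
Proof. by move=> k k' /(congr1 val) /= /addnI /val_inj. Qed.
Lemma i2_inj : injective i2.
Proof. by move=> k k' /(congr1 val) /= /addnI /val_inj. Qed.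
Lemma i3_inj : injective i3.
Proof. by move=> k k' /(congr1 val) /= /addnI /val_inj. Qed.
Lemma i4_inj : injective i4.
Proof. by move=> k k' /(congr1 val) /= /addnI /val_inj. Qed.

Lemma same_ptE (w : Om) l i j : same_pt w e l i j =
  [forall k, same_cell (m := m) (fun k : 'I_al => x i k) (fun k : 'I_al => x j k)
     (fun=> l) k (w (i1 k))].
Proof. by apply: eq_forallb => k; rewrite (rnE w (idx1_lt k)). Qed.

Lemma pt_near l i j : (l <= m)%N -> (i < n)%N -> (j < n)%N ->
  Pr R (fun w : Om => point_label (pst w) base l i != point_label (pst w) base l j)
    <= (dnat i j)%:R / 2 ^+ l.
Proof.
move=> lm iN jN.
have S := @grid_separate R _ m _ i1 (fun k : 'I_al => x i k) (fun k : 'I_al => x j k)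
  (fun=> l) (fun=> lm).
apply: le_trans (_ : _ <= \sum_(k < al) (ndist (x i k) (x j k))%:R / 2 ^+ l) _; last first.
  by rewrite -mulr_suml -natr_sum.
apply: le_trans S; apply: Pr_sub => w; apply: contraNN; rewrite -same_ptE => /same_pt_hash h.
by rewrite last_labelP //; apply/eqP.
Qed.

(** Shifts and coefficients are different words: with the shifts frozen the cells are fixed, and the
    linear hash tells different cell vectors apart. *)
Lemma pt_collision l i j :
  Pr R (fun w : Om => (hash_pt w e l i == hash_pt w e l j) && ~~ same_pt w e l i j) <= 2 ^- m.
Proof.
pose J : pred 'I_EE := fun k => [exists q, i2 q == k].
apply: (Pr_merge_le (cardV_gt0 m) (J := J)) => w.
have J1 q : ~~ J (i1 q).
  apply/existsP => -[q' /eqP /(congr1 val) /= h]; have := ltn_ord q; lia.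
have r1 w' (q : 'I_al) : rn (merge J w w') (base + q) = rn w (base + q).
  by rewrite (rnE _ (idx1_lt q)) (rnE _ (idx1_lt q)) ffunE ifN //; apply: J1.
have r2 w' (q : 'I_al) : rn (merge J w w') (base + al + q) = w' (i2 q).
  rewrite (rnE _ (idx2_lt q)) ffunE ifT //; apply/existsP; exists q.
  exact/eqP/val_inj.
pose X (t : nat) (q : 'I_al) := ((x t q + rn w (base + q)) %/ 2 ^ l)%N.
have sE w' : same_pt (merge J w w') e l i j = [forall q, X i q == X j q].
  by apply: eq_forallb => q; rewrite r1.
have hE w' t : hash_pt (merge J w w') e l t = (\sum_q w' (i2 q) * X t q)%N.
  by rewrite hash_ptE; apply: eq_bigr => q _; rewrite r1 r2.
have [H|H] := boolP [forall q, X i q == X j q].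
  apply: le_trans (_ : Pr R (fun=> false) <= _).
    by apply: Pr_sub => w'; rewrite sE H andbF.
  by rewrite /Pr Ex_cst ?cardV_gt0 // invr_ge0 exprn_ge0.
have C : exists q, X i q != X j q.
  by move: H; rewrite negb_forall => /existsP[q Hq]; exists q.
apply: le_trans (linear_hash_collision R m i2_inj C).
by apply: Pr_sub => w' /andP[]; rewrite !hE.
Qed.

Lemma pt_far l i j (B : nat) : (l <= m)%N -> (B * 2 ^ l <= dnat i j)%N ->
  Pr R (fun w : Om => same_pt w e l i j) <= 2 ^- B.
Proof.
move=> lm far; apply: le_trans (expR_pow2 R B).
have S := @grid_same R _ m _ i1 (fun k : 'I_al => x i k) (fun k : 'I_al => x j k)
  (fun=> l) (fun=> lm) i1_inj.
apply: le_trans (_ : _ <= expR (- ((dnat i j)%:R / 2 ^+ l))) _.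
  apply: le_trans (_ : _ <= expR (- \sum_(k < al) (ndist (x i k) (x j k))%:R / 2 ^+ l)) _.
    by apply: le_trans S; apply: Pr_sub => w; rewrite same_ptE.
  by rewrite -mulr_suml -natr_sum.
rewrite ler_expR lerN2 ler_pdivlMr ?exprn_gt0 // -natrX -natrM ler_nat.
exact: far.
Qed.

Section Win.
Variable rho : nat.
Hypothesis rho_le : (rho <= m)%N.

Definition wexp (y : nat) : nat := (rho - y %/ n)%N.

Definition same_win (w : Om) i j : bool := [forall y : 'I_(Lv * n),
  (cnt w e y i + rn w (base + 2 * al + Lv * n + y)) %/ 2 ^ wexp y ==
  (cnt w e y j + rn w (base + 2 * al + Lv * n + y)) %/ 2 ^ wexp y]%N.

Definition hash_win (w : Om) i : nat := window_hash (pst w) base rho i.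

Lemma hash_winE w i : hash_win w i = (\sum_(y < Lv * n) rn w (base + 2 * al + y) *
  ((cnt w e y i + rn w (base + 2 * al + Lv * n + y)) %/ 2 ^ wexp y
   - rn w (base + 2 * al + Lv * n + y) %/ 2 ^ wexp y))%N.
Proof. by []. Qed.

Lemma same_win_hash w i j : same_win w i j -> hash_win w i = hash_win w j.
Proof.
by move=> /forallP H; rewrite !hash_winE; apply: eq_bigr => y _; rewrite (eqP (H y)).
Qed.

Lemma cnt_local (w w' : Om) : (forall k, (k < 2 * al)%N -> rn w (base + k) = rn w' (base + k)) ->
  cnt w e =2 cnt w' e.
Proof.
move=> H y i; rewrite /cnt; congr (wcount _ _ _ _); apply: boolp.funext => q.
rewrite /point_label; congr (last_label _ _ _); apply: boolp.funext => t.
rewrite -/(hash_pt w e _ t) -/(hash_pt w' e _ t) !hash_ptE; apply: eq_bigr => k _.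
have kl := ltn_ord k; rewrite -!addnA !H //; clear -kl; lia.
Qed.

Lemma rn_merge_out (J : pred 'I_EE) (w w' : Om) k :
  (forall h : (k < EE)%N, ~~ J (Ordinal h)) -> rn (merge J w w') k = rn w k.
Proof.
move=> H; case: (ltnP k EE) => h; last by rewrite /rn !insubN // -leqNgt.
by rewrite !(rnE _ h) ffunE ifN.
Qed.

Lemma win_collision i j :
  Pr R (fun w : Om => (hash_win w i == hash_win w j) && ~~ same_win w i j) <= 2 ^- m.
Proof.
pose J : pred 'I_EE := fun k => [exists q, i3 q == k].
apply: (Pr_merge_le (cardV_gt0 m) (J := J)) => w.
have out k : (forall q : 'I_(Lv * n), k != base + 2 * al + q)%N ->
   forall w', rn (merge J w w') k = rn w k.
  move=> Hk w'; apply: rn_merge_out => h; apply/existsP => -[q /eqP /(congr1 val) /= hq].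
  by move: (Hk q); rewrite hq eqxx.
have cE w' : cnt (merge J w w') e =2 cnt w e.
  by apply: cnt_local => k kl; apply: out => q; apply/eqP; lia.
have r4 w' (q : 'I_(Lv * n)) : rn (merge J w w') (base + 2 * al + Lv * n + q) =
    rn w (base + 2 * al + Lv * n + q).
  by apply: out => q'; apply/eqP; have := ltn_ord q'; lia.
have r3 w' (q : 'I_(Lv * n)) : rn (merge J w w') (base + 2 * al + q) = w' (i3 q).
  rewrite (rnE _ (idx3_lt q)) ffunE ifT //; apply/existsP; exists q.
  exact/eqP/val_inj.
pose X (t : nat) (q : 'I_(Lv * n)) := ((cnt w e q t + rn w (base + 2 * al + Lv * n + q))
   %/ 2 ^ wexp q - rn w (base + 2 * al + Lv * n + q) %/ 2 ^ wexp q)%N.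
have hE w' t : hash_win (merge J w w') t = (\sum_q w' (i3 q) * X t q)%N.
  by rewrite hash_winE; apply: eq_bigr => q _; rewrite cE r4 r3.
have sE w' : same_win (merge J w w') i j = same_win w i j.
  by apply: eq_forallb => q; rewrite !cE r4.
have [H|H] := boolP (same_win w i j).
  apply: le_trans (_ : Pr R (fun=> false) <= _).
    by apply: Pr_sub => w'; rewrite sE H andbF.
  by rewrite /Pr Ex_cst ?cardV_gt0 // invr_ge0 exprn_ge0.
(* The subtracted quotient depends on the shift alone, so different roundings stay different. *)
have C : exists q, X i q != X j q.
  move: H; rewrite negb_forall => /existsP[q Hq]; exists q; apply: contraNneq Hq; rewrite /X.
  set u := (rn w _ %/ _)%N => h.
  have m1 t : (u <= (cnt w e q t + rn w (base + 2 * al + Lv * n + q)) %/ 2 ^ wexp q)%N.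
    by apply: leq_div2r; apply: leq_addl.
  by rewrite -(subnK (m1 i)) -(subnK (m1 j)) h.
apply: le_trans (linear_hash_collision R m i3_inj C).
by apply: Pr_sub => w' /andP[]; rewrite !hE.
Qed.

(** The quadtree estimate of transportation cost: a unit of discrepancy at level [l] costs the cell
    side [2 ^ l]. *)
Definition weight (w : Om) i j : nat :=
  \sum_(y < Lv * n) 2 ^ (y %/ n) * ndist (cnt w e y i) (cnt w e y j).

Lemma same_win_low w i j : same_win w i j -> forall y : 'I_(Lv * n), (rho <= y %/ n)%N ->
  ndist (cnt w e y i) (cnt w e y j) = 0%N.
Proof.
move=> /forallP H y hy; have := H y.
have -> : wexp y = 0%N by rewrite /wexp; apply/eqP; rewrite subn_eq0.
by rewrite expn0 !divn1 eqn_add2r => /eqP->; rewrite /ndist subnn.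
Qed.

Lemma resample4 (w : Om) : let J : pred 'I_EE := fun k => [exists q, i4 q == k] in
  forall w', (cnt (merge J w w') e =2 cnt w e) /\
  forall q : 'I_(Lv * n), rn (merge J w w') (base + 2 * al + Lv * n + q) = w' (i4 q).
Proof.
move=> J w'; split.
  apply: cnt_local => k kl; apply: rn_merge_out => h; apply/existsP => -[q].
  by move=> /eqP /(congr1 val) /=; lia.
move=> q; rewrite (rnE _ (idx4_lt q)) ffunE ifT //; apply/existsP; exists q.
exact/eqP/val_inj.
Qed.

(** With the counts frozen, rounding is one more random grid, of width [2 ^ (rho - l)] at level [l],
    so distance over width is the weight over [2 ^ rho]. From level [rho] on the comparison is exact
    and any discrepancy excludes equality. *)
Lemma win_far i j (B : nat) :
  Pr R (fun w : Om => same_win w i j && (B * 2 ^ rho <= weight w i j)%N) <= 2 ^- B.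
Proof.
pose J : pred 'I_EE := fun k => [exists q, i4 q == k].
apply: (Pr_merge_le (cardV_gt0 m) (J := J)) => w.
have cE w' := (resample4 w w').1; have r4 w' := (resample4 w w').2.
have ex : (forall y, (wexp y <= m)%N) by move=> y; apply: leq_trans (leq_subr _ _) rho_le.
have sE w' : same_win (merge J w w') i j = [forall q, same_cell (m := m)
   (fun q : 'I_(Lv * n) => cnt w e q i) (fun q : 'I_(Lv * n) => cnt w e q j)
   (fun q : 'I_(Lv * n) => wexp q) q (w' (i4 q))].
  by apply: eq_forallb => q; rewrite !cE r4.
have wE w' : weight (merge J w w') i j = weight w i j.
  by apply: eq_bigr => q _; rewrite !cE.
have zero : (forall w', ~~ (same_win (merge J w w') i j &&
     (B * 2 ^ rho <= weight (merge J w w') i j)%N)) ->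
   Pr R (fun w' => same_win (merge J w w') i j &&
     (B * 2 ^ rho <= weight (merge J w w') i j)%N) <= 2 ^- B.
  move=> H; apply: le_trans (_ : Pr R (fun=> false) <= _).
    by apply: Pr_sub => w' h; move: (H w'); rewrite h.
  by rewrite /Pr Ex_cst ?cardV_gt0 // invr_ge0 exprn_ge0.
have [/existsP[y /andP[y1 y2]]|/existsPn low] := boolP [exists y : 'I_(Lv * n),
    (rho <= y %/ n)%N && (ndist (cnt w e y i) (cnt w e y j) != 0)%N].
  apply: zero => w'; apply/negP => /andP[sw _].
  by have := same_win_low sw y1; rewrite !cE => h; rewrite h in y2.
have [far|near] := leqP (B * 2 ^ rho) (weight w i j); last first.
  by apply: zero => w'; rewrite wE leqNgt near andbF.
apply: le_trans (expR_pow2 R B).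
have S := @grid_same R _ m _ i4 (fun q : 'I_(Lv * n) => cnt w e q i)
  (fun q : 'I_(Lv * n) => cnt w e q j) (fun q : 'I_(Lv * n) => wexp q) (fun q => ex q) i4_inj.
apply: le_trans (_ : _ <= expR (- ((weight w i j)%:R / 2 ^+ rho))) _.
  apply: le_trans (_ : _ <= expR (- \sum_(q < Lv * n)
      (ndist (cnt w e q i) (cnt w e q j))%:R / 2 ^+ wexp q)) _.
    by apply: le_trans S; apply: Pr_sub => w' /andP[]; rewrite sE.
  rewrite ler_expR lerN2 /weight natr_sum mulr_suml; apply: ler_sum => q _.
  have := low q; rewrite negb_and -ltnNge negbK => /orP[ql|/eqP->]; last by rewrite muln0 !mul0r.
  have -> : 2 ^+ rho = 2 ^+ wexp q * 2 ^+ (q %/ n) :> R by rewrite -exprD /wexp subnK // ltnW.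
  rewrite natrM natrX [2 ^+ (q %/ n) * _]mulrC invfM -mulrA [2 ^+ (q %/ n) * (_ * _)]mulrCA.
  by rewrite divff ?mulr1 // expf_neq0 // pnatr_eq0.
by rewrite ler_expR lerN2 ler_pdivlMr ?exprn_gt0 // -natrX -natrM ler_nat.
Qed.

Lemma sum_divmod (F : nat -> nat -> nat) a :
  (\sum_(y < a * n) F (y %/ n) (y %% n) = \sum_(l < a) \sum_(g < n) F l g)%N.
Proof.
elim: a => [|a IH]; first by rewrite !big_ord0.
rewrite -(big_mkord xpredT (fun y => F (y %/ n) (y %% n)))%N mulSnr.
rewrite (big_cat_nat (n := (a * n)%N)) ?leq_addr //= big_mkord IH big_ord_recr /=.
congr (_ + _)%N; rewrite -{1}[(a * n)%N]add0n big_addn addKn big_mkord.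
apply: eq_bigr => g _; rewrite addnC divnMDl ?n_pos // divn_small // addn0.
by rewrite modnMDl modn_small.
Qed.

Lemma weight_upper w i j (tau : 'S_s) : (weight w i j <= \sum_(l < Lv) 2 ^ l *
  (2 * \sum_(k < s) (point_label (pst w) base l (i + k)
                      != point_label (pst w) base l (j + tau k))))%N.
Proof.
pose F l g := (2 ^ l * ndist (wcount s (point_label (pst w) base l) g i)
                            (wcount s (point_label (pst w) base l) g j))%N.
have -> : weight w i j = (\sum_(l < Lv) \sum_(g < n) F l g)%N by rewrite -sum_divmod.
apply: leq_sum => l _; rewrite /F -big_distrr /= leq_mul2l; apply/orP; right.
by apply: wcount_upper => q; apply: last_label_lt; apply: n_pos.
Qed.

(** Given the counts, the windows are told apart with probability at most the weight over [2 ^ rho],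
    and an optimal matching bounds the expected weight by [2 * Lv * wd i j]: at level [l] a pair is
    cut with probability at most its distance over [2 ^ l], while [2 ^ l <= s] handles the truncated
    pairs. *)
Lemma win_near i j : (i < N)%N -> (j < N)%N -> (4 * Lv * wd i j <= 2 ^ rho)%N ->
  (Lv <= m)%N -> Pr R (fun w : Om => hash_win w i != hash_win w j) <= 2^-1.
Proof.
move=> iN jN hw Lm.
pose J : pred 'I_EE := fun k => [exists q, i4 q == k].
have r0 : 0 < 2 ^+ rho :> R by rewrite exprn_gt0.
apply: le_trans (_ : _ <= Ex (fun w : Om => (weight w i j)%:R / 2 ^+ rho)) _.
  apply: le_trans (_ : Pr R (fun w : Om => ~~ same_win w i j) <= _).
    by apply: Pr_sub => w; apply: contraNN => /same_win_hash ->.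
  apply: (Pr_merge_Ex (cardV_gt0 m) (J := J)) => w.
  have cE w' := (resample4 w w').1; have r4 w' := (resample4 w w').2.
  have ex : (forall y, (wexp y <= m)%N) by move=> y; apply: leq_trans (leq_subr _ _) rho_le.
  have S := @grid_separate R _ m _ i4 (fun q : 'I_(Lv * n) => cnt w e q i)
    (fun q : 'I_(Lv * n) => cnt w e q j) (fun q : 'I_(Lv * n) => wexp q) (fun q => ex q).
  apply: le_trans (_ : _ <= \sum_(q < Lv * n)
      (ndist (cnt w e q i) (cnt w e q j))%:R / 2 ^+ wexp q) _.
    apply: le_trans S; apply: Pr_sub => w'; apply: contraNN => /forallP H.
    by apply/forallP => q; have := H q; rewrite /same_cell !cE r4.
  rewrite /weight natr_sum mulr_suml; apply: ler_sum => q _.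
  rewrite natrM natrX ler_pdivrMr ?exprn_gt0 // mulrAC ler_pdivlMr //.
  rewrite [2 ^+ _ * _]mulrC -mulrA ler_wpM2l // -exprD ler_weXn2l ?ler1n //.
  by rewrite -leq_subLR.
have [tau tE] := wdist_ex s dnat i j.
apply: le_trans (_ : _ <= (2 * Lv * wd i j)%:R / 2 ^+ rho) _; last first.
  rewrite ler_pdivrMr // mulrC ler_pdivlMr // -natrX -natrM ler_nat; lia.
rewrite (_ : Ex _ = (2 ^+ rho)^-1 * Ex (fun w : Om => (weight w i j)%:R)); last first.
  by rewrite -Ex_scale; apply: eq_Ex => w; rewrite mulrC.
rewrite mulrC; apply: ler_wpM2r; first by rewrite invr_ge0 (ltW r0).
apply: le_trans (_ : _ <= Ex (fun w : Om => \sum_(l < Lv) \sum_(k < s) (2 * 2 ^+ l) *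
   (point_label (pst w) base l (i + k) != point_label (pst w) base l (j + tau k))%:R)) _.
  apply: Ex_le => w; apply: le_trans (_ : (\sum_(l < Lv) 2 ^ l *
  (2 * \sum_(k < s) (point_label (pst w) base l (i + k)
                      != point_label (pst w) base l (j + tau k))))%N%:R <= _).
    by rewrite ler_nat weight_upper.
  rewrite natr_sum; apply: ler_sum => l _; rewrite !natrM natr_sum natrX mulrA mulr_sumr.
  by apply: ler_sum => k _; rewrite [2 * _]mulrC.
rewrite Ex_sum; under eq_bigr do rewrite Ex_sum.
have -> : (2 * Lv * wd i j)%:R = \sum_(l < Lv) \sum_(k < s)
    2 * (minn (dnat (i + k) (j + tau k)) s)%:R :> R.
  rewrite sumr_const card_ord -mulr_sumr -natr_sum -/(match_cost dnat i j tau) -tE.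
  by rewrite -[RHS]mulr_natr !natrM mulrAC.
apply: ler_sum => l _; apply: ler_sum => k _; rewrite Ex_scale -mulrA ler_pM2l //.
have l2 : 0 < 2 ^+ l :> R by rewrite exprn_gt0.
have ls : (2 ^ l <= s)%N.
  by apply: leq_trans (trunc_logP (leqnn 2) s_gt0); rewrite leq_exp2l // -ltnS.
have ik : (i + k < n)%N by have := ltn_ord k; move: iN le_sn; rewrite /vN; lia.
have jk : (j + tau k < n)%N by have := ltn_ord (tau k); move: jN le_sn; rewrite /vN; lia.
rewrite natr_min le_min; apply/andP; split.
  rewrite mulrC -ler_pdivlMr //; apply: pt_near => //.
  by apply: leq_trans Lm; apply: ltnW.
apply: le_trans (_ : 2 ^+ l * 1 <= _); first by rewrite ler_pM2l // Pr_le1 ?cardV_gt0.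
by rewrite mulr1 -natrX ler_nat.
Qed.

End Win.
End Class.

Local Notation t := (vt c n).
Local Notation RB := (vRB c n).

Lemma K_gt0 : (0 < K)%N.
Proof. by rewrite /vK /CK muln_gt0 L_gt0 addnS. Qed.

Lemma m_gt0 : (0 < m)%N.
Proof. by rewrite /vm /th muln_gt0 L_gt0. Qed.

Lemma Rn_gt0 : (0 < Rn)%N.
Proof. by rewrite /vRn muln_gt0 L_gt0. Qed.

Lemma E_gt0 : (0 < E)%N.
Proof. by rewrite /vE muln_gt0 Rn_gt0 K_gt0. Qed.

Lemma RB_gt0 : (0 < RB)%N.
Proof. by rewrite /vRB /CB /CK !muln_gt0 L_gt0 addnS. Qed.

Lemma t_gt0 : (0 < t)%N.
Proof. by rewrite /vt muln_gt0 RB_gt0 andbT muln_gt0 L_gt0. Qed.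

Lemma n_lt_pow : (n < 2 ^ L.+1)%N.
Proof. exact: trunc_log_ltn. Qed.

Lemma levels_le : (Lv <= L.+1)%N.
Proof. by rewrite /vLv ltnS leq_trunc_log. Qed.

Lemma N_le : (N <= n)%N.
Proof. by rewrite /vN; move: s_gt0 le_sn; lia. Qed.

Lemma rho_lt e : (e < E)%N -> (e %/ K < Rn)%N.
Proof. by rewrite ltn_divLR ?K_gt0. Qed.

Lemma Rn_le_m : (Rn <= m)%N.
Proof. by rewrite /vRn /vm leq_mul2r /th; apply/orP; right; lia. Qed.

Lemma levels_le_m : (Lv <= m)%N.
Proof. by apply: leq_trans levels_le _; rewrite /vm /th; have := L_gt0; nia. Qed.

Lemma class_labelE w e i : class_label (pst w) e i =
  if ((e %/ K).+1 < Rn)%N then hash_win e (e %/ K) w i else 0%N.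
Proof. by []. Qed.

Lemma class_weightE w e : class_weight (pst w) e =
  if (e %/ K == 0)%N then 0%N else (2 ^ (e %/ K))%N.
Proof. by []. Qed.

Lemma Pr_false : Pr R (fun _ : Om => false) = 0.
Proof. by rewrite /Pr Ex_cst ?cardV_gt0. Qed.

Definition bad_pt (w : Om) e l i j : bool :=
  (hash_pt w e l i == hash_pt w e l j) && ~~ same_pt w e l i j
  || same_pt w e l i j && (m * 2 ^ l <= dnat i j)%N.

Definition bad_win (w : Om) e i j : bool :=
  (hash_win e (e %/ K)%N w i == hash_win e (e %/ K)%N w j)
    && ~~ same_win e (e %/ K)%N w i j
  || same_win e (e %/ K)%N w i j && (m * 2 ^ (e %/ K) <= weight e w i j)%N.

(** Excluded for all points, windows and classes at once, since a shortest path may use any edge. *)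
Definition bad (w : Om) : bool :=
  [exists p : ('I_E * 'I_Lv) * ('I_n * 'I_n), bad_pt w p.1.1 p.1.2 p.2.1 p.2.2]
  || [exists p : 'I_E * ('I_N * 'I_N), bad_win w p.1 p.2.1 p.2.2].

Lemma not_bad w : ~~ bad w ->
  (forall e l i j, (e < E)%N -> (l < Lv)%N -> (i < n)%N -> (j < n)%N -> ~~ bad_pt w e l i j) /\
  (forall e i j, (e < E)%N -> (i < N)%N -> (j < N)%N -> ~~ bad_win w e i j).
Proof.
rewrite /bad negb_or => /andP[/existsPn H1 /existsPn H2]; split.
  move=> e l i j he hl hi hj.
  exact: (H1 ((Ordinal he, Ordinal hl), (Ordinal hi, Ordinal hj))).
by move=> e i j he hi hj; exact: (H2 (Ordinal he, (Ordinal hi, Ordinal hj))).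
Qed.

Lemma Pr_bad_pt e l i j : (e < E)%N -> (l <= m)%N ->
  Pr R (fun w : Om => bad_pt w e l i j) <= 2 * 2 ^- m.
Proof.
move=> eE lm; apply: le_trans (PrU R (fun w : Om => (hash_pt w e l i == hash_pt w e l j)
   && ~~ same_pt w e l i j) (fun w : Om => same_pt w e l i j && (m * 2 ^ l <= dnat i j)%N)) _.
rewrite mulr_natl mulr2n; apply: lerD; first exact: pt_collision.
have [far|near] := leqP (m * 2 ^ l) (dnat i j).
  by apply: le_trans (pt_far eE lm far); apply: Pr_sub => w /andP[].
apply: le_trans (_ : Pr R (fun _ : Om => false) <= _).
  by apply: Pr_sub => w /andP[_].
by rewrite Pr_false invr_ge0 exprn_ge0.
Qed.

Lemma Pr_bad_win e i j : (e < E)%N -> Pr R (fun w : Om => bad_win w e i j) <= 2 * 2 ^- m.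
Proof.
move=> eE; have rm : (e %/ K <= m)%N by apply: leq_trans Rn_le_m; apply/ltnW/rho_lt.
apply: le_trans (PrU R (fun w : Om => (hash_win e (e %/ K)%N w i == hash_win e (e %/ K)%N w j)
    && ~~ same_win e (e %/ K)%N w i j) (fun w : Om => same_win e (e %/ K)%N w i j
    && (m * 2 ^ (e %/ K) <= weight e w i j)%N)) _.
rewrite mulr_natl mulr2n; apply: lerD; first exact: win_collision.
exact: win_far.
Qed.

(** With [p = 2 ^ L] and [q = 2 ^ K] the left side is at most [192 * p ^ 5 * q ^ 2], and
    [192 <= 2 ^ 8 <= p ^ 8], which explains the 13 in [th]. *)
Lemma bad_count : ((E * Lv * (n * n) + E * (N * N)) * 2 * 2 ^ K <= 2 ^ m)%N.
Proof.
have L0 := L_gt0; set p := (2 ^ L)%N; set q := (2 ^ K)%N.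
have pL : (L <= p)%N by apply: ltnW; apply: ltn_expl.
have p2 : (2 <= p)%N by rewrite -{1}(expn1 2) leq_exp2l.
have qC : (CK c <= q)%N.
  apply: leq_trans (ltnW (ltn_expl (CK c) (leqnn 2))) _.
  by rewrite leq_exp2l // /vK leq_pmulr.
have E1 : (E <= 8 * (q * (p * p)))%N.
  apply: leq_trans (_ : 8 * (CK c * (L * L)) <= _)%N; first by rewrite /vE /vRn /vK; lia.
  by rewrite leq_mul2l /= leq_mul // leq_mul.
have nn : (n * n <= 4 * (p * p))%N.
  apply: leq_trans (_ : (2 * p) * (2 * p) <= _)%N; last by lia.
  by apply: leq_mul; rewrite -expnS ltnW // n_lt_pow.
have NN : (N * N <= n * n)%N by rewrite leq_mul // N_le.
have L3 : (Lv + 1 <= 3 * p)%N by have := levels_le; lia.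
have X1 : (E * Lv * (n * n) + E * (N * N) <= 8 * (q * (p * p)) * (3 * p) * (4 * (p * p)))%N.
  apply: leq_trans (_ : E * (Lv + 1) * (n * n) <= _)%N.
    by rewrite mulnDr muln1 mulnDl leq_add2l leq_mul2l NN orbT.
  by apply: leq_mul => //; apply: leq_mul.
have -> : (2 ^ m = p ^ 13 * (q * q))%N.
  by rewrite /p /q -expnM -!expnD; congr (2 ^ _)%N; rewrite /vm /th /vK; lia.
apply: leq_trans (_ : (8 * (q * (p * p)) * (3 * p) * (4 * (p * p))) * 2 * q <= _)%N.
  by rewrite !leq_mul2r X1 !orbT.
have -> : (8 * (q * (p * p)) * (3 * p) * (4 * (p * p)) * 2 * q = 192 * (p ^ 5 * (q * q)))%N.
  by rewrite !expnS expn0; lia.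
rewrite (expnD p 8 5) -mulnA; apply: leq_mul => //.
by apply: leq_trans (_ : 2 ^ 8 <= _)%N => //; rewrite leq_exp2r.
Qed.

Lemma Pr_bad : Pr R bad <= 2 ^- K.
Proof.
apply: le_trans (PrU R (fun w : Om => [exists p : ('I_E * 'I_Lv) * ('I_n * 'I_n),
   bad_pt w p.1.1 p.1.2 p.2.1 p.2.2]) (fun w : Om => [exists p : 'I_E * ('I_N * 'I_N),
   bad_win w p.1 p.2.1 p.2.2])) _.
apply: le_trans (_ : (E * Lv * (n * n))%:R * (2 * 2 ^- m) + (E * (N * N))%:R * (2 * 2 ^- m) <= _).
  apply: lerD.
    apply: le_trans (Pr_exists_le (cardV_gt0 m) (p := 2 * 2 ^- m) _) _.
      move=> p; apply: Pr_bad_pt => //; apply: leq_trans levels_le_m; exact: ltnW.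
    by rewrite !card_prod !card_ord.
  apply: le_trans (Pr_exists_le (cardV_gt0 m) (p := 2 * 2 ^- m) _) _.
    by move=> p; apply: Pr_bad_win.
  by rewrite !card_prod !card_ord.
rewrite -mulrDl -natrD mulrA -(natrM _ _ 2) ler_pdivrMr ?exprn_gt0 // [2 ^- _ * _]mulrC.
rewrite ler_pdivlMr ?exprn_gt0 // -!natrX -natrM ler_nat; exact: bad_count.
Qed.

Lemma label_hash w e l i j : (i < n)%N -> (j < n)%N ->
  (point_label (pst w) (e * str) l i == point_label (pst w) (e * str) l j) =
  (hash_pt w e l i == hash_pt w e l j).
Proof. by move=> iN jN; exact: last_labelP. Qed.

Lemma same_pt_up w e l i j : same_pt w e l i j -> same_pt w e l.+1 i j.
Proof.
by move=> /forallP H; apply/forallP => k; rewrite expnSr !divnMA (eqP (H k)).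
Qed.

Lemma same_pt0 w e i j : same_pt w e 0 i j -> dnat i j = 0%N.
Proof.
move=> /forallP H; rewrite /dnat big1 // => k _; have := H k.
by rewrite expn0 !divn1 eqn_add2r => /eqP->; rewrite /ndist subnn.
Qed.

Lemma weightE w e i j : weight e w i j = (\sum_(l < Lv) \sum_(g < n) 2 ^ l *
  ndist (wcount s (point_label (pst w) (e * str) l) g i)
        (wcount s (point_label (pst w) (e * str) l) g j))%N.
Proof.
exact: (sum_divmod (fun l g => 2 ^ l * ndist (wcount s (point_label (pst w) (e * str) l) g i)
        (wcount s (point_label (pst w) (e * str) l) g j))%N Lv).
Qed.

Lemma window_lt i p : (i < N)%N -> p \in iota i s -> (p < n)%N.
Proof. by rewrite mem_iota => iN /andP[_ h]; move: iN h le_sn; rewrite /vN; lia. Qed.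

(** A pair first sharing a cell at level [l + 1] is closer than [m * 2 ^ l.+1] and is charged to
    level [l], where it is still separated. Sharing a cell at level 0 means distance 0, and a pair
    never together pays at most [s], charged to the last level. So [wdist_lower] applies with these
    weights, and equal hashes keep the weight below [m * 2 ^ rho]. *)
Lemma hash_wd w e i j : ~~ bad w -> (e < E)%N -> (i < N)%N -> (j < N)%N ->
  hash_win e (e %/ K)%N w i = hash_win e (e %/ K)%N w j ->
  (wd i j <= 2 * m * m * (if e %/ K == 0 then 0 else 2 ^ (e %/ K)))%N.
Proof.
move=> /not_bad[B1 B2] eE iN jN hE.
have := B2 e i j eE iN jN; rewrite /bad_win hE eqxx /= negb_or negbK => /andP[sw].
rewrite sw /= -ltnNge; set rho := (e %/ K)%N in hE sw * => wl.
pose lab l p := point_label (pst w) (e * str) l p.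
have hs l p q : (l < Lv)%N -> (p < n)%N -> (q < n)%N -> lab l p = lab l q ->
    same_pt w e l p q /\ (dnat p q < m * 2 ^ l)%N.
  move=> lL pn qn /eqP; rewrite /lab label_hash // => h.
  have := B1 e l p q eE lL pn qn; rewrite /bad_pt h /= negb_or negbK => /andP[sp].
  by rewrite sp /= -ltnNge.
have bound : (wd i j <= 2 * m * weight e w i j)%N.
  apply: leq_trans (_ : \sum_(l < Lv) (m * 2 ^ l.+1) *
     \sum_(g < n) ndist (wcount s (lab l) g i) (wcount s (lab l) g j) <= _)%N.
    apply: (@wdist_lower s dnat lab Lv n (fun l => m * 2 ^ l.+1)%N).
    - by move=> l p; apply: last_label_lt; exact: n_pos.
    - have wl2 p : p \in iota i s ++ iota j s -> (p < n)%N.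
        by rewrite mem_cat => /orP[|]; apply: window_lt.
      move=> l p q lL /wl2 pn /wl2 qn /(hs l p q (ltnW lL) pn qn)[sp _].
      by apply/eqP; rewrite /lab label_hash //; apply/eqP/same_pt_hash/same_pt_up.
    - move=> p q /(window_lt iN) pn /(window_lt jN) qn.
      have [/existsP[l0 ll]|/existsPn no] := boolP [exists l : 'I_Lv, lab l p == lab l q].
        have ex : exists l, (l < Lv)%N && (lab l p == lab l q) by exists l0; rewrite ltn_ord.
        case: (ex_minnP ex) => l /andP[lL /eqP le] lmin.
        have [sp dl] := hs l p q lL pn qn le.
        case: l lL le lmin sp dl => [|l] lL le lmin sp dl.
          by rewrite (same_pt0 sp) min0n.
        have ll' : (l < Lv)%N by exact: ltnW.
        have nl : lab l p != lab l q.
          by apply/negP => h; have := lmin l; rewrite ll' h ltnn => /(_ isT).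
        rewrite (bigD1 (Ordinal ll')) //= nl muln1; apply: leq_trans (leq_addr _ _).
        exact: leq_trans (geq_minl _ _) (ltnW dl).
      have tl : (trunc_log 2 s < Lv)%N by [].
      have nt : lab (trunc_log 2 s) p != lab (trunc_log 2 s) q := no (Ordinal tl).
      rewrite (bigD1 (Ordinal tl)) //= nt muln1; apply: leq_trans (leq_addr _ _).
      apply: leq_trans (geq_minr _ _) _.
      apply: leq_trans (ltnW (trunc_log_ltn s (leqnn 2))) _.
      by apply: leq_pmull; exact: m_gt0.
  rewrite weightE big_distrr /=; apply: leq_sum => l _.
  have -> : (\sum_(g < n) 2 ^ l * ndist (wcount s (point_label (pst w) (e * str) l) g i)
        (wcount s (point_label (pst w) (e * str) l) g j) =
     2 ^ l * \sum_(g < n) ndist (wcount s (lab l) g i) (wcount s (lab l) g j))%N.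
    by rewrite big_distrr.
  by rewrite expnS; move: (2 ^ l)%N (\sum_(g < n) _)%N (vm c n) => a a' a''; lia.
(* At scale 0 all counts agree exactly, as an edge of length 0 demands. *)
have [r0|r0] := eqVneq rho 0%N.
  have W0 : weight e w i j = 0%N.
    by rewrite /weight big1 // => y _; rewrite (same_win_low sw) ?r0 ?muln0.
  by move: bound; rewrite W0 /= !muln0.
apply: leq_trans bound _.
by rewrite -[X in (_ <= X)%N]mulnA leq_mul2l (ltnW wl) orbT.
Qed.

(** In a class of the top scale all labels agree, and the crude bound [s * s] is below the edge
    length. *)
Lemma label_wd w e i j : ~~ bad w -> (e < E)%N -> (i < N)%N -> (j < N)%N ->
  class_label (pst w) e i = class_label (pst w) e j ->
  (wd i j <= 2 * m * m * class_weight (pst w) e)%N.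
Proof.
move=> nb eE iN jN; rewrite !class_labelE class_weightE.
case: ifP => [_|/negbT]; first exact: hash_wd.
rewrite -leqNgt => top _; have L0 := L_gt0.
have r0 : (e %/ K == 0)%N = false by apply/negbTE; rewrite -lt0n; move: top; rewrite /vRn; lia.
rewrite r0; apply: leq_trans (wdist_max _ _ _ _) _.
apply: leq_trans (_ : 2 ^ (e %/ K) <= _)%N; last first.
  by rewrite leq_pmull // muln_gt0 m_gt0 andbT muln_gt0 m_gt0.
apply: leq_trans (_ : 2 ^ (2 * L.+1) <= _)%N.
  rewrite mul2n -addnn expnD.
  by apply: leq_mul; apply: leq_trans le_sn _; apply: ltnW n_lt_pow.
by rewrite leq_exp2l //; move: top; rewrite /vRn; lia.
Qed.

Lemma wd0 i : wd i i = 0%N.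
Proof.
by apply: wdist0 => k; rewrite /dnat big1 // => q _; rewrite /ndist subnn.
Qed.

Lemma wdT i j k : (wd i k <= wd i j + wd j k)%N.
Proof.
apply: wdistT => p q r; rewrite /dnat -big_split /=; apply: leq_sum => a _.
by rewrite /ndist; lia.
Qed.

Definition class_greatest (w : Om) (S : {set 'I_N}) (f : nat -> nat) :=
  greatest_lip E (class_label (pst w)) (class_weight (pst w)) S f.

(** Off the bad event [wd i z] divided by [2 * m * m], rounded up, is a potential vanishing at [i];
    maximality of [d i] applies. *)
Lemma lip_lower w (d : 'I_N -> nat -> nat) (i j : 'I_N) : ~~ bad w ->
  (forall y, class_greatest w [set y] (d y)) -> (wd i j <= 2 * m * m * d i j)%N.
Proof.
move=> nb dP; set lam := (2 * m * m)%N.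
have lam0 : (0 < lam)%N by rewrite /lam muln_gt0 m_gt0 andbT muln_gt0 m_gt0.
pose g z := ((wd i z + lam.-1) %/ lam)%N.
have gl : lip N E (class_label (pst w)) (class_weight (pst w)) g.
  move=> e a a' eE aN a'N lE; rewrite /g.
  have h : (wd i a <= wd i a' + lam * class_weight (pst w) e)%N.
    by apply: leq_trans (wdT i a' a) _; rewrite leq_add2l; apply: label_wd.
  have h' : (wd i a + lam.-1 <= class_weight (pst w) e * lam + (wd i a' + lam.-1))%N.
    by rewrite [(class_weight _ _ * lam)%N]mulnC; move: h; lia.
  by apply: leq_trans (leq_div2r lam h') _; rewrite divnMDl // addnC.
have gi (y : 'I_N) : y \in [set i] -> g y = 0%N.
  by rewrite inE => /eqP->; rewrite /g wd0 add0n divn_small // ltn_predL.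
have [_ _ mx] := dP i; have gj := mx g gl gi j (ltn_ord j).
have := ltn_ceil (wd i j + lam.-1) lam0; rewrite -/(g j) mulSn => h.
apply: leq_trans (_ : lam * g j <= _)%N; last by rewrite leq_mul2l gj orbT.
by rewrite mulnC; lia.
Qed.

Lemma dist_exists w : exists d : 'I_N -> nat -> nat, forall y, class_greatest w [set y] (d y).
Proof.
apply: (@greatest_exists N E _ _ E.-1); first by rewrite ltn_predL E_gt0.
have top : ((E.-1 %/ K).+1 < Rn)%N = false.
  apply/negbTE; rewrite -leqNgt.
  have h : (Rn.-1 <= E.-1 %/ K)%N.
    rewrite leq_divRL ?K_gt0 // /vE; move: Rn_gt0 K_gt0.
    by case: (vRn n) (vK c n) => [|a] [|k] // _ _; rewrite mulSn addSn; exact: leq_addl.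
  by move: h Rn_gt0; lia.
by move=> i j _ _; rewrite !class_labelE top.
Qed.

Lemma rn_eq (w w' : Om) k :
  (forall h : (k < EE)%N, w (Ordinal h) = w' (Ordinal h)) -> rn w k = rn w' k.
Proof.
move=> H; case: (ltnP k EE) => h; last by rewrite /rn !insubN // -leqNgt.
by rewrite !(rnE _ h) H.
Qed.

Lemma hash_win_local e rho (w w' : Om) i :
  (forall q, (q < str)%N -> rn w (e * str + q) = rn w' (e * str + q)) ->
  hash_win e rho w i = hash_win e rho w' i.
Proof.
move=> H; rewrite !hash_winE; apply: eq_bigr => y _; have yl := ltn_ord y.
have cE : cnt w e =2 cnt w' e.
  by apply: cnt_local => k kl; apply: H; rewrite /vstr; lia.
have r3 : rn w (e * str + 2 * al + y) = rn w' (e * str + 2 * al + y).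
  by rewrite -addnA H // /vstr /vLvn; lia.
have r4 : rn w (e * str + 2 * al + Lv * n + y) = rn w' (e * str + 2 * al + Lv * n + y).
  have -> : (e * str + 2 * al + Lv * n + y = e * str + (2 * al + Lv * n + y))%N by rewrite !addnA.
  by apply: H; rewrite /vstr /vLvn -addnA ltn_add2l [(2 * (_ * _))%N]mul2n -addnn ltn_add2l.
by rewrite cE r3 r4.
Qed.

Lemma scale_exists i j : (i < N)%N -> (j < N)%N -> exists rho, [/\ (rho < Rn)%N,
  (4 * Lv * wd i j <= 2 ^ rho)%N & ((if rho == 0 then 0 else 2 ^ rho) <= 8 * Lv * wd i j)%N].
Proof.
move=> iN jN; have L0 := L_gt0.
have [w0|w0] := eqVneq (wd i j) 0%N.
  by exists 0%N; rewrite w0 !muln0; split=> //; exact: Rn_gt0.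
have LW : (0 < Lv * wd i j)%N by rewrite muln_gt0 andbC lt0n w0.
have w1 : (1 < 4 * Lv * wd i j)%N by rewrite -mulnA; move: LW; lia.
have := up_log_bounds (leqnn 2) w1; rewrite /=; set k := up_log _ _ => /andP[u1 u2].
exists k; split=> //.
- have bd : (4 * Lv * wd i j <= 2 ^ Rn.-1)%N.
    apply: leq_trans (_ : 2 ^ 2 * 2 ^ L * (2 ^ L.+1 * 2 ^ L.+1) <= _)%N.
      apply: leq_mul.
        by apply: leq_mul => //; apply: leq_trans levels_le _; apply: ltn_expl.
      apply: leq_trans (wdist_max _ _ _ _) _.
      by apply: leq_mul; apply: leq_trans le_sn _; apply: ltnW n_lt_pow.
    by rewrite -!expnD leq_exp2l // /vRn; lia.
  apply: leq_ltn_trans (up_log_min (leqnn 2) bd) _.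
  by rewrite ltn_predL Rn_gt0.
case: eqP => [//|/eqP k0].
have kE : (2 ^ k = 2 * 2 ^ k.-1)%N by rewrite -expnS prednK // lt0n.
rewrite kE; move: u1; set z := (2 ^ k.-1)%N => u1.
by rewrite -mulnA; move: u1; rewrite -mulnA; lia.
Qed.

(** The [K] repetitions at the scale fitting the pair read disjoint blocks of words and each fails
    with probability at most 1/2. *)
Lemma near_class i j : (i < N)%N -> (j < N)%N ->
  Pr R (fun w : Om => ~~ [exists e : 'I_E,
    (class_label (pst w) e i == class_label (pst w) e j) &&
    (class_weight (pst w) e <= 8 * Lv * wd i j)%N]) <= 2 ^- K.
Proof.
move=> iN jN; have [rho [rR hw wb]] := scale_exists iN jN.
have rm : (rho <= m)%N by apply: leq_trans Rn_le_m; exact: ltnW.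
have eE k : (k < K)%N -> (rho * K + k < E)%N.
  move=> kK; apply: leq_trans (_ : rho.+1 * K <= _)%N; first by rewrite mulSnr ltn_add2l.
  by rewrite leq_mul2r rR orbT.
have eK k : (k < K)%N -> ((rho * K + k) %/ K = rho)%N.
  by move=> kK; rewrite divnMDl ?K_gt0 // divn_small // addn0.
pose B (k : nat) : pred 'I_EE := fun q => (q %/ str == rho * K + k)%N.
pose F (k : nat) (w : Om) : bool :=
  hash_win (rho * K + k)%N rho w i != hash_win (rho * K + k)%N rho w j.
have S : Pr R (fun w => all (fun k => F k w) (iota 0 K)) <= (2^-1) ^+ size (iota 0 K).
  apply: (Pr_blocks (cardV_gt0 m) (B := B)); rewrite ?iota_uniq ?invr_ge0 //.
  - by move=> z z' q zz /eqP qz; rewrite /B qz eqn_add2l.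
  - move=> z w w' H; have rE q : (q < str)%N ->
        rn w ((rho * K + z) * str + q) = rn w' ((rho * K + z) * str + q).
      move=> qs; apply: rn_eq => h; apply: H; rewrite /B /=.
      by rewrite divnMDl ?(leq_ltn_trans _ qs) // divn_small // addn0.
    by rewrite /F !(hash_win_local _ _ rE).
  - move=> z; rewrite mem_iota add0n => /= zK.
    exact: (win_near (eE z zK) rm iN jN hw levels_le_m).
move: S; rewrite size_iota exprVn => S; apply: le_trans S; apply: Pr_sub => w /existsPn H.
have H' e : (e < E)%N -> ~~ ((class_label (pst w) e i == class_label (pst w) e j) &&
    (class_weight (pst w) e <= 8 * Lv * wd i j)%N) by move=> h; exact: (H (Ordinal h)).
apply/allP => k; rewrite mem_iota add0n => /= kK; have := H' _ (eE k kK).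
rewrite class_weightE !class_labelE eK // wb andbT.
by case: ifP => _ //; rewrite eqxx.
Qed.

(** The graph is determined by the hashing words, so seed words can be resampled with the metric
    frozen. *)
Lemma greatest_lip_local (w w' : Om) S f :
  (forall q, (q < E * str)%N -> rn w q = rn w' q) ->
  class_greatest w S f -> class_greatest w' S f.
Proof.
move=> H.
have lE e i : (e < E)%N -> class_label (pst w) e i = class_label (pst w') e i.
  move=> eE; rewrite !class_labelE; case: ifP => // _; apply: hash_win_local => q qs.
  apply: H; apply: leq_trans (_ : e.+1 * str <= _)%N; first by rewrite mulSnr ltn_add2l.
  by rewrite leq_mul2r eE orbT.
have wE e : class_weight (pst w) e = class_weight (pst w') e by [].
have lp g : lip N E (class_label (pst w)) (class_weight (pst w)) g <->
    lip N E (class_label (pst w')) (class_weight (pst w')) g.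
  split=> G e i j eE iN jN h.
    by rewrite -wE; apply: (G e i j eE iN jN); rewrite !lE.
  by rewrite wE; apply: (G e i j eE iN jN); rewrite -!lE.
by case=> h1 h2 h3; split=> [|//|g /lp gl]; [exact/lp | exact: h3].
Qed.

(** Stated for every [d] with the defining property, which fixes distances only below [N]. *)
Definition separated (w : Om) (i j : 'I_N) (z : nat) : bool := boolp.asbool
  (forall d : 'I_N -> nat -> nat, (forall y, class_greatest w [set y] (d y)) ->
   d i j = 0%N \/ (ideal_seeds c n s al (rn w) z != finset.set0 /\
     forall f, class_greatest w (ideal_seeds c n s al (rn w) z) f ->
       (d i j <= 2 * (2 * L) * ndist (f i) (f j))%N)).

Lemma pow47_le : (47 / 48 : R) ^+ RB <= 2 ^- K.
Proof.
have h : 47 / 48 <= expR (- 48^-1) :> R by have := expR_ge1Dx (- 48^-1 : R); lra.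
apply: le_trans (_ : expR (- 48^-1) ^+ RB <= _).
  by apply: lerXn2r => //; rewrite nnegrE ?expR_ge0 //; lra.
rewrite -expRM_natl (_ : RB%:R * - 48^-1 = - K%:R); first exact: expR_pow2.
have -> : RB = (48 * K)%N by rewrite /vRB /CB /vK mulnA.
by rewrite natrM mulrN mulrAC divff ?mul1r // pnatr_eq0.
Qed.

(** With the hashing words frozen, the two balls and their density [h] are fixed. The [RB] seed sets
    of that density read disjoint words, and each separates the pair with probability at least
    1/48. *)
Lemma seeds_separate (i j : 'I_N) :
  Pr R (fun w : Om => ~~ [exists z : 'I_t, separated w i j z]) <= 2 ^- K.
Proof.
pose J : pred 'I_EE := fun q => (E * str <= q)%N; have L0 := L_gt0.
apply: (Pr_merge_le (cardV_gt0 m) (J := J)) => w.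
have loc w' q : (q < E * str)%N -> rn (merge J w w') q = rn w q.
  by move=> qE; apply: rn_merge_out => h; rewrite /J -ltnNge.
have [d dP] := dist_exists w.
have tr w' S f : class_greatest (merge J w w') S f -> class_greatest w S f.
  by apply: greatest_lip_local => q; exact: loc.
have dE w' d' : (forall y, class_greatest (merge J w w') [set y] (d' y)) -> d' i j = d i j.
  move=> d'P; have [a1 a2 a3] := dP i; have [b1 b2 b3] := tr _ _ _ (d'P i).
  by apply/eqP; rewrite eqn_leq (a3 _ b1 b2 _ (ltn_ord j)) (b3 _ a1 a2 _ (ltn_ord j)).
have [d0|d0] := posnP (d i j).
  apply: le_trans (_ : Pr R (fun _ : Om => false) <= _); last first.
    by rewrite Pr_false invr_ge0 exprn_ge0.
  apply: Pr_sub => w' /existsPn /(_ (Ordinal t_gt0)) /negP []; apply/boolp.asboolP => d' d'P.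
  by left; rewrite (dE w').
(* Bourgain's radii are used with [Q = 2 * L], the source of the factor in [separated]. *)
have NQ : (N < 2 ^ (2 * L))%N.
  apply: leq_ltn_trans N_le _; apply: leq_trans n_lt_pow _; rewrite leq_exp2l //; lia.
have [h [Ba [Bb [h1 h2 h3 h4 h5]]]] := separating_balls dP NQ d0.
have hL : (h < L.+1)%N.
  rewrite -(ltn_exp2l _ _ (ltnSn 1)); apply: leq_ltn_trans h1 _.
  by apply: leq_ltn_trans N_le n_lt_pow.
have hm : (h < m)%N.
  by apply: leq_trans hL _; apply: leq_trans Rn_le_m; rewrite /vRn; lia.
have zt (r : 'I_RB) : (h * RB + r < t)%N.
  apply: leq_trans (_ : h.+1 * RB <= _)%N; first by rewrite mulSnr ltn_add2l.
  by rewrite /vt leq_mul2r; apply/orP; right; lia.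
have idx (r : 'I_RB) (q : 'I_N) : (E * str + (h * RB + r) * N + q < EE)%N.
  rewrite /vEE -addnA ltn_add2l; apply: leq_trans (_ : (h * RB + r).+1 * N <= _)%N.
    by rewrite mulSnr ltn_add2l.
  by rewrite leq_mul2r zt orbT.
pose f r q := Ordinal (idx r q).
have f_inj r : injective (f r) by move=> q q' /(congr1 val) /= /addnI /val_inj.
pose good r (w' : Om) := ~~ [disjoint rset (f r) h.+1 w' & Ba]
   && [disjoint rset (f r) h.+1 w' & Bb].
pose B (r : 'I_RB) : pred 'I_EE :=
  fun q => (E * str <= q)%N && ((q - E * str) %/ N == h * RB + r)%N.
have S : Pr R (fun w' => all (fun r => ~~ good r w') (enum 'I_RB))
    <= (47 / 48) ^+ size (enum 'I_RB).
  apply: (Pr_blocks (cardV_gt0 m) (B := B)); rewrite ?enum_uniq //; first lra.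
  - move=> z z' q zz /andP[_ /eqP qz]; rewrite /B qz eqn_add2l negb_and.
    by apply/orP; right; apply: contraNneq zz => e; apply/eqP/val_inj.
  - move=> z w1 w2 H; rewrite /good.
    have -> // : rset (f z) h.+1 w1 = rset (f z) h.+1 w2.
    apply/setP => q; rewrite !inE H // /B /f /= -addnA leq_addr addKn divnMDl //.
    by rewrite divn_small ?addn0 ?eqxx.
  - move=> z _; apply: le_trans (_ : Pr R (fun w' => ~~ good z w') <= _); first exact: lexx.
    have gE : 48^-1 <= Pr R (good z) := Pr_rset_good R (f_inj z) hm h2 h3 h4.
    by move: gE; rewrite (PrC R (cardV_gt0 m) (good z)); lra.
move: S; rewrite size_enum_ord => S; apply: le_trans pow47_le; apply: le_trans S.
apply: Pr_sub => w' /existsPn H; apply/allP => r _; apply/negP => /andP[g1 g2].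
have sE : ideal_seeds c n s al (rn (merge J w w')) (h * RB + r) = rset (f r) h.+1 w'.
  apply/setP => q; rewrite !inE divnMDl ?RB_gt0 // divn_small // addn0.
  by rewrite (rnE _ (idx r q)) ffunE ifT // /J /= -addnA leq_addr.
have H' z : (z < t)%N -> ~~ separated (merge J w w') i j z.
  by move=> zl; exact: (H (Ordinal zl)).
have /negP[] := H' _ (zt r); apply/boolp.asboolP => d' d'P; right.
rewrite sE (dE w') //; split.
  by apply: contraNneq g1 => ->; rewrite -setI_eq0 set0I.
by move=> f0 f0P; apply: h5 (tr _ _ _ f0P) g1 g2.
Qed.

(** Quantifying over all coordinates that meet the specification makes this an event on the words
    alone, free of the machine. *)
Definition good (w : Om) (i j : 'I_N) : bool := boolp.asbool
  (forall D : nat -> nat -> nat,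
   (forall z, (z < t)%N ->
      ideal_spec b c n s al (init_state b c s M v [::]) (rn w) z (D z)) ->
   (wd i j <= vF c n * \sum_(z < t) ndist (D z i) (D z j))%N /\
   (\sum_(z < t) ndist (D z i) (D z j) <= t * (8 * Lv * wd i j))%N).

(** Above: each coordinate is 1-Lipschitz in the graph metric, where the pair has an edge of length
    at most [8 * Lv * wd i j]. Below: a single separating coordinate suffices. *)
Lemma not_bad_good (w : Om) (i j : 'I_N) : ~~ bad w ->
  [exists e : 'I_E, (class_label (pst w) e i == class_label (pst w) e j) &&
    (class_weight (pst w) e <= 8 * Lv * wd i j)%N] ->
  [exists z : 'I_t, separated w i j z] -> good w i j.
Proof.
move=> nb /existsP[e /andP[/eqP le we]] /existsP[z /boolp.asboolP sz].
have [d dP] := dist_exists w; apply/boolp.asboolP => D DP.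
have dU : (d i j <= 8 * Lv * wd i j)%N.
  have [lp d0 _] := dP i; apply: leq_trans we.
  have := lp e j i (ltn_ord e) (ltn_ord j) (ltn_ord i) (esym le).
  by rewrite (d0 i) ?inE.
have each z0 : (z0 < t)%N -> (ndist (D z0 i) (D z0 j) <= d i j)%N.
  move=> zt; have [h1 h2] := DP z0 zt.
  have [s0|s0] := eqVneq (ideal_seeds c n s al (rn w) z0) finset.set0.
    by rewrite !h2.
  have [[lp _ _] pos] := h1 s0.
  have a := lip_d dP i j lp; have a' := lip_d dP j i lp; rewrite (d_sym dP j i) in a'.
  have pi := pos i (ltn_ord i); have pj := pos j (ltn_ord j).
  by move: a a' pi pj; rewrite /ndist /=; lia.
split; last first.
  apply: (@leq_trans (\sum_(z0 < t) (8 * Lv * wd i j))%N).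
    by apply: leq_sum => z0 _; apply: leq_trans dU; apply: each.
  by rewrite sum_nat_const card_ord.
have lo := lip_lower i j nb dP.
case: (sz d dP) => [d0|[s0 Hs]].
  by move: lo; rewrite d0 muln0 leqn0 => /eqP->.
have [h1 _] := DP z (ltn_ord z); have [gl pos] := h1 s0; have := Hs _ gl => /= hh.
have nd : ndist (D z i).-1 (D z j).-1 = ndist (D z i) (D z j).
  by have := pos i (ltn_ord i); have := pos j (ltn_ord j); rewrite /ndist; lia.
apply: leq_trans lo _.
apply: leq_trans (_ : 2 * m * m * (2 * (2 * L) * ndist (D z i) (D z j)) <= _)%N.
  by rewrite leq_mul2l -nd hh orbT.
rewrite mulnA (_ : 2 * m * m * (2 * (2 * L)) = vF c n)%N; last first.
  by rewrite /vF /CF /vm -mulnn; lia.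
by rewrite leq_mul2l (bigD1 z) //= leq_addr orbT.
Qed.

Lemma Pr_good (i j : 'I_N) : 1 - 3 * 2 ^- K <= Pr R (fun w : Om => good w i j).
Proof.
rewrite (PrC R (cardV_gt0 m)) lerD2l lerN2.
pose A (w : Om) := ~~ [exists e : 'I_E, (class_label (pst w) e i == class_label (pst w) e j) &&
    (class_weight (pst w) e <= 8 * Lv * wd i j)%N].
pose B (w : Om) := ~~ [exists z : 'I_t, separated w i j z].
apply: le_trans (_ : Pr R (fun w : Om => bad w || (A w || B w)) <= _).
  apply: Pr_sub => w; apply: contraNT; rewrite negb_or => /andP[nb].
  rewrite /A /B negb_or !negbK => /andP[ne sz].
  exact: not_bad_good.
apply: le_trans (PrU R bad (fun w => A w || B w)) _.
have -> : 3 * 2 ^- K = 2 ^- K + (2 ^- K + 2 ^- K) :> R by ring.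
apply: lerD; first exact: Pr_bad.
apply: le_trans (PrU R A B) _; apply: lerD; first exact: near_class.
exact: seeds_separate.
Qed.

End Hashing.

(** * Coins, probabilities and real bounds *)

Local Open Scope ring_scope.

Lemma bits_val_inj (f g : nat -> nat) o k : (forall i, (f i < 2)%N) -> (forall i, (g i < 2)%N) ->
  bits_val f o k = bits_val g o k -> forall q, (q < k)%N -> f (o + q)%N = g (o + q)%N.
Proof.
move=> f2 g2; elim: k => [//|k IH] /= h q; have := f2 (o + k)%N; have := g2 (o + k)%N.
move=> hg hf; rewrite ltnS leq_eqVlt => /orP[/eqP->|qk]; first by lia.
by apply: IH => //; lia.
Qed.

Section Coins.
Variables (R : realType) (EE m T : nat).
Hypothesis hT : (EE * m <= T)%N.
Local Notation Om := {ffun 'I_EE -> 'I_(2 ^ m)}.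

Lemma bit_lt2 (r : seq bool) i : ((nth false r i : nat) < 2)%N.
Proof. by case: (nth _ _ _). Qed.

Definition word_of (r : T.-tuple bool) : Om :=
  [ffun k : 'I_EE => Ordinal (bits_val_lt (k * m) m (bit_lt2 r))].

(** Coin sequences correspond bijectively to the words together with the leftover bits, so the words
    are uniform. *)
Lemma prob_words (Q : pred Om) :
  prob R (fun r : T.-tuple bool => Q (word_of r)) = Pr R Q.
Proof.
pose U := (T - EE * m)%N.
pose psi (r : T.-tuple bool) : Om * {ffun 'I_U -> bool} :=
  (word_of r, [ffun k : 'I_U => nth false r (EE * m + k)]).
have inj : injective psi.
  move=> r r' e; have /ffunP hw := congr1 fst e; have /ffunP hu := congr1 snd e.
  apply: val_inj; apply: (@eq_from_nth _ false); rewrite ?size_tuple // => q qT.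
  case: (ltnP q (EE * m)) => qE.
    have m0 : (0 < m)%N by rewrite lt0n; apply: contraTneq qE => ->; rewrite muln0.
    have kE : (q %/ m < EE)%N by rewrite ltn_divLR.
    have := hw (Ordinal kE); rewrite /= !ffunE => /(congr1 val) /= h.
    have := bits_val_inj (bit_lt2 r) (bit_lt2 r') h (ltn_pmod q m0); rewrite -divn_eq.
    by case: (nth _ _ _); case: (nth _ _ _).
  have kU : (q - EE * m < U)%N by rewrite /U; lia.
  by have := hu (Ordinal kU); rewrite /= !ffunE /= subnKC.
have cd : (#|{: Om * {ffun 'I_U -> bool}}| <= #|{: T.-tuple bool}|)%N.
  rewrite card_prod !card_ffun !card_ord card_tuple card_bool -expnM -expnD leq_exp2l //.
  by rewrite [(m * EE)%N]mulnC /U subnKC.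
have bij := inj_card_bij inj cd.
have cE : #|(fun r : T.-tuple bool => Q (word_of r))|%:R =
    \sum_(r : T.-tuple bool) (Q (word_of r))%:R :> R.
  rewrite -sum1_card natr_sum big_mkcond /=; apply: eq_bigr => r _.
  by rewrite unfold_in /=; case: (Q _).
have sE : \sum_(r : T.-tuple bool) (Q (word_of r))%:R =
    \sum_(p : Om * {ffun 'I_U -> bool}) (Q p.1)%:R :> R.
  by rewrite [RHS](reindex psi) //; apply: onW_bij.
rewrite /prob /Pr /Ex cE sE -(pair_big xpredT xpredT (fun w _ => (Q w)%:R)) /=.
have inner w : \sum_(u : {ffun 'I_U -> bool}) (Q w)%:R = (Q w)%:R * 2 ^+ U :> R.
  by rewrite sumr_const -[LHS]mulr_natr card_ffun card_bool card_ord natrX.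
under eq_bigr do rewrite inner.
rewrite -mulr_suml card_ffun !card_ord !natrX -exprM -mulrA; congr (_ * _).
have -> : 2 ^+ T = 2 ^+ U * 2 ^+ (m * EE) :> R.
  by rewrite -exprD; congr (_ ^+ _); rewrite /U [(m * EE)%N]mulnC subnK.
by rewrite invfM mulrA divff ?mul1r // expf_neq0 // pnatr_eq0.
Qed.

Lemma prob_sub (Q Q' : pred (T.-tuple bool)) : (forall r, Q r -> Q' r) ->
  prob R Q <= prob R Q'.
Proof.
move=> H; rewrite /prob ler_wpM2r ?invr_ge0 ?exprn_ge0 // ler_nat.
by apply: subset_leq_card; apply/subsetP => r; exact: H.
Qed.

End Coins.

Lemma iter_step_done k cf : cf_todo cf = [::] -> iter k step cf = cf.
Proof. by move=> h; elim: k => //= k ->; case: cf h => td mm r w /= ->. Qed.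

Definition run_time b c n s al : nat :=
  total_steps b c n s al + total_steps b c n s al *
    (8 * cmd_size (main_cmd b c) ^ 2 * (trunc_log 2 (bound_X b c n)).+1).

Lemma bound_X_gt1 b c n : (1 < bound_X b c n)%N.
Proof.
have gen (a a' : nat) : (1 < a + a' + 2)%N by lia.
exact: gen.
Qed.

Lemma cmd_const_le_bound_X b c n : (cmd_const (main_cmd b c) <= bound_X b c n)%N.
Proof.
have gen (a a' : nat) : (a' <= a + a' + 2)%N by lia.
exact: gen.
Qed.

(** The coins of all words are added to the running time, so that a single [T] bounds the time and
    supplies enough coins. *)
Lemma time_bound b c : exists C k, forall n s al, (0 < s)%N -> (s <= n)%N -> (0 < al)%N ->
  (al <= n)%N -> (run_time b c n s al + vEE c n s al * vm c n <= C * (n * al * (vL n).+1 ^ k))%N.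
Proof.
have [C1 [k1 H1]] := bO_total b c; have [_ _ _ _ [_ [C2 [k2 H2]]]] := bO_ns b c.
set G := (8 * cmd_size (main_cmd b c) ^ 2)%N.
set k0 := (cmd_const (main_cmd b c) + 2)%N; set D := (cap_exp b c + k0 + 1)%N.
exists (C1 * (1 + G * D) + C2 * th c)%N, (k1 + k2 + 1)%N => n s al s0 sn al0 aln.
have n0 : (0 < n)%N by exact: leq_trans sn.
have := H1 n s al s0 sn al0 aln; have := H2 n s al s0 sn al0 aln.
rewrite /run_time -/G; set tot := total_steps _ _ _ _ _; set Y := (vL n).+1.
rewrite -[pr b c 18 n s al]/(vEE c n s al) /bna => h2 h1.
have tl : ((trunc_log 2 (bound_X b c n)).+1 <= D * Y)%N.
  have nY : (n.+1 <= 2 ^ Y)%N by exact: trunc_log_ltn.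
  have X2 : (bound_X b c n <= 2 ^ (Y * cap_exp b c + k0))%N.
    rewrite /bound_X -addnA -/k0 expnD expnM.
    have c1 : (0 < vcap b c n)%N by rewrite /vcap expn_gt0.
    apply: leq_trans (_ : vcap b c n * 2 ^ k0 <= _)%N; last first.
      by rewrite leq_mul2r; apply/orP; right; rewrite /vcap leq_exp2r // /cap_exp addnS.
    apply: leq_trans (_ : vcap b c n * k0.+1 <= _)%N; first by rewrite mulnS leq_add2l leq_pmull.
    by rewrite leq_mul2l (ltn_expl k0 (leqnn 2)) orbT.
  have X0 : (0 < bound_X b c n)%N by apply: ltnW (bound_X_gt1 b c n).
  have := leq_trans (trunc_logP (leqnn 2) X0) X2; rewrite leq_exp2l // => h.
  apply: leq_ltn_trans h _; rewrite /D mulnC.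
  have ar (y a e : nat) : (0 < y)%N -> (e * y + a < (e + a + 1) * y)%N.
    by move=> y0; rewrite !mulnDl mul1n; have := leq_pmulr a y0; lia.
  exact: ar.
have mY : (vm c n <= th c * Y)%N by rewrite /vm leq_mul2l leqnSn orbT.
have Y1 : (0 < Y)%N by [].
set B := (n * al)%N in h1 h2 *.
apply: leq_trans (_ : tot * ((1 + G * D) * Y) + (C2 * (B * Y ^ k2)) * (th c * Y) <= _)%N.
  apply: leq_add; last by apply: leq_mul.
  rewrite -{1}[tot]muln1 -mulnDr leq_mul2l; apply/orP; right; rewrite mulnDl mul1n.
  by apply: leq_add => //; rewrite -mulnA leq_mul2l tl orbT.
apply: leq_trans (_ : (C1 * (B * Y ^ k1)) * ((1 + G * D) * Y) +
   (C2 * (B * Y ^ k2)) * (th c * Y) <= _)%N; first by rewrite leq_add2r leq_mul2r h1 orbT.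
have a1 : (Y ^ k1 * Y <= Y ^ (k1 + k2 + 1))%N by rewrite -expnSr leq_pexp2l //; lia.
have a2 : (Y ^ k2 * Y <= Y ^ (k1 + k2 + 1))%N by rewrite -expnSr leq_pexp2l //; lia.
rewrite [X in (_ <= X)%N]mulnDl; apply: leq_add.
  have -> : (C1 * (B * Y ^ k1) * ((1 + G * D) * Y) = C1 * (1 + G * D) * (B * (Y ^ k1 * Y)))%N.
    by move: (Y ^ k1)%N (1 + G * D)%N => u u'; lia.
  by rewrite !leq_mul2l a1 !orbT.
have -> : (C2 * (B * Y ^ k2) * (th c * Y) = C2 * th c * (B * (Y ^ k2 * Y)))%N.
  by move: (Y ^ k2)%N (th c) => u u'; lia.
by rewrite !leq_mul2l a2 !orbT.
Qed.

(** * Real bounds and the embedding *)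

Section Reals.
Variable R : realType.

(** The square root of e is at most 2, being the inverse of [expR (- 2^-1)], which is at least
    1/2. *)
Lemma trunc_log_le_ln n : (0 < n)%N -> (vL n)%:R <= 2 * ln n%:R :> R.
Proof.
move=> n0; have e2 : expR (2^-1) <= 2 :> R.
  have p := expR_gt0 (2^-1 : R); have := expR_ge1Dx (- 2^-1 : R); rewrite expRN => h.
  have : (1 + - 2^-1) * expR 2^-1 <= 1 :> R by rewrite -ler_pdivlMr // div1r.
  lra.
have : expR ((vL n)%:R * 2^-1) <= n%:R :> R.
  rewrite expRM_natl; apply: le_trans (_ : 2 ^+ vL n <= _).
    by apply: lerXn2r => //; rewrite nnegrE ?expR_ge0.
  by rewrite -natrX ler_nat trunc_logP.
by rewrite -ler_ln ?posrE ?expR_gt0 ?ltr0n // expRK; lra.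
Qed.

Lemma norm_nat_sub (p q : nat) : `|p%:R - q%:R| = (ndist p q)%:R :> R.
Proof.
case: (leqP p q) => h.
  have -> : ndist p q = (q - p)%N by rewrite /ndist; lia.
  by rewrite distrC -natrB // normr_nat.
have -> : ndist p q = (p - q)%N by rewrite /ndist; lia.
by rewrite -natrB ?normr_nat // ltnW.
Qed.

Lemma bigmin_le_in (I : eqType) (r : seq I) (a : R) (F : I -> R) i : i \in r ->
  \big[Num.min/a]_(j <- r) F j <= F i.
Proof.
elim: r => [//|a' r IH]; rewrite in_cons big_cons ge_min => /orP[/eqP->|/IH->].
  by rewrite lexx.
by rewrite orbT.
Qed.

Lemma time_real (n al C k T : nat) : (0 < n)%N -> (0 < al)%N ->
  (T <= C * (n * al * (vL n).+1 ^ k))%N ->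
  T%:R <= (C * 2 ^ k)%:R * ((n * al)%:R * (1 + ln ((n * al)%:R : R)) ^+ k) :> R.
Proof.
move=> n0 al0 h; apply: le_trans (_ : (C * (n * al * (vL n).+1 ^ k))%:R <= _).
  by rewrite ler_nat.
have f1 : ln n%:R <= ln (n * al)%:R :> R.
  by rewrite ler_ln ?posrE ?ltr0n ?muln_gt0 ?n0 // ler_nat leq_pmulr.
have h2 := trunc_log_le_ln n0; set g := 1 + ln (n * al)%:R.
have Y : (vL n).+1%:R <= 2 * g by rewrite /g -natr1; move: h2 f1; lra.
have Yk : (vL n).+1%:R ^+ k <= (2 * g) ^+ k.
  by apply: lerXn2r => //; rewrite nnegrE // (le_trans _ Y).
have -> : (C * 2 ^ k)%:R * ((n * al)%:R * g ^+ k) = C%:R * ((n * al)%:R * (2 * g) ^+ k).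
  by rewrite [(C * _)%:R]natrM natrX exprMn; ring.
have -> : (C * (n * al * (vL n).+1 ^ k))%:R = C%:R * ((n * al)%:R * (vL n).+1%:R ^+ k) :> R.
  by rewrite natrM [(n * al * _)%:R]natrM natrX.
by apply: ler_wpM2l => //; apply: ler_wpM2l.
Qed.

Section Embedding.
Variables (b c n s al M : nat) (v : 'I_n -> 'rV[int]_al).
Hypotheses (s_gt0 : (0 < s)%N) (le_sn : (s <= n)%N) (al_gt0 : (0 < al)%N) (le_al : (al <= n)%N).
Hypothesis le_M : (M <= n ^ b)%N.
Hypothesis v_bound : forall (i : 'I_n) (k : 'I_al), `|v i 0 k| <= M%:Z.
Local Notation m0 := (input_memory s M v).
Local Notation P := (main_cmd b c).
Local Notation A := (window le_sn (fun i => map_mx (intr : int -> R) (v i))).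
Local Notation temd i j := (TEMD (@l1dist R al) (A i) (A j)).
Local Notation wd i j := (@wd n s al M v i j).

Lemma coord_ndist (p q : 'I_n) (k : 'I_al) :
  `|(v p 0 k)%:~R - (v q 0 k)%:~R| = (ndist (coord s M v p k) (coord s M v q k))%:R :> R.
Proof.
rewrite /coord /inp !input_cell -mulrzBr -intr_norm.
have hp := v_bound p k; have hq := v_bound q k.
have -> : `|v p 0 k - v q 0 k| =
    Posz (ndist (absz (v p 0 k + Posz M)) (absz (v q 0 k + Posz M))).
  by rewrite /ndist; lia.
by rewrite -pmulrn.
Qed.

Lemma temd_costE (i j : 'I_(n - s + 1)) (tau : 'S_s) :
  temd_cost (@l1dist R al) (A i) (A j) tau = (match_cost (@dnat n s al M v) i j tau)%:R.
Proof.
rewrite /temd_cost /match_cost natr_sum; apply: eq_bigr => k _; rewrite natr_min.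
congr (Num.min _ _); rewrite /l1dist /l1norm /dnat natr_sum; apply: eq_bigr => q _.
by rewrite /window !mxE coord_ndist.
Qed.

Lemma temdE (i j : 'I_(n - s + 1)) : temd i j = (wd i j)%:R / s%:R.
Proof.
rewrite /TEMD mulrC; congr (_ / _); apply/le_anti/andP; split.
  have [tau tE] := wdist_ex s (@dnat n s al M v) i j.
  have tE' : wd i j = match_cost (@dnat n s al M v) i j tau := tE.
  rewrite tE' -temd_costE.
  by apply: bigmin_le_in; rewrite mem_index_enum.
have H tau : (wd i j)%:R <= temd_cost (@l1dist R al) (A i) (A j) tau.
  by rewrite temd_costE ler_nat wdist_le.
apply: (big_ind (fun y => (wd i j)%:R <= y)); first exact: H.
  by move=> a a' ha ha'; rewrite le_min ha ha'.
by move=> tau _; exact: H.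
Qed.

Lemma run_main T (r : seq bool) : (run_time b c n s al <= T)%N ->
  halts_within P m0 T r /\ exists r', represents false
     (sem out_prog (sem build_prog (sem (params_prog c) (sem logs_prog
        (sem header_prog (init_state b c s M v r)))))) (cf_mem (run P m0 T r)) r'.
Proof.
rewrite /run_time => hT.
have [m' [r' [k [ex kl mb rep]]]] := main_exec c s_gt0 le_sn al_gt0 le_al le_M v_bound r.
have [_ H] := exec_run (bound_X_gt1 b c n) ex mb (leqnn _) (cmd_const_le_bound_X b c n).
have [w' it wl] := H [::] 0%N.
have kT : (k <= T)%N by apply: leq_trans kl _; apply: leq_trans hT; apply: leq_addr.
have E : run P m0 T r = Config [::] m' r' w'.
  by rewrite /run -(subnK kT) iterD it iter_step_done.
split; last by exists r'; rewrite E.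
split; rewrite E //=; apply: leq_trans wl _; rewrite add0n.
apply: leq_trans hT; apply: leq_trans (leq_addl _ _).
by rewrite leq_mul2r kl orbT.
Qed.

Lemma inp_header : [/\ inp s M v 0 = (n + M)%N, inp s M v 1 = (s + M)%N,
  inp s M v 2 = (al + M)%N & inp s M v 3 = (M + M)%N].
Proof. by rewrite /inp /=; split; lia. Qed.

Lemma coord_le i k : (i < n)%N -> (k < al)%N -> (coord s M v i k <= 2 * M)%N.
Proof.
move=> ni ka; have := v_bound (Ordinal ni) (Ordinal ka).
have := input_cell s M v (Ordinal ni) (Ordinal ka); rewrite /coord /inp /= => ->.
by move: (v _ _ _) => z; lia.
Qed.

Section Run.
Variable T : nat.
Hypotheses (hT : (run_time b c n s al + vEE c n s al * vm c n <= T)%N) (n_gt1 : (1 < n)%N).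

(** Numerators carry the factor [vF], repaying the contraction, and the denominator [s] restores the
    normalisation of [TEMD]. *)
Lemma output_good (r : T.-tuple bool) (i j : 'I_(n - s + 1)) (i' j' : 'I_(vN n s)) :
  i = i' :> nat -> j = j' :> nat ->
  @good b c n s al M v (word_of (vEE c n s al) (vm c n) r) i' j' ->
  exists S : nat, [/\ (wd i j <= vF c n * S)%N, (S <= vt c n * (8 * vLv s * wd i j))%N &
    l1norm (output_vector R (vt c n) (cf_mem (run P m0 T r)) i -
            output_vector R (vt c n) (cf_mem (run P m0 T r)) j) = (vF c n * S)%:R / s%:R].
Proof.
move=> ii jj /boolp.asboolP G.
have [_ [r' rep]] := @run_main T r (leq_trans (leq_addr _ _) hT).
have [h0 h1 h2 h3] := inp_header.
have [D [D1 D2 D3]] := @final_sem b c n s al M (coord s M v) (init_state b c s M v r)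
  s_gt0 le_sn al_gt0 le_al le_M h0 h1 h2 h3 (fun _ _ _ _ => erefl) coord_le erefl
  (fun k => bit_lt2 r k) (fun q k (h : (5 < q)%N) => ltac:(by do 6?[case: q h => [//|q] h])) n_gt1.
have wE : words c n s al (init_state b c s M v r) = @rn c n s al (word_of (vEE c n s al) (vm c n) r).
  apply: boolp.funext => k; rewrite /words.
  case: ifP => h; first by rewrite (rnE _ h) ffunE.
  by rewrite /rn insubN // h.
rewrite wE in D1; have [g1 g2] := G D D1.
move: D2 D3 rep; set st5 := sem out_prog _ => D2 D3 rep.
have mo k a : st5 2 k = a.+1 -> cf_mem (run P m0 T r) (Posz k) = Posz a.
  by move=> e; have := rep_out rep k; rewrite e => -[//|->].
exists (\sum_(z < vt c n) ndist (D z i') (D z j'))%N; rewrite ii jj; split=> //.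
have cell (p : 'I_(vN n s)) (z : 'I_(vt c n)) :
    cf_mem (run P m0 T r) (1 + p * vt c n + z)%N%:Z = Posz (D z p * vF c n).
  by apply: mo; apply: D2.
rewrite /l1norm big_distrr /= natr_sum mulr_suml; apply: eq_bigr => z _.
rewrite !mxE !cell (mo 0%N s D3) -!pmulrn -mulrBl normrM normfV normr_nat norm_nat_sub.
by congr (_%:R / _); rewrite /ndist -!mulnBl -mulnDl mulnC.
Qed.

Lemma failure_le : 3 * 2 ^- vK c n <= (n%:R ^+ c)^-1 :> R.
Proof.
have L0 : (0 < vL n)%N by exact: L_gt0.
have n0 : 0 < n%:R :> R by rewrite ltr0n ltnW.
rewrite ler_pdivrMr ?exprn_gt0 // mulrC ler_pdivlMr ?exprn_gt0 // -!natrX -natrM ler_nat.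
apply: leq_trans (_ : 2 ^ (3 * vL n) * 2 ^ (2 * vL n * c) <= _)%N.
  apply: leq_mul.
    by apply: leq_trans (_ : 2 ^ 3 <= _)%N => //; rewrite leq_exp2l //; lia.
  rewrite expnM; case: c => [//|c']; rewrite leq_exp2r //.
  by apply: leq_trans (ltnW (n_lt_pow n)) _; rewrite leq_exp2l //; lia.
by rewrite -expnD leq_exp2l // /vK /CK; lia.
Qed.

(** [vF], [vt] and [8 * vLv] contribute [L ^ 3], [L ^ 2] and [L], with constant [32 * CF * CB] as
    [vLv <= 2 * L]; replacing [L] by [2 * ln n] multiplies it by [2 ^ 6]. *)
Lemma distortion_le (i j : 'I_(n - s + 1)) S :
  (wd i j <= vF c n * S)%N -> (S <= vt c n * (8 * vLv s * wd i j))%N ->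
  (temd i j <= (vF c n * S)%:R / s%:R) && ((vF c n * S)%:R / s%:R <=
     temd i j * ((2048 * CF c * CB c)%:R * ln (n%:R : R) ^+ 6)).
Proof.
move=> h1 h2; have s0 : 0 < s%:R :> R by rewrite ltr0n.
have L0 : (0 < vL n)%N by exact: L_gt0.
rewrite temdE ler_pM2r ?invr_gt0 // ler_nat h1 /= mulrAC ler_pM2r ?invr_gt0 //.
have X : (vF c n * (vt c n * (8 * vLv s)) <= 32 * CF c * CB c * vL n ^ 6)%N.
  apply: leq_trans (_ : vF c n * (vt c n * (8 * (2 * vL n))) <= _)%N.
    do 3!(apply: leq_mul => //).
    apply: leq_trans (_ : (vL n).+1 <= _)%N; last by lia.
    by rewrite /vLv ltnS leq_trunc_log.
  by rewrite /vF /vt /vRB !expnS expn0; apply: eq_leq; lia.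
apply: le_trans (_ : (wd i j * (32 * CF c * CB c * vL n ^ 6))%:R <= _).
  rewrite ler_nat; apply: leq_trans (_ : wd i j * (vF c n * (vt c n * (8 * vLv s))) <= _)%N.
    apply: leq_trans (_ : vF c n * (vt c n * (8 * vLv s * wd i j)) <= _)%N.
      by rewrite leq_mul2l h2 orbT.
    by apply: eq_leq; move: (wd i j) (vF c n) (vt c n) (vLv s) => x1 x2 x3 x4; lia.
  by rewrite leq_mul2l X orbT.
rewrite natrM ler_wpM2l // (_ : (2048 * CF c * CB c = 32 * CF c * CB c * 64)%N); last by lia.
rewrite natrM [(_ * 64)%N%:R]natrM natrX -mulrA ler_wpM2l //.
have h := trunc_log_le_ln (ltnW n_gt1).
apply: le_trans (_ : (2 * ln n%:R) ^+ 6 <= _).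
  by apply: lerXn2r => //; rewrite nnegrE // (le_trans _ h).
by rewrite exprMn -natrX.
Qed.

Lemma success_prob (i j : 'I_(n - s + 1)) : 1 - (n%:R ^+ c)^-1 <=
  prob R (fun r : T.-tuple bool =>
    let q := output_vector R (vt c n) (cf_mem (run P m0 T r)) in
    (temd i j <= l1norm (q i - q j)) &&
    (l1norm (q i - q j) <= temd i j * ((2048 * CF c * CB c)%:R * ln (n%:R : R) ^+ 6))).
Proof.
have iN (p : 'I_(n - s + 1)) : (p < vN n s)%N by rewrite /vN -[(n - s).+1]addn1; exact: ltn_ord.
pose i' := Ordinal (iN i); pose j' := Ordinal (iN j).
have G : 1 - 3 * 2 ^- vK c n <= Pr R (fun w => @good b c n s al M v w i' j').
  exact: Pr_good.
apply: le_trans (_ : 1 - 3 * 2 ^- vK c n <= _); first by rewrite lerD2l lerN2 failure_le.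
apply: le_trans G _.
have hE : (vEE c n s al * vm c n <= T)%N by apply: leq_trans hT; apply: leq_addl.
rewrite -(prob_words R hE); apply: prob_sub => r g.
have [S [w1 w2 nE]] := @output_good r i j i' j' erefl erefl g.
by rewrite /= nE distortion_le.
Qed.

End Run.

(** For [n = 1] there is a single window, and [vt] is 0, so both sides vanish. *)
Lemma success_prob1 T (i j : 'I_(n - s + 1)) (C : R) : (n <= 1)%N -> 1 - (n%:R ^+ c)^-1 <=
  prob R (fun r : T.-tuple bool =>
    let q := output_vector R (vt c n) (cf_mem (run P m0 T r)) in
    (temd i j <= l1norm (q i - q j)) && (l1norm (q i - q j) <= temd i j * C)).
Proof.
move=> n1; have nE : n = 1%N by move: s_gt0 le_sn n1; lia.
have ij : i = j.
  by apply: val_inj; have := ltn_ord i; have := ltn_ord j; move: s_gt0 le_sn n1 => /=; lia.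
have t0 : temd i j = 0 by rewrite ij temdE wd0 mul0r.
rewrite t0 mul0r.
apply: le_trans (_ : 1 <= _); first by rewrite gerBl invr_ge0 exprn_ge0.
have vt0 : vt c n = 0%N by rewrite /vt /vL nE.
rewrite /prob ler_pdivlMr ?exprn_gt0 // mul1r -natrX ler_nat.
rewrite (_ : (2 ^ T)%N = #|{: T.-tuple bool}|); last by rewrite card_tuple card_bool.
apply: subset_leq_card; apply/subsetP => r _; rewrite unfold_in /= ij subrr /l1norm.
by rewrite big1 ?lexx // => k _; rewrite mxE normr0.
Qed.

End Embedding.
End Reals.

Theorem theorem2 (R : realType) (b c : nat) :
  exists (C_dim C_dist C_time : R) (k_dist k_time : nat)
         (t : nat -> nat) (P : cmd),
    (forall n : nat, (0 < n)%N -> (t n)%:R <= C_dim * ln (n%:R : R) ^+ 2) /\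
    forall (n s alpha M : nat) (v : 'I_n -> 'rV[int]_alpha)
           (s_gt0 : (0 < s)%N) (le_sn : (s <= n)%N)
           (alpha_gt0 : (0 < alpha)%N) (le_alpha : (alpha <= n)%N)
           (le_M : (M <= n ^ b)%N)
           (v_bound : forall (i : 'I_n) (k : 'I_alpha), `|v i 0 k| <= M%:Z),
      let m0 := input_memory s M v in
      let A := window le_sn (fun i => map_mx (intr : int -> R) (v i)) in
      let temd i j := TEMD (@l1dist R alpha) (A i) (A j) in
      let f := (n * alpha)%:R : R in
      exists T : nat,
        [/\ T%:R <= C_time * (f * (1 + ln f) ^+ k_time),
            forall r : T.-tuple bool, halts_within P m0 T r
          & forall i j : 'I_(n - s + 1),
              1 - (n%:R ^+ c)^-1 <=
              prob R (fun r : T.-tuple bool =>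
                let q := output_vector R (t n) (cf_mem (run P m0 T r)) in
                (temd i j <= l1norm (q i - q j)) &&
                (l1norm (q i - q j) <=
                   temd i j * (C_dist * ln (n%:R : R) ^+ k_dist)))].
Proof.
have [C [k Htime]] := time_bound b c.
(* The dimension is [2 * CB * L ^ 2], and [L <= 2 * ln n] turns 2 into 8; the distortion data come
   from [distortion_le]. *)
exists (8 * CB c)%:R, (2048 * CF c * CB c)%:R, (C * 2 ^ k)%:R, 6%N, k, (vt c), (main_cmd b c).
split.
  move=> n n0; have h := trunc_log_le_ln R n0.
  apply: le_trans (_ : (2 * CB c)%:R * (2 * ln n%:R) ^+ 2 <= _); last first.
    by rewrite exprMn -natrX mulrA -natrM; rewrite (_ : (8 * CB c = 2 * CB c * 2 ^ 2)%N) //; lia.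
  apply: le_trans (_ : (2 * CB c)%:R * (vL n)%:R ^+ 2 <= _).
    by rewrite -natrX -natrM ler_nat /vt /vRB -mulnn; apply: eq_leq; lia.
  by apply: ler_wpM2l => //; apply: lerXn2r => //; rewrite nnegrE // (le_trans _ h).
move=> n s al M v s_gt0 le_sn al_gt0 le_al le_M v_bound m0 A temd f.
exists (run_time b c n s al + vEE c n s al * vm c n)%N; split.
- have n0 : (0 < n)%N := leq_trans s_gt0 le_sn.
  by apply: time_real => //; exact: Htime.
- move=> r; have h : (run_time b c n s al <= run_time b c n s al + vEE c n s al * vm c n)%N.
    exact: leq_addr.
  by have [] := run_main s_gt0 le_sn al_gt0 le_al le_M v_bound r h.
- move=> i j; have [n1|n1] := leqP n 1; first exact: success_prob1.
  exact: success_prob.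
Qed.
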